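(* Let $\mathcal{Q}\subset\mathbb{P}^2=\mathbb{P}^2_{\mathbb{C}}$ be an irreducible plane quartic whose singularities are exactly two nodes $x_1,x_2$ and one cusp $y$. Let $z_o$ be a smooth point of $\mathcal{Q}$ and let $l_{z_o}$ be the tangent line to $\mathcal{Q}$ at $z_o$. For $i=1,\dots,6$ let $n_i$ be the number of weak contact conics to $\mathcal{Q}$ of type $i$ that are tangent to $\mathcal{Q}$ at $z_o$. Then, according to the position (s), (b), (sc) or (sn) of $l_{z_o}$, the numbers $n_i$ are as follows: (I) in case (s): $(n_1,n_2,n_3,n_4,n_5,n_6)=(3,4,4,1,1,1)$; (II) in case (b): $(n_1,n_2,n_3,n_4,n_5,n_6)=(1,2,2,0,1,0)$; (III) in case (sc): $(n_1,n_2,n_3,n_4,n_5,n_6)=(0,2,0,1,0,0)$; (IV) in case (sn): $(n_1,n_2,n_3,n_4,n_5,n_6)=(1,0,2,0,0,1)$.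
   Context: $I_x(\cdot,\cdot)$ denotes the intersection multiplicity at $x$ of two plane curves. A smooth conic $\mathcal{C}\subset\mathbb{P}^2$ is a weak contact conic to a reduced plane curve $\mathcal{B}$ if $I_x(\mathcal{B},\mathcal{C})$ is even for every $x\in\mathcal{B}\cap\mathcal{C}$. Types. For a weak contact conic $\mathcal{C}$ to $\mathcal{Q}$ passing through the smooth point $z_o$ of $\mathcal{Q}$, let $(\mathcal{Q}\cap\mathcal{C})_{sing}$ be the set of singular points of $\mathcal{Q}$ lying on $\mathcal{C}$. The conic $\mathcal{C}$ is of type 1 if $(\mathcal{Q}\cap\mathcal{C})_{sing}=\{y\}$; type 2 if it is $\{x_1\}$ or $\{x_2\}$; type 3 if it is $\{x_1,y\}$ or $\{x_2,y\}$; type 4 if it is $\{x_1,x_2\}$; type 5 if it is $\{x_1,x_2,y\}$; type 6 if it is empty. Positions of $l_{z_o}$: (s) $I_{z_o}(l_{z_o},\mathcal{Q})=2$ or $3$, and $l_{z_o}$ meets $\mathcal{Q}$ transversely at the other point(s); (b) $l_{z_o}$ is a bitangent line (tangent to $\mathcal{Q}$ at $z_o$ and at another smooth point of $\mathcal{Q}$), or $I_{z_o}(l_{z_o},\mathcal{Q})=4$; (sc) $I_{z_o}(l_{z_o},\mathcal{Q})=2$ and $l_{z_o}$ passes through the cusp of $\mathcal{Q}$; (sn) $I_{z_o}(l_{z_o},\mathcal{Q})=2$ and $l_{z_o}$ passes through one of the two nodes of $\mathcal{Q}$. *)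

(* Defs.v *)
From mathcomp Require Import all_boot all_order all_algebra.
From mathcomp Require Import mpoly complex reals.

Set Implicit Arguments.
Unset Strict Implicit.
Unset Printing Implicit Defensive.

Import GRing.Theory.
Local Open Scope ring_scope.

(* Points of P^2 are nonzero vectors p : 'rV[K]_3 (p 0 : 'I_3 -> K is the
   tuple of homogeneous coordinates), and plane curves are nonzero forms in
   three variables, both up to a nonzero scalar. *)
Definition proportional (K : fieldType) (V : lmodType K) (u v : V) : Prop :=
  exists2 a : K, a != 0 & v = a *: u.

(* The number of classes modulo [proportional] of elements satisfying P;
   meant for predicates P that are invariant under scaling. *)
Definition number_up_to_scaling (K : fieldType) (V : lmodType K)
    (P : V -> Prop) (n : nat) : Prop :=
  exists s : 'I_n -> V,
    [/\ forall i, P (s i),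
        forall i j, proportional (s i) (s j) -> i = j
      & forall v, P v -> exists i, proportional (s i) v].

Definition irreducible_elt (A : idomainType) (f : A) : Prop :=
  [/\ f != 0, f \isn't a GRing.unit
    & forall a b : A, f = a * b -> a \is a GRing.unit \/ b \is a GRing.unit].

Definition plane_curve (K : closedFieldType) (d : nat) (F : {mpoly K[3]})
  : Prop := (F \is d.-homog) /\ F != 0.

Definition on_curve (K : closedFieldType) (F : {mpoly K[3]}) (p : 'rV[K]_3)
  : Prop := p != 0 /\ F.@[p 0] = 0.

Definition singular_point (K : closedFieldType) (F : {mpoly K[3]})
    (p : 'rV[K]_3) : Prop :=
  on_curve F p /\ (forall i, (F^`M(i)).@[p 0] = 0).

Definition smooth_point (K : closedFieldType) (F : {mpoly K[3]})
    (p : 'rV[K]_3) : Prop :=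
  on_curve F p /\ (exists i, (F^`M(i)).@[p 0] != 0).

(* The local ring of P^2 at p: fractions of forms of the same degree with
   denominator not vanishing at p. *)
Definition local_ring (K : closedFieldType) (p : 'rV[K]_3)
    (h : {fraction {mpoly K[3]}}) : Prop :=
  exists (d : nat) (A B : {mpoly K[3]}),
    [/\ A \is d.-homog, B \is d.-homog, B.@[p 0] != 0
      & h = tofrac A / tofrac B].

(* The ideal of the local ring at p generated by local equations of F = 0
   and G = 0, for forms F and G of possibly different degrees. *)
Definition local_ideal (K : closedFieldType) (F G : {mpoly K[3]})
    (p : 'rV[K]_3) (h : {fraction {mpoly K[3]}}) : Prop :=
  exists (d : nat) (A B D : {mpoly K[3]}),
    [/\ F * A \is d.-homog, G * B \is d.-homog, D \is d.-homog,
        D.@[p 0] != 0 & h = tofrac (F * A + G * B) / tofrac D].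

(* I_p(F, G) = m: the quotient of the local ring at p by the ideal of F and G
   has a basis of m elements over K. No m exists when F and G have a common
   component through p. *)
Definition intersection_mult (K : closedFieldType) (F G : {mpoly K[3]})
    (p : 'rV[K]_3) (m : nat) : Prop :=
  exists e : 'I_m -> {fraction {mpoly K[3]}},
    let comb (c : 'I_m -> K) := \sum_i tofrac (c i)%:MP * e i in
    [/\ forall i, local_ring p (e i),
        forall c, local_ideal F G p (comb c) -> forall i, c i = 0
      & forall h, local_ring p h -> exists c, local_ideal F G p (h - comb c)].

Definition tangent_line (K : closedFieldType) (F : {mpoly K[3]})
    (p : 'rV[K]_3) : {mpoly K[3]} :=
  \sum_i (F^`M(i)).@[p 0] *: 'X_i.

Definition tangent_at (K : closedFieldType) (F G : {mpoly K[3]})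
    (p : 'rV[K]_3) : Prop :=
  [/\ smooth_point F p, smooth_point G p
    & proportional (tangent_line F p) (tangent_line G p)].

Definition transverse_at (K : closedFieldType) (F G : {mpoly K[3]})
    (p : 'rV[K]_3) : Prop :=
  [/\ smooth_point F p, smooth_point G p
    & ~ proportional (tangent_line F p) (tangent_line G p)].

(* Twice the degree 2 part in X of F(p + X). When p is singular on F, this is
   the equation of the tangent cone at p, as a union of lines through p. *)
Definition tangent_cone (K : closedFieldType) (F : {mpoly K[3]})
    (p : 'rV[K]_3) : {mpoly K[3]} :=
  \sum_i \sum_j (F^`M(i)^`M(j)).@[p 0] *: ('X_i * 'X_j).

(* A double point with two distinct tangent lines. *)
Definition node (K : closedFieldType) (F : {mpoly K[3]}) (p : 'rV[K]_3)
  : Prop :=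
  singular_point F p /\
  exists L M : {mpoly K[3]},
    [/\ plane_curve 1 L, plane_curve 1 M, ~ proportional L M
      & tangent_cone F p = L * M].

(* An ordinary cusp (A_2): a double point with a single tangent line, which
   meets the curve with multiplicity exactly 3 there. *)
Definition cusp (K : closedFieldType) (F : {mpoly K[3]}) (p : 'rV[K]_3)
  : Prop :=
  singular_point F p /\
  exists L : {mpoly K[3]},
    [/\ plane_curve 1 L, tangent_cone F p = L ^+ 2
      & intersection_mult L F p 3].

Definition smooth_conic (K : closedFieldType) (G : {mpoly K[3]}) : Prop :=
  plane_curve 2 G /\ (forall p, on_curve G p -> smooth_point G p).

Definition weak_contact_conic (K : closedFieldType) (F G : {mpoly K[3]})
  : Prop :=
  smooth_conic G /\
  forall p, on_curve F p -> on_curve G p ->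
    exists2 m, intersection_mult F G p m & ~~ odd m.

Definition common_sing_is (K : closedFieldType) (F G : {mpoly K[3]})
    (s : seq 'rV[K]_3) : Prop :=
  forall p, (singular_point F p /\ on_curve G p) <->
            (exists2 q, q \in s & proportional q p).

Definition conic_type (K : closedFieldType) (F : {mpoly K[3]})
    (x1 x2 y : 'rV[K]_3) (i : nat) (G : {mpoly K[3]}) : Prop :=
  match i with
  | 1 => common_sing_is F G [:: y]
  | 2 => common_sing_is F G [:: x1] \/ common_sing_is F G [:: x2]
  | 3 => common_sing_is F G [:: x1; y] \/ common_sing_is F G [:: x2; y]
  | 4 => common_sing_is F G [:: x1; x2]
  | 5 => common_sing_is F G [:: x1; x2; y]
  | 6 => common_sing_is F G [::]
  | _ => False
  end.

Definition position_s (K : closedFieldType) (F : {mpoly K[3]})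
    (z : 'rV[K]_3) : Prop :=
  let l := tangent_line F z in
  (intersection_mult l F z 2 \/ intersection_mult l F z 3) /\
  forall p, on_curve l p -> on_curve F p -> ~ proportional z p ->
    transverse_at l F p.

Definition position_b (K : closedFieldType) (F : {mpoly K[3]})
    (z : 'rV[K]_3) : Prop :=
  let l := tangent_line F z in
  (exists2 p, ~ proportional z p & tangent_at l F p) \/
  intersection_mult l F z 4.

Definition position_sc (K : closedFieldType) (F : {mpoly K[3]})
    (y z : 'rV[K]_3) : Prop :=
  let l := tangent_line F z in
  intersection_mult l F z 2 /\ on_curve l y.

Definition position_sn (K : closedFieldType) (F : {mpoly K[3]})
    (x1 x2 z : 'rV[K]_3) : Prop :=
  let l := tangent_line F z in
  intersection_mult l F z 2 /\ (on_curve l x1 \/ on_curve l x2).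

Definition conic_count (K : closedFieldType) (F : {mpoly K[3]})
    (x1 x2 y z : 'rV[K]_3) (i n : nat) : Prop :=
  number_up_to_scaling
    (fun G : {mpoly K[3]} =>
       [/\ weak_contact_conic F G, tangent_at F G z
         & conic_type F x1 x2 y i G]) n.

(* Main.v *)
Require Import Defs.
From HB Require Import structures.
From mathcomp Require Import all_boot all_order all_algebra.
From mathcomp Require Import fingroup perm mpoly complex reals boolp ring zify.

Set Implicit Arguments.
Unset Strict Implicit.
Unset Printing Implicit Defensive.

Import GRing.Theory Num.Theory.
Local Open Scope ring_scope.

(** * Finite codimension *)

Section Codimension.

Variables (K E : fieldType) (iota : {rmorphism K -> E}).
Implicit Types (U V W : E -> Prop).

Definition subspace V : Prop :=
  [/\ V 0, forall x y, V x -> V y -> V (x + y)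
    & forall c x, V x -> V (iota c * x)].

Definition lincomb n (e : 'I_n -> E) (c : 'I_n -> K) : E :=
  \sum_i iota (c i) * e i.

Definition free_mod W n (e : 'I_n -> E) : Prop :=
  forall c, W (lincomb e c) -> forall i, c i = 0.

Definition spans_mod W V n (e : 'I_n -> E) : Prop :=
  forall x, V x -> exists c, W (x - lincomb e c).

Definition codim W V n : Prop :=
  exists e : 'I_n -> E,
    [/\ forall i, V (e i), free_mod W e & spans_mod W V e].

Lemma subspaceN V x : subspace V -> V x -> V (- x).
Proof.
by case=> _ _ VZ Vx; rewrite -mulN1r -(rmorph1 iota) -rmorphN; apply: VZ.
Qed.

Lemma subspaceB V x y : subspace V -> V x -> V y -> V (x - y).
Proof. by move=> sV Vx Vy; case: (sV) => _ VD _; apply: VD (subspaceN sV Vy). Qed.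

Lemma subspace_sum V n (f : 'I_n -> E) :
  subspace V -> (forall i, V (f i)) -> V (\sum_i f i).
Proof.
by case=> V0 VD _ Vf; elim/big_ind: _.
Qed.

Lemma subspace_lincomb V n (e : 'I_n -> E) c :
  subspace V -> (forall i, V (e i)) -> V (lincomb e c).
Proof. by move=> sV Ve; apply: subspace_sum => // i; case: sV => _ _; apply. Qed.

Lemma free_le_spanning W V m n (e : 'I_m -> E) (f : 'I_n -> E) :
  subspace W -> (forall i, V (e i)) -> free_mod W e -> spans_mod W V f ->
  (m <= n)%N.
Proof.
move=> sW Ve fe sf.
have /choice [P HP] i : exists c, W (e i - lincomb f c) by apply/sf/Ve.
rewrite leqNgt; apply/negP => lt_nm.
pose A : 'M[K]_(m, n) := \matrix_(i, j) P i j.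
have : kermx A != 0.
  rewrite -mxrank_eq0 mxrank_ker subn_eq0 -ltnNge.
  by apply: leq_ltn_trans lt_nm; apply: rank_leq_col.
case/rowV0Pn => c /sub_kermxP cA /rV0Pn [i0].
rewrite (fe (fun i => c 0 i)) ?eqxx //.
have -> : lincomb e (fun i => c 0 i) =
    \sum_i iota (c 0 i) * (e i - lincomb f (P i)).
  rewrite /lincomb [RHS](eq_bigr (fun i => iota (c 0 i) * e i -
      \sum_j iota (c 0 i * P i j) * f j)); last first.
    move=> i _; rewrite mulrBr mulr_sumr; congr (_ - _).
    by apply: eq_bigr => j _; rewrite rmorphM mulrA.
  rewrite sumrB exchange_big /= [X in _ - X]big1 ?subr0 // => j _.
  rewrite -mulr_suml -rmorph_sum.
  have -> : \sum_i c 0 i * P i j = (c *m A) 0 j.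
    by rewrite mxE; apply: eq_bigr => i _; rewrite mxE.
  by rewrite cA mxE rmorph0 mul0r.
by apply: subspace_sum => // i; case: (sW) => _ _; apply; apply: HP.
Qed.

Lemma codim_uniq W V m n : subspace W -> codim W V m -> codim W V n -> m = n.
Proof.
move=> sW [e [Ve fe se]] [f [Vf ff sf]]; apply/eqP; rewrite eqn_leq.
by rewrite (free_le_spanning sW Ve fe sf) (free_le_spanning sW Vf ff se).
Qed.

Lemma lincomb_split m n (e : 'I_(m + n) -> E) c :
  lincomb e c = lincomb (fun i => e (lshift n i)) (fun i => c (lshift n i)) +
                lincomb (fun i => e (rshift m i)) (fun i => c (rshift m i)).
Proof. by rewrite /lincomb big_split_ord. Qed.

Definition join m n (T : Type) (e : 'I_m -> T) (f : 'I_n -> T) (i : 'I_(m + n)) :=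
  match split i with inl j => e j | inr j => f j end.

Lemma join_lshift m n T (e : 'I_m -> T) (f : 'I_n -> T) i :
  join e f (lshift n i) = e i.
Proof. by rewrite /join -/(unsplit (inl i)) unsplitK. Qed.

Lemma join_rshift m n T (e : 'I_m -> T) (f : 'I_n -> T) i :
  join e f (rshift m i) = f i.
Proof. by rewrite /join -/(unsplit (inr i)) unsplitK. Qed.

Lemma eq_lincomb n (e e' : 'I_n -> E) c c' :
  e =1 e' -> c =1 c' -> lincomb e c = lincomb e' c'.
Proof. by move=> ee cc; apply: eq_bigr => i _; rewrite ee cc. Qed.

Lemma lincomb_join m n (e : 'I_m -> E) (f : 'I_n -> E) c :
  lincomb (join e f) c = lincomb e (fun i => c (lshift n i)) +
                         lincomb f (fun i => c (rshift m i)).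
Proof.
rewrite lincomb_split; congr (_ + _); apply: eq_lincomb => // i.
  exact: join_lshift.
exact: join_rshift.
Qed.

Lemma codim_add U W V m n :
  subspace U -> subspace W -> (forall x, U x -> W x) -> (forall x, W x -> V x) ->
  codim U W m -> codim W V n -> codim U V (m + n).
Proof.
move=> sU sW UW WV [e [We fe se]] [f [Vf ff sf]].
exists (join e f); split.
- by move=> i; rewrite /join; case: split => j; [apply/WV/We|apply: Vf].
- move=> c; rewrite lincomb_join => Uc.
  have c2 : forall j, c (rshift m j) = 0.
    apply: ff; move: (subspaceB sW (UW _ Uc) (subspace_lincomb (fun i => c (lshift n i)) sW We)).
    by rewrite addrC addKr.
  have c1 : forall j, c (lshift n j) = 0.
    apply: fe; move: Uc; rewrite [X in _ + X]big1 ?addr0 // => j _.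
    by rewrite c2 rmorph0 mul0r.
  by move=> i; rewrite -(splitK i); case: split => j /=; rewrite ?c1 ?c2.
- move=> x Vx; have [c2 Wx] := sf _ Vx; have [c1 Ux] := se _ Wx.
  exists (join c1 c2); have -> : lincomb (join e f) (join c1 c2) =
      lincomb e c1 + lincomb f c2.
    rewrite lincomb_join; congr (_ + _); apply: eq_lincomb => // i.
      exact: join_lshift.
    exact: join_rshift.
  by rewrite [lincomb e _ + _]addrC opprD addrA.
Qed.

(** A maximal family of [W] that is free modulo [U] spans. *)
Lemma codim_exists U W V n :
  subspace U -> subspace W -> (forall x, W x -> V x) -> codim U V n ->
  exists m, codim U W m.
Proof.
move=> sU sW WV [f [_ _ sf]].
pose P m := `[< exists e : 'I_m -> E, (forall i, W (e i)) /\ free_mod U e >].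
have P0 : exists m, P m.
  exists 0%N; apply/asboolP.
  by exists (fun=> 0); split=> [[]|c _ []].
have Pn m : P m -> (m <= n)%N.
  move=> /asboolP [e [We fe]].
  by apply: (free_le_spanning sU _ fe sf) => i; apply/WV/We.
case: (ex_maxnP P0 Pn) => m /asboolP [e [We fe]] m_max.
exists m, e; split=> // x Wx; apply: contrapT => Nx.
suff /m_max : P (m + 1)%N by rewrite addn1 ltnn.
apply/asboolP; exists (join e (fun=> x) : 'I_(m + 1) -> E); split.
  by move=> i; rewrite /join; case: split.
move=> c; rewrite lincomb_join; set c1 := fun i => c (lshift 1 i).
rewrite {2}/lincomb big_ord1; set c0 := c _ => Uc.
have c00 : c0 = 0.
  apply: contra_notP Nx => /eqP c0N0.
  exists (fun i => - (c0^-1 * c1 i)).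
  have := (let: And3 _ _ UZ := sU in UZ) c0^-1 _ Uc.
  rewrite mulrDr mulrA -rmorphM mulVf // rmorph1 mul1r.
  rewrite addrC mulr_sumr -sumrN; congr (U (_ + _)); apply: eq_bigr => i _.
  by rewrite rmorphN rmorphM mulNr opprK mulrA.
have c10 : forall i, c1 i = 0 by apply: fe; move: Uc; rewrite c00 rmorph0 mul0r addr0.
move=> i; rewrite -(splitK i); case: split => j /=; first exact: c10.
by rewrite (ord1 j).
Qed.

Lemma codim_refl V : subspace V -> codim V V 0.
Proof.
case=> V0 _ _; exists (fun=> 0); split=> [[]|c _ []|x Vx] //; exists (fun=> 0).
by rewrite /lincomb big_ord0 subr0.
Qed.

Definition scaled g V x : Prop := exists2 y, V y & x = g * y.

Lemma subspace_scaled g V : subspace V -> subspace (scaled g V).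
Proof.
case=> V0 VD VZ; split; first by exists 0; rewrite ?mulr0.
  by move=> _ _ [x Vx ->] [y Vy ->]; exists (x + y); rewrite ?mulrDr //; apply: VD.
by move=> c _ [x Vx ->]; exists (iota c * x); [apply: VZ|rewrite mulrCA].
Qed.

Lemma lincombZ g n (e : 'I_n -> E) c :
  lincomb (fun i => g * e i) c = g * lincomb e c.
Proof. by rewrite /lincomb mulr_sumr; apply: eq_bigr => i _; rewrite mulrCA. Qed.

Lemma codim_scaled g W V n :
  g != 0 -> codim W V n -> codim (scaled g W) (scaled g V) n.
Proof.
move=> g0 [e [Ve fe se]]; exists (fun i => g * e i); split.
- by move=> i; exists (e i).
- move=> c [x Wx]; rewrite lincombZ => /(mulfI g0) Ex.
  by apply: fe; rewrite Ex.
- move=> _ [x Vx ->]; have [c Wc] := se _ Vx.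
  by exists c, (x - lincomb e c); rewrite // lincombZ mulrBr.
Qed.

(** Multiplication by [g] maps the quotient [V / R] isomorphically to
    [gV / gR], so the index of [gR] in [V] can be counted through [R] or through
    [gV]. *)
Lemma codim_scaled_sub g R V d m :
  subspace R -> subspace V -> g != 0 ->
  (forall x, R x -> V x) -> (forall x, scaled g V x -> V x) ->
  (forall x, scaled g R x -> R x) ->
  codim R V d -> codim (scaled g V) V m -> codim (scaled g R) R m.
Proof.
move=> sR sV g0 RV gV gR cRV cgV.
have cgRV : codim (scaled g R) V (d + m).
  apply: codim_add (codim_scaled g0 cRV) cgV => //; try exact: subspace_scaled.
  by move=> _ [y Ry ->]; exists y => //; apply: RV.
have [k ck] := codim_exists (subspace_scaled g sR) sR RV cgRV.
have : codim (scaled g R) V (k + d).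
  by apply: codim_add ck cRV => //; apply: subspace_scaled.
move/(codim_uniq (subspace_scaled g sR) cgRV); rewrite addnC => /addIn -> //.
Qed.

End Codimension.

(** * Forms in three variables and linear changes of coordinates *)

Section EvaluationOfForms.

Variables (n : nat) (K : comNzRingType) (S : comNzRingType).
Variable f : {rmorphism K -> S}.
Implicit Types (A B : {mpoly K[n]}).

Lemma mpoly_alg_ind (P : {mpoly K[n]} -> Prop) :
  (forall c, P c%:MP) -> (forall i, P 'X_i) ->
  (forall A B, P A -> P B -> P (A + B)) ->
  (forall A B, P A -> P B -> P (A * B)) -> forall A, P A.
Proof.
move=> PC PX PD PM A; rewrite (mpolyE A).
have P0 : P 0 by rewrite -mpolyC0.
apply: (big_ind P) => // m _; rewrite -mul_mpolyC mpolyXE_id; apply: (PM) => //.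
have P1 : P 1 by rewrite -mpolyC1.
apply: (big_ind P) => //; last move=> i _.
by elim: (m i) => [|k IHk]; [rewrite expr0|rewrite exprS; apply: PM].
Qed.

Lemma eq_mmap h h' A : h =1 h' -> mmap f h A = mmap f h' A.
Proof. by move=> hh; apply: eq_bigr => m _; rewrite (mmap1_eq _ hh). Qed.

Lemma mmap_homog d A (c : S) h :
  A \is d.-homog -> mmap f (fun i => c * h i) A = c ^+ d * mmap f h A.
Proof.
move/dhomogP => hA; rewrite /mmap mulr_sumr !big_seq; apply: eq_bigr => m /hA /= md.
rewrite mulrCA; congr (_ * _); rewrite /mmap1.
under eq_bigr do rewrite exprMn.
by rewrite big_split /= prodrXr -mdegE md.
Qed.

End EvaluationOfForms.

Lemma horner_mmap n (K : comNzRingType) (h : 'I_n -> {poly K}) A r :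
  (mmap (@polyC K) h A).[r] = A.@[fun i => (h i).[r]].
Proof.
elim/mpoly_alg_ind: A => [c|i|A B IA IB|A B IA IB].
- by rewrite mmapC mevalC hornerC.
- by rewrite mmapX mmap1U mevalXU.
- by rewrite !rmorphD /= hornerD IA IB.
- by rewrite !rmorphM /= hornerM IA IB.
Qed.

Section LinearSubstitution.

Variable K : closedFieldType.
Implicit Types (A B F G : {mpoly K[3]}) (M N : 'M[K]_3) (p q : 'rV[K]_3).

Definition lin_sub M : {mpoly K[3]} -> {mpoly K[3]} :=
  mmap (@mpolyC 3 K) (fun j => \sum_i M i j *: 'X_i).

HB.instance Definition _ M := GRing.RMorphism.copy (lin_sub M)
  (mmap (@mpolyC 3 K) (fun j => \sum_i M i j *: 'X_i)).

Lemma lin_subC M c : lin_sub M c%:MP = c%:MP.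
Proof. exact: mmapC. Qed.

Lemma lin_subX M j : lin_sub M 'X_j = \sum_i M i j *: 'X_i.
Proof. by rewrite /lin_sub mmapX mmap1U. Qed.

Lemma lin_subZ M c A : lin_sub M (c *: A) = c *: lin_sub M A.
Proof. by rewrite -!mul_mpolyC rmorphM /= lin_subC. Qed.

Lemma mmap_lin_sub (S : comNzRingType) (f : {rmorphism K -> S}) M
    (h : 'rV[S]_3) A :
  mmap f (h 0) (lin_sub M A) = mmap f ((h *m map_mx f M) 0) A.
Proof.
elim/mpoly_alg_ind: A => [c|j|A B IA IB|A B IA IB].
- by rewrite lin_subC !mmapC.
- rewrite lin_subX mmapX mmap1U mxE raddf_sum; apply: eq_bigr => i _ /=.
  by rewrite mmapZ mmapX mmap1U mxE mulrC.
- by rewrite !rmorphD /= IA IB.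
- by rewrite !rmorphM /= IA IB.
Qed.

Lemma meval_lin_sub M p A : (lin_sub M A).@[p 0] = A.@[(p *m M) 0].
Proof. by rewrite /meval mmap_lin_sub map_mx_id. Qed.

Lemma lin_sub_comp M N A : lin_sub M (lin_sub N A) = lin_sub (M *m N) A.
Proof.
elim/mpoly_alg_ind: A => [c|j|A B IA IB|A B IA IB].
- by rewrite !lin_subC.
- rewrite !lin_subX raddf_sum /=.
  under eq_bigr do rewrite lin_subZ lin_subX scaler_sumr.
  rewrite exchange_big /=; apply: eq_bigr => i _.
  by rewrite mxE scaler_suml; apply: eq_bigr => l _; rewrite scalerA mulrC.
- by rewrite !rmorphD /= IA IB.
- by rewrite !rmorphM /= IA IB.
Qed.

Lemma lin_sub1 A : lin_sub 1%:M A = A.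
Proof.
elim/mpoly_alg_ind: A => [c|j|A B IA IB|A B IA IB].
- by rewrite lin_subC.
- rewrite lin_subX (bigD1 j) //= mxE eqxx scale1r big1 ?addr0 // => i ij.
  by rewrite mxE (negbTE ij) scale0r.
- by rewrite rmorphD /= IA IB.
- by rewrite rmorphM /= IA IB.
Qed.

Lemma lin_subK M A : M \in unitmx -> lin_sub (invmx M) (lin_sub M A) = A.
Proof. by move=> uM; rewrite lin_sub_comp mulVmx // lin_sub1. Qed.

Lemma lin_subKV M A : M \in unitmx -> lin_sub M (lin_sub (invmx M) A) = A.
Proof. by move=> uM; rewrite lin_sub_comp mulmxV // lin_sub1. Qed.

Lemma lin_form_homog (a : 'I_3 -> K) : (\sum_i a i *: 'X_i) \is 1.-homog.
Proof.
by apply: rpred_sum => i _; apply: rpredZ; rewrite dhomogX /= mdeg1.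
Qed.

Lemma lin_sub_homog M d A : A \is d.-homog -> lin_sub M A \is d.-homog.
Proof.
move/dhomogP => hA; rewrite /lin_sub /mmap big_seq; apply: rpred_sum => m /hA /= md.
rewrite mul_mpolyC; apply: rpredZ; rewrite -md mdegE /mmap1.
elim/big_rec2: _ => [|i e x _ hx]; first exact: dhomog1.
apply: dhomogM hx; rewrite -[X in X.-homog]mul1n; apply: dhomogMn.
exact: lin_form_homog.
Qed.

Lemma lin_sub_eq0 M A : M \in unitmx -> (lin_sub M A == 0) = (A == 0).
Proof.
move=> uM; apply/eqP/eqP => [A0|->]; last exact: rmorph0.
by rewrite -(lin_subK A uM) A0 rmorph0.
Qed.

Lemma lin_sub_homogE M d A : M \in unitmx ->
  (lin_sub M A \is d.-homog) = (A \is d.-homog).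
Proof.
move=> uM; apply/idP/idP => [hA|]; last exact: lin_sub_homog.
by rewrite -(lin_subK A uM); apply: lin_sub_homog.
Qed.

Lemma mderiv_lin_sub M A i :
  (lin_sub M A)^`M(i) = \sum_j M i j *: lin_sub M A^`M(j).
Proof.
elim/mpoly_alg_ind: A => [c|j|A B IA IB|A B IA IB].
- rewrite lin_subC mderivC big1 // => j _.
  by rewrite mderivC rmorph0 scaler0.
- rewrite lin_subX raddf_sum /= (bigD1 i) //= [X in _ + X]big1 ?addr0; last first.
    move=> l li; rewrite linearZ /= mderivX mnm1E eq_sym eq_sym (negbTE li).
    by rewrite scale0r scaler0.
  rewrite [RHS](bigD1 j) //= [X in _ + X]big1 ?addr0; last first.
    move=> l li; rewrite mderivX mnm1E eq_sym (negbTE li).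
    by rewrite scale0r rmorph0 scaler0.
  rewrite linearZ /= !mderivX !mnm1E !eqxx !scale1r.
  have sub1 l : (U_(l) - U_(l))%MM = 0%MM :> 'X_{1..3}.
    by rewrite -[X in (X - _)%MM]add0m addmK.
  by rewrite !sub1 mpolyX0 rmorph1.
- rewrite rmorphD raddfD /= IA IB -big_split /=; apply: eq_bigr => j _.
  by rewrite mderivD rmorphD scalerDr.
- rewrite rmorphM mderivM /= IA IB mulr_suml mulr_sumr -big_split /=.
  apply: eq_bigr => j _; rewrite mderivM rmorphD !rmorphM /= scalerDr.
  by rewrite scalerAl scalerAr.
Qed.

(** The gradient of a form at a point; it is the coefficient vector of
    [tangent_line]. *)
Definition grad A p : 'rV[K]_3 := \row_j (A^`M(j)).@[p 0].

Lemma grad_lin_sub M A p : grad (lin_sub M A) p = grad A (p *m M) *m M^T.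
Proof.
apply/rowP => i; rewrite !mxE mderiv_lin_sub raddf_sum /=; apply: eq_bigr => j _.
by rewrite mevalZ meval_lin_sub !mxE mulrC.
Qed.

Lemma meval_homog d A (c : K) p : A \is d.-homog ->
  A.@[(c *: p) 0] = c ^+ d * A.@[p 0].
Proof.
move=> hA; rewrite /meval -(mmap_homog _ c (p 0) hA); apply: eq_mmap => i.
by rewrite mxE.
Qed.

Lemma mderiv_homog d A i : A \is d.+1.-homog -> A^`M(i) \is d.-homog.
Proof.
move/dhomogP => hA; rewrite [A]mpolyE raddf_sum big_seq; apply: rpred_sum => m /hA /= md.
rewrite /= linearZ /= mderivX; apply: rpredZ.
case: (posnP (m i)) => [->|mi]; first by rewrite scale0r rpred0.
apply: rpredZ; rewrite dhomogX; apply/eqP.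
have /(congr1 (fun m => mdeg m)) : (m - U_(i) + U_(i))%MM = m.
  by rewrite submK // lep1mP -lt0n.
by rewrite mdegD mdeg1 md addn1 => -[].
Qed.

Lemma grad_scale d A (c : K) p : A \is d.+1.-homog ->
  grad A (c *: p) = c ^+ d *: grad A p.
Proof.
move=> hA; apply/rowP => i; rewrite !mxE; apply: meval_homog.
exact: mderiv_homog.
Qed.

End LinearSubstitution.

(** * Intersection multiplicities along a parametrized curve *)

Section FractionScalars.

Variables (K : fieldType) (A : idomainType) (f : {rmorphism K -> A}).

Definition frac_scalar : {rmorphism K -> {fraction A}} := @tofrac A \o f.

End FractionScalars.

Lemma tofrac_inj (A : idomainType) : injective (@tofrac A).
Proof. by move=> x y /eqP; rewrite tofrac_eq => /eqP. Qed.

Section ParametrizedCurve.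

Variable K : closedFieldType.
Variables (Q : {mpoly K[3]}) (phi : 'rV[{poly K}]_3) (p : 'rV[K]_3).

Let pull (A : {mpoly K[3]}) : {poly K} := mmap (@polyC K) (phi 0) A.

Let iotaM : {rmorphism K -> {fraction {mpoly K[3]}}} :=
  frac_scalar (@mpolyC 3 K).
Let iotaP : {rmorphism K -> {fraction {poly K}}} := frac_scalar (@polyC K).

Definition param_ring (k : {fraction {poly K}}) : Prop :=
  exists (n : nat) (A B : {mpoly K[3]}),
    [/\ A \is n.-homog, B \is n.-homog, B.@[p 0] != 0
      & k = tofrac (pull A) / tofrac (pull B)].

Definition param_ideal (G : {mpoly K[3]}) (k : {fraction {poly K}}) : Prop :=
  exists (n : nat) (A B : {mpoly K[3]}),
    [/\ G * A \is n.-homog, B \is n.-homog, B.@[p 0] != 0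
      & k = tofrac (pull (G * A)) / tofrac (pull B)].

Hypothesis Q_pull0 : pull Q = 0.
Hypothesis Q_kernel : forall n A, A \is n.-homog -> pull A = 0 ->
  exists B, A = Q * B.
Hypothesis pull_neq0 : forall n B, B \is n.-homog -> B.@[p 0] != 0 ->
  pull B != 0.

Let pullM A B : pull (A * B) = pull A * pull B.
Proof. exact: rmorphM. Qed.

Let pullD A B : pull (A + B) = pull A + pull B.
Proof. exact: rmorphD. Qed.

Let meval_neq0 (B : {mpoly K[3]}) : B.@[p 0] != 0 -> B != 0.
Proof. by apply: contraNneq => ->; rewrite meval0. Qed.

(* The graph of the restriction from the local ring of the plane at p to the
   function field of the curve. *)
Let restr h k := exists (n : nat) (A B : {mpoly K[3]}),
  [/\ A \is n.-homog, B \is n.-homog, B.@[p 0] != 0,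
      h = tofrac A / tofrac B & k = tofrac (pull A) / tofrac (pull B)].

Let restr_lincomb m (h : 'I_m -> _) (k : 'I_m -> _) c :
  (forall i, restr (h i) (k i)) ->
  restr (lincomb iotaM h c) (lincomb iotaP k c).
Proof.
move=> hk; rewrite /lincomb; apply: big_ind2 => [|x1 y1 x2 y2|i _].
- exists 0%N, 0, 1; split; rewrite ?rpred0 ?dhomog1 ?meval1 ?oner_neq0 //.
    by rewrite tofrac0 mul0r.
  by rewrite [pull 0]rmorph0 tofrac0 mul0r.
- move=> [n [A [B [hA hB Bp -> ->]]]] [n' [A' [B' [hA' hB' B'p -> ->]]]].
  exists (n + n')%N, (A * B' + A' * B), (B * B'); split.
  + apply: rpredD; first exact: dhomogM.
    by rewrite addnC; apply: dhomogM.
  + exact: dhomogM.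
  + by rewrite mevalM mulf_neq0.
  + by rewrite addf_div ?tofrac_eq0 ?meval_neq0 // tofracD !tofracM.
  + rewrite addf_div ?tofrac_eq0 ?(pull_neq0 hB) ?(pull_neq0 hB') //.
    by rewrite pullD !pullM tofracD !tofracM.
- have [n [A [B [hA hB Bp -> ->]]]] := hk i.
  exists n, (c i *: A), B; split=> //; first exact: rpredZ.
    by rewrite mulrA -tofracM mul_mpolyC.
  by rewrite mulrA -tofracM /pull mmapZ.
Qed.

Let restr_sub h h' k k' : restr h k -> restr h' k' -> restr (h - h') (k - k').
Proof.
move=> hk hk'.
pose h2 (i : 'I_2) := if i == 0 then h else h'.
pose k2 (i : 'I_2) := if i == 0 then k else k'.
have := @restr_lincomb 2 h2 k2 (fun i => if i == 0 then 1 else -1).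
rewrite /lincomb !big_ord_recl !big_ord0 /h2 /k2 /= !rmorph1 !rmorphN1.
by rewrite !mulN1r !mul1r !addr0; apply=> i; case: (i == 0).
Qed.

Let ideal_restr G h k : restr h k -> local_ideal Q G p h -> param_ideal G k.
Proof.
move=> [n [A [B [hA hB Bp -> ->]]]] [n' [A' [B' [D [hQ hG hD Dp]]]]].
move/eqP; rewrite eqr_div ?tofrac_eq0 ?meval_neq0 // -!tofracM tofrac_eq.
move/eqP/(congr1 pull); rewrite !pullM pullD !pullM Q_pull0 mul0r add0r => E.
exists n', B', D; split=> //; apply/eqP.
rewrite eqr_div ?tofrac_eq0 ?(pull_neq0 hB) ?(pull_neq0 hD) //.
by rewrite -!tofracM E pullM.
Qed.

Let restr_ideal G h k : restr h k -> param_ideal G k -> local_ideal Q G p h.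
Proof.
move=> [n [A [B [hA hB Bp -> ->]]]] [n' [A' [D [hG hD Dp]]]].
move/eqP; rewrite eqr_div ?tofrac_eq0 ?(pull_neq0 hB) ?(pull_neq0 hD) //.
rewrite -!tofracM -!pullM tofrac_eq => /eqP E.
have hGAB : G * A' * B \is (n + n').-homog by rewrite addnC; apply: dhomogM.
have hdiff : A * D - G * A' * B \is (n + n').-homog.
  by apply: rpredB => //; apply: dhomogM.
have [|C EC] := Q_kernel hdiff.
  by rewrite [pull _]rmorphB; apply/eqP; rewrite subr_eq0; apply/eqP.
exists (n + n')%N, C, (A' * B), (B * D); split.
- by rewrite -EC.
- by rewrite mulrA.
- exact: dhomogM.
- by rewrite mevalM mulf_neq0.
- apply/eqP; rewrite eqr_div ?tofrac_eq0 ?mulf_neq0 ?meval_neq0 //.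
  rewrite -!tofracM tofrac_eq -EC mulrA subrK; apply/eqP; ring.
Qed.

(** The local ring of the plane at [p] modulo [Q] embeds in the function field
    of the curve, because [Q] generates the forms that vanish along [phi]. *)
Lemma intersection_mult_param G m :
  codim iotaP (param_ideal G) param_ring m -> intersection_mult Q G p m.
Proof.
move=> [k [Rk fk sk]].
have /choice [h hk] i : exists h, restr h (k i).
  have [n [A [B [hA hB Bp ->]]]] := Rk i.
  by exists (tofrac A / tofrac B), n, A, B.
exists h; split.
- by move=> i; have [n [A [B [hA hB Bp -> _]]]] := hk i; exists n, A, B.
- by move=> c hc; apply: fk; apply: ideal_restr hc; apply: restr_lincomb.
- move=> x [n [A [B [hA hB Bp Ex]]]].
  have [|c kc] := sk (tofrac (pull A) / tofrac (pull B)); first by exists n, A, B.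
  exists c; apply: restr_ideal kc; apply: restr_sub; last exact: restr_lincomb.
  by exists n, A, B.
Qed.

End ParametrizedCurve.

Lemma local_ideal_subspace (K : closedFieldType) (F G : {mpoly K[3]}) p :
  subspace (frac_scalar (@mpolyC 3 K)) (local_ideal F G p).
Proof.
have neq0 (B : {mpoly K[3]}) : B.@[p 0] != 0 -> B != 0.
  by apply: contraNneq => ->; rewrite meval0.
split.
- exists 0%N, 0, 0, 1; rewrite !mulr0 rpred0 dhomog1 meval1 oner_neq0.
  by split=> //; rewrite addr0 tofrac0 mul0r.
- move=> _ _ [n [A [B [D [hA hB hD Dp ->]]]]] [n' [A' [B' [D' [hA' hB' hD' Dp' ->]]]]].
  have hom (C C' H : {mpoly K[3]}) : H * C \is n.-homog -> H * C' \is n'.-homog ->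
      H * (C * D' + C' * D) \is (n + n').-homog.
    move=> hC hC'; rewrite mulrDr !mulrA; apply: rpredD; first exact: dhomogM.
    by rewrite addnC; apply: dhomogM.
  exists (n + n')%N, (A * D' + A' * D), (B * D' + B' * D), (D * D').
  split; [exact: hom|exact: hom|exact: dhomogM|by rewrite mevalM mulf_neq0|].
  rewrite addf_div ?tofrac_eq0 ?neq0 // -!tofracM -tofracD.
  by congr (tofrac _ / _); ring.
- move=> c _ [n [A [B [D [hA hB hD Dp ->]]]]].
  exists n, (c *: A), (c *: B), D; rewrite -!scalerAr.
  split=> //; try exact: rpredZ.
  by rewrite /= mulrA -tofracM mul_mpolyC scalerDr.
Qed.

Lemma intersection_mult_uniq (K : closedFieldType) (F G : {mpoly K[3]}) p m n :
  intersection_mult F G p m -> intersection_mult F G p n -> m = n.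
Proof. exact: (codim_uniq (local_ideal_subspace F G p)). Qed.

Lemma intersection_multC (K : closedFieldType) (F G : {mpoly K[3]}) p m :
  intersection_mult F G p m -> intersection_mult G F p m.
Proof.
have sw (A B : {mpoly K[3]}) h : local_ideal A B p h -> local_ideal B A p h.
  by case=> n [C [D [H [? ? ? ? ->]]]]; exists n, D, C, H; rewrite addrC.
case=> e [Re fe se]; exists e; split=> // [c /sw|x /se [c /sw]]; first exact: fe.
by exists c.
Qed.

(** The size of a polynomial occurs with several convertible readings of its
    coefficient ring; [slia] is [lia] after making them syntactically equal. *)
Definition psize (K : closedFieldType) (P : {poly K}) : nat := size P.

Ltac slia :=
  repeat match goal with
  | K : GRing.ClosedField.type, H : context [@size ?T (@polyseq ?R ?P)] |- _ =>
    change (@size T (@polyseq R P)) with (@psize K P) in H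
  end;
  repeat match goal with
  | K : GRing.ClosedField.type |- context [@size ?T (@polyseq ?R ?P)] =>
    change (@size T (@polyseq R P)) with (@psize K P)
  end; lia.

Section LocalRingsOfTheLine.

Variable K : closedFieldType.
Implicit Types (A B C N g b q : {poly K}).

Local Notation FP := {fraction {poly K}}.

Let iotaP : {rmorphism K -> FP} := frac_scalar (@polyC K).

(* The lemmas on sizes of products, with sizes read in [K] itself, so that [lia]
   recognizes them. *)
Let size_mulK A B : A != 0 -> B != 0 -> size (A * B) = (size A + size B).-1.
Proof. exact: size_mul. Qed.

Let size_mul_leqK A B : (size (A * B)%R <= (size A + size B).-1)%N.
Proof. exact: size_polyMleq. Qed.

Let size_divK A B : B != 0 -> size (A %/ B) = (size A - (size B).-1)%N.
Proof. exact: size_divp. Qed.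

(** Rational functions that are regular at all the roots of [N]. *)
Definition loc N (k : FP) : Prop :=
  exists A B, [/\ coprimep B N, B != 0 & k = tofrac A / tofrac B].

Lemma loc_subspace N : subspace iotaP (loc N).
Proof.
split.
- by exists 0, 1; rewrite coprime1p oner_neq0 tofrac0 mul0r.
- move=> _ _ [A [B [BN B0 ->]]] [A' [B' [BN' B0' ->]]].
  exists (A * B' + A' * B), (B * B'); rewrite coprimepMl BN BN' mulf_neq0 //.
  by split=> //; rewrite addf_div ?tofrac_eq0 // -!tofracM -tofracD.
- move=> c _ [A [B [BN B0 ->]]]; exists (c%:P * A), B; split=> //.
  by rewrite mulrA -tofracM.
Qed.

Lemma loc_poly N A : loc N (tofrac A).
Proof. by exists A, 1; rewrite coprime1p oner_neq0 tofrac1 divr1. Qed.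

Lemma scaled_loc_sub N g b x :
  coprimep b N -> b != 0 ->
  scaled (tofrac g / tofrac b) (loc N) x -> loc N x.
Proof.
move=> bN b0 [_ [A [B [BN B0 ->]]] ->]; exists (g * A), (b * B).
by rewrite coprimepMl bN BN mulf_neq0 // mulf_div !tofracM.
Qed.

Lemma lincomb_Xn m (c : 'I_m -> K) :
  lincomb iotaP (fun i => tofrac 'X^i) c = tofrac (\sum_i c i *: 'X^i).
Proof.
rewrite raddf_sum /lincomb; apply: eq_bigr => i _.
by rewrite /= -mul_polyC tofracM.
Qed.

Lemma size_sum_Xn m (c : 'I_m -> K) : (size (\sum_i c i *: 'X^i : {poly K})%R <= m)%N.
Proof.
by apply: (leq_trans (size_sum _ _ _)); apply/bigmax_leqP => i _;
  rewrite (leq_trans (size_scale_leq _ _)) // size_polyXn.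
Qed.

Lemma sum_Xn_eq0 m (c : 'I_m -> K) :
  \sum_i c i *: 'X^i = 0 :> {poly K} -> forall i, c i = 0.
Proof.
move=> c0 i; have /(congr1 (fun P : {poly K} => P`_i)) := c0.
rewrite coef_sum coef0 (bigD1 i) //= big1 ?addr0 => [|j ji].
  by rewrite coefZ coefXn eqxx mulr1.
by rewrite coefZ coefXn [_ == _]eq_sym (negbTE (ji : (j : nat) != i)) mulr0.
Qed.

Lemma poly_sum_Xn m (P : {poly K}) : (size P <= m)%N ->
  P = \sum_(i < m) P`_i *: 'X^i.
Proof.
move=> sP; rewrite -[LHS]coefK poly_def (big_ord_widen _ (fun i => P`_i *: 'X^i) sP).
rewrite [RHS](bigID (fun i : 'I_m => (i < size P)%N)) /= [X in _ + X]big1 ?addr0 //.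
by move=> i; rewrite -leqNgt => /(nth_default 0) ->; rewrite scale0r.
Qed.

(** Only the factor of [g] supported on the roots of [N] survives in the
    quotient of [loc N] by [g], and its degree is the length. *)
Lemma codim_loc N g1 g2 b j :
  coprimep b N -> b != 0 -> coprimep g2 N -> g2 != 0 -> g1 != 0 ->
  g1 %| N ^+ j ->
  codim iotaP (scaled (tofrac (g1 * g2) / tofrac b) (loc N)) (loc N)
    (size g1).-1.
Proof.
move=> bN b0 gN g20 g10 g1N.
have cop B : coprimep B N -> coprimep B g1.
  by move=> BN; apply: coprimep_dvdl g1N _; apply: coprimep_expr.
exists (fun i => tofrac 'X^i); split.
- by move=> i; apply: loc_poly.
- move=> c [_ [A [B [BN B0 ->]]]]; rewrite lincomb_Xn; set P := \sum_i _ => E.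
  apply: sum_Xn_eq0; rewrite -/P; apply/eqP.
  move: E; rewrite mulf_div -!tofracM -[LHS]divr1 -tofrac1.
  move/eqP; rewrite eqr_div ?tofrac_eq0 ?oner_neq0 ?mulf_neq0 // -!tofracM.
  rewrite tofrac_eq mulr1 => /eqP E.
  have : g1 %| P.
    rewrite -(Gauss_dvdpl P (_ : coprimep g1 (b * B))).
      by rewrite E -!mulrA dvdp_mulr.
    by rewrite coprimep_sym coprimepMl !cop.
  apply: contraLR => P0; apply/negP => /(dvdp_leq P0); rewrite leqNgt.
  by rewrite (leq_ltn_trans (size_sum_Xn c)) // prednK // size_poly_gt0.
- move=> _ [A [B [BN B0 ->]]].
  have /Bezout_eq1_coprimepP [[x y] /= xy1] : coprimep B g1 by apply: cop.
  set P := (A * x) %% g1.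
  have sP : (size P <= (size g1).-1)%N.
    by rewrite -ltnS prednK ?size_poly_gt0 // ltn_modp.
  exists (fun i => P`_i); rewrite lincomb_Xn -poly_sum_Xn //.
  pose C := A * y + B * ((A * x) %/ g1).
  have E : A - P * B = g1 * C.
    have -> : P = A * x - (A * x) %/ g1 * g1.
      by rewrite {1}(divp_eq (A * x) g1) addrC addKr.
    by rewrite /C -[X in X - _ = _](mulr1 A) -xy1; ring.
  exists (tofrac (b * C) / tofrac (g2 * B)).
    by exists (b * C), (g2 * B); rewrite coprimepMl gN BN mulf_neq0.
  rewrite mulf_div -!tofracM -[tofrac P]divr1 -tofrac1 -mulNr -tofracN.
  rewrite addf_div ?tofrac_eq0 ?oner_neq0 // -!tofracM -tofracD mulr1 mulNr.
  apply/eqP; rewrite eqr_div ?tofrac_eq0 ?mulf_neq0 ?oner_neq0 // -!tofracM.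
  by rewrite tofrac_eq E; apply/eqP; ring.
Qed.

(** The local ring of a double point with normalization [loc q]: functions
    taking the same value at the two roots of [q], or with vanishing derivative
    at the double root of [q]. *)
Definition pinched q (k : FP) : Prop :=
  exists c, scaled (tofrac q) (loc q) (k - iotaP c).

Lemma pinched_subspace q : subspace iotaP (pinched q).
Proof.
have sl := subspace_scaled (tofrac q) (loc_subspace q).
case: (sl) => s0 sD sZ; split.
- by exists 0; rewrite rmorph0 subr0.
- move=> x y [c qx] [c' qy]; exists (c + c'); rewrite rmorphD opprD addrACA.
  exact: sD.
- move=> c x [c' qx]; exists (c * c'); rewrite rmorphM -mulrBr; exact: sZ.
Qed.

Lemma pinched_loc q k : pinched q k -> loc q k.
Proof.
case=> c [x lx /eqP]; rewrite subr_eq => /eqP ->.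
have [_ lD _] := loc_subspace q; apply: lD; last exact: loc_poly.
rewrite -[tofrac q]divr1 -tofrac1; apply: scaled_loc_sub; last by exists x.
  exact: coprime1p.
exact: oner_neq0.
Qed.

Lemma codim_pinched q : size q = 3%N -> codim iotaP (pinched q) (loc q) 1.
Proof.
move=> sq; have q0 : q != 0 by rewrite -size_poly_gt0 sq.
exists (fun=> tofrac 'X); split.
- by move=> i; apply: loc_poly.
- move=> c [c' [_ [A [B [Bq B0 ->]]]]].
  rewrite /lincomb big_ord1 /= -tofracM -tofracB -[LHS]divr1 mulrA -tofracM.
  rewrite -tofrac1 => /eqP; rewrite eqr_div ?tofrac_eq0 ?oner_neq0 //.
  rewrite -!tofracM tofrac_eq mulr1 => /eqP E i; rewrite (ord1 i).
  have : q %| (c 0)%:P * 'X - c'%:P.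
    rewrite -(Gauss_dvdpl _ (_ : coprimep q B)) 1?coprimep_sym //.
    by rewrite E dvdp_mulr.
  apply: contraTeq => c0; apply/negP => /dvdp_leq; rewrite -polyCN.
  rewrite -size_poly_eq0 size_MXaddC polyC_eq0 (negbTE c0) sq size_polyC c0 /=.
  by move/(_ isT).
- move=> _ [A [B [Bq B0 ->]]].
  have /Bezout_eq1_coprimepP [[x y] /= xy1] := Bq.
  set P := (A * x) %% q.
  have sP : (size P <= 2)%N by rewrite -ltnS -sq ltn_modp.
  exists (fun=> P`_1), P`_0; rewrite /lincomb big_ord1 /=.
  pose C := A * y + B * ((A * x) %/ q).
  have E : A - P * B = q * C.
    have -> : P = A * x - (A * x) %/ q * q.
      by rewrite {1}(divp_eq (A * x) q) addrC addKr.
    by rewrite /C -[X in X - _ = _](mulr1 A) -xy1; ring.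
  have EP : P = (P`_1)%:P * 'X + (P`_0)%:P.
    apply/polyP => i; rewrite coefD coefC coefCM coefX.
    case: i => [|[|i]] /=; rewrite ?mulr0 ?mulr1 ?add0r ?addr0 //.
    by rewrite nth_default // (leq_trans sP).
  exists (tofrac C / tofrac B); first by exists C, B.
  rewrite -tofracM -addrA -opprD -tofracD -EP mulrA -tofracM -E.
  by rewrite tofracB mulrBl tofracM mulfK // tofrac_eq0.
Qed.

(** Rational functions that are regular at infinity. *)
Definition loc_infty (k : FP) : Prop :=
  exists A B, [/\ B != 0, (size A <= size B)%N & k = tofrac A / tofrac B].

Lemma loc_infty_subspace : subspace iotaP loc_infty.
Proof.
split.
- by exists 0, 1; rewrite oner_neq0 size_poly0 tofrac0 mul0r.
- move=> _ _ [A [B [B0 sAB ->]]] [A' [B' [B0' sAB' ->]]].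
  exists (A * B' + A' * B), (B * B'); rewrite mulf_neq0 //.
  split=> //; last by rewrite addf_div ?tofrac_eq0 // -!tofracM -tofracD.
  have sB : (0 < size B)%N by rewrite size_poly_gt0.
  have sB' : (0 < size B')%N by rewrite size_poly_gt0.
  rewrite size_mulK // (leq_trans (size_polyD _ _)) // geq_max.
  apply/andP; split; apply: leq_trans (size_mul_leqK _ _) _; lia.
- move=> c _ [A [B [B0 sAB ->]]]; exists (c *: A), B; split=> //.
    by rewrite (leq_trans (size_scale_leq _ _)).
  by rewrite mulrA -tofracM mul_polyC.
Qed.

Lemma codim_loc_infty g b m :
  g != 0 -> size b = (size g + m)%N ->
  codim iotaP (scaled (tofrac g / tofrac b) loc_infty) loc_infty m.
Proof.
move=> g0 sb.
have sg : (0 < size g)%N by rewrite size_poly_gt0.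
have b0 : b != 0 by rewrite -size_poly_gt0 sb; lia.
pose D : {poly K} := 'X^(m.-1).
have D0 : D != 0 by rewrite -size_poly_gt0 size_polyXn.
exists (fun i => tofrac 'X^i / tofrac D); split.
- move=> i; exists 'X^i, D; split=> //.
  by rewrite !size_polyXn; have := ltn_ord i; lia.
- move=> c; have -> : lincomb iotaP (fun i : 'I_m => tofrac 'X^i / tofrac D) c =
      tofrac (\sum_i c i *: 'X^i) / tofrac D.
    by rewrite -lincomb_Xn /lincomb mulr_suml; apply: eq_bigr => i _; rewrite mulrA.
  set P : {poly K} := \sum_i _ => -[_ [A [B [B0 sAB ->]]] E].
  apply: sum_Xn_eq0; rewrite -/P; apply/eqP; apply: contraT => P0.
  move: E; rewrite mulf_div -!tofracM.
  move/eqP; rewrite eqr_div ?tofrac_eq0 ?mulf_neq0 // -!tofracM tofrac_eq.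
  move=> /eqP E.
  have A0 : A != 0.
    apply: contraTneq isT => A0; move/eqP: E.
    by rewrite A0 mulr0 mul0r !mulf_eq0 (negbTE P0) (negbTE b0) (negbTE B0).
  move/(congr1 (fun R : {poly K} => size R)): E.
  rewrite !size_mulK ?mulf_neq0 // sb size_polyXn.
  have := size_sum_Xn c; rewrite -/P.
  have : (0 < size P)%N by rewrite size_poly_gt0.
  have : (0 < size A)%N by rewrite size_poly_gt0.
  lia.
- move=> _ [A [B [B0 sAB ->]]].
  have sB : (0 < size B)%N by rewrite size_poly_gt0.
  case: (posnP m) => [m0|m0].
    exists (fun=> 0); have -> : forall e : 'I_m -> FP, lincomb iotaP e (fun=> 0) = 0.
      by move=> e; rewrite /lincomb big1 // => i _; rewrite rmorph0 mul0r.
    exists (tofrac (A * b) / tofrac (B * g)).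
      exists (A * b), (B * g); rewrite mulf_neq0 //; split=> //.
      have := size_mul_leqK A b; rewrite (size_mulK B0) // sb; lia.
    rewrite subr0 mulf_div -!tofracM; apply/eqP.
    by rewrite eqr_div ?tofrac_eq0 ?mulf_neq0 // -!tofracM tofrac_eq; apply/eqP; ring.
  set q : {poly K} := (A * D) %/ B; set r : {poly K} := (A * D) %% B.
  have ADE : A * D = q * B + r by apply: divp_eq.
  have sr : (size r < size B)%N by rewrite ltn_modp.
  have sq : (size q <= m)%N.
    rewrite size_divK //; have := size_mul_leqK A D.
    by rewrite size_polyXn; lia.
  exists (fun i => q`_i).
  have -> : lincomb iotaP (fun i : 'I_m => tofrac 'X^i / tofrac D) (fun i => q`_i) =
      tofrac q / tofrac D.
    rewrite [in RHS](poly_sum_Xn sq) -lincomb_Xn /lincomb mulr_suml.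
    by apply: eq_bigr => i _; rewrite mulrA.
  exists (tofrac (b * r) / tofrac (g * (B * D))).
    exists (b * r), (g * (B * D)); rewrite !mulf_neq0 //; split=> //.
    have := size_mul_leqK b r; rewrite (size_mulK g0) ?mulf_neq0 // (size_mulK B0 D0) sb size_polyXn.
    lia.
  rewrite mulf_div -!tofracM -mulNr -tofracN.
  rewrite addf_div ?tofrac_eq0 // -!tofracM -tofracD ADE.
  apply/eqP; rewrite eqr_div ?tofrac_eq0 ?mulf_neq0 // -!tofracM.
  by rewrite tofrac_eq; apply/eqP; ring.
Qed.

End LocalRingsOfTheLine.

Section HomogeneousFactors.

Variables (K : closedFieldType).
Implicit Types A G : {mpoly K[3]}.

Lemma pihomog_mull e n G A : G \is e.-homog ->
  pihomog [measure of mdeg] (e + n) (G * A) = G * pihomog [measure of mdeg] n A.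
Proof.
move=> hG; rewrite [A]mpolyE mulr_sumr !raddf_sum mulr_sumr; apply: eq_bigr => m _.
rewrite /= -scalerAr !linearZ /= -scalerAr; congr (_ *: _).
rewrite pihomogX; case: eqP => [md|/eqP md].
  by apply: pihomog_dE; apply: dhomogM => //; rewrite dhomogX; apply/eqP.
have hX : G * 'X_[m] \is (e + mdeg m).-homog by apply: dhomogM; rewrite ?dhomogX.
by rewrite mulr0 (pihomog_ne0 _ hX) // eqn_add2l.
Qed.

Lemma homog_factor e n G A : G != 0 -> G \is e.-homog -> G * A \is n.-homog ->
  A != 0 -> exists2 d, n = (e + d)%N & A \is d.-homog.
Proof.
move=> G0 hG hGA A0.
have GA0 : G * A != 0 by rewrite mulf_neq0.
have [len|ltn] := leqP e n.
  exists (n - e)%N; first by rewrite subnKC.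
  rewrite homog_piE; apply/eqP; apply: (mulfI G0).
  by rewrite -(pihomog_mull _ _ hG) subnKC // pihomog_dE.
case/negP: GA0; apply/eqP.
have [m mA] : exists m, m \in msupp A.
  by exists (mlead A); apply: mlead_supp.
have : pihomog [measure of mdeg] (e + mdeg m) (G * A) = 0.
  by apply: pihomog_ne0 hGA; lia.
rewrite pihomog_mull // => /eqP; rewrite mulf_eq0 (negbTE G0) /= => /eqP.
move/(congr1 (mcoeff m)); rewrite mcoeff0 pihomogE raddf_sum /=.
rewrite -big_filter (bigD1_seq m) ?filter_uniq ?msupp_uniq ?mem_filter ?eqxx //=.
rewrite mcoeffZ mcoeffX eqxx mulr1 big1_seq.
  by rewrite addr0 => /eqP; rewrite mcoeff_eq0 mA.
by move=> m' /andP [mm _]; rewrite mcoeffZ mcoeffX (negbTE mm) mulr0.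
Qed.

End HomogeneousFactors.

Section LocalRingOfTheCurve.

Variables (K : closedFieldType) (phi : 'rV[{poly K}]_3) (p : 'rV[K]_3).

Let pull (A : {mpoly K[3]}) : {poly K} := mmap (@polyC K) (phi 0) A.
Let pullM A B : pull (A * B) = pull A * pull B.
Proof. exact: rmorphM. Qed.
Let pullD A B : pull (A + B) = pull A + pull B.
Proof. exact: rmorphD. Qed.
Let pullX A n : pull (A ^+ n) = pull A ^+ n.
Proof. exact: rmorphXn. Qed.
Let pullZ c A : pull (c *: A) = c *: pull A.
Proof. by rewrite /pull mmapZ mul_polyC. Qed.

Lemma param_ideal_scaled e G L :
  pull G != 0 -> G \is e.-homog -> L \is 1.-homog -> L.@[p 0] != 0 ->
  pull L != 0 ->
  (forall n B, B \is n.-homog -> B.@[p 0] != 0 -> pull B != 0) ->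
  param_ideal phi p G =
  scaled (tofrac (pull G) / tofrac (pull L ^+ e)) (param_ring phi p).
Proof.
move=> G0 hG hL Lp L0 pull_neq0; apply/funext => k; apply/propext; split.
- case=> n [A [B [hA hB Bp ->]]].
  have [->|A0] := eqVneq A 0.
    exists 0; last by rewrite !mulr0 rmorph0 tofrac0 mul0r.
    exists n, 0, B; rewrite rpred0; split=> //.
    by rewrite rmorph0 tofrac0 mul0r.
  have GN0 : G != 0 by apply: contraNneq G0 => ->; rewrite /pull rmorph0.
  have [d nE hAd] := homog_factor GN0 hG hA A0.
  exists (tofrac (pull (L ^+ e * A)) / tofrac (pull B)).
    exists n, (L ^+ e * A), B; split=> //; rewrite nE; apply: dhomogM => //.
    by rewrite -[X in X.-homog]mul1n; apply: dhomogMn.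
  have PB : pull B != 0 := pull_neq0 _ _ hB Bp.
  rewrite -!/(pull _) mulf_div -!tofracM; apply/eqP.
  rewrite eqr_div ?tofrac_eq0 ?mulf_neq0 ?expf_neq0 //.
  by rewrite -!tofracM tofrac_eq !pullM pullX; apply/eqP; ring.
- case=> _ [n [A [B [hA hB Bp ->]]]] ->; exists (e + n)%N, A, (L ^+ e * B).
  have hLe : L ^+ e \is e.-homog.
    by rewrite -[X in X.-homog]mul1n; apply: dhomogMn.
  split; [exact: dhomogM|exact: dhomogM| |].
    by rewrite mevalM rmorphXn /= mulf_neq0 ?expf_neq0.
  by rewrite -!/(pull _) mulf_div -!tofracM !pullM pullX.
Qed.

Lemma scaled_param_ring_sub e G L x :
  G \is e.-homog -> L \is 1.-homog -> L.@[p 0] != 0 ->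
  scaled (tofrac (pull G) / tofrac (pull L ^+ e)) (param_ring phi p) x ->
  param_ring phi p x.
Proof.
move=> hG hL Lp [_ [n [A [B [hA hB Bp ->]]]] ->].
exists (e + n)%N, (G * A), (L ^+ e * B).
have hLe : L ^+ e \is e.-homog.
  by rewrite -[X in X.-homog]mul1n; apply: dhomogMn.
split; [exact: dhomogM|exact: dhomogM| |].
  by rewrite mevalM rmorphXn /= mulf_neq0 ?expf_neq0.
by rewrite -!/(pull _) mulf_div -!tofracM !pullM pullX.
Qed.

(** The functions in [s * {poly K}] all come from forms: [s] generates the
    conductor of the curve. *)
Variable s : {poly K}.
Hypothesis conductor : forall e (P : {poly K}), (size P <= 4 * e + 3)%N ->
  exists2 A, A \is (e.+2).-homog & pull A = s * P.

Lemma param_ring_smooth r : ~~ root s r ->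
  (forall n B, B \is n.-homog -> (B.@[p 0] != 0) = ~~ root (pull B) r) ->
  param_ring phi p = loc ('X - r%:P).
Proof.
move=> sr val; have s0 : s != 0 by apply: contraNneq sr => ->; rewrite root0.
apply/funext => k; apply/propext; split.
- case=> n [A [B [hA hB Bp ->]]]; exists (pull A), (pull B).
  move: Bp; rewrite (val _ _ hB) coprimep_XsubC => Br; split=> //.
  by apply: contraNneq Br => ->; rewrite root0.
- case=> A [B [Br B0 ->]].
  have [|A2 hA2 EA] := @conductor (size A + size B) A; first by lia.
  have [|B2 hB2 EB] := @conductor (size A + size B) B; first by lia.
  exists (size A + size B).+2, A2, B2; split=> //.
    by rewrite (val _ _ hB2) EB rootM negb_or sr -coprimep_XsubC.
  by rewrite -!/(pull _) EA EB !tofracM -mulf_div divff ?mul1r // tofrac_eq0.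
Qed.

Lemma param_ring_infty : size s = 7%N ->
  (forall n B, B \is n.-homog -> (size (pull B) <= 4 * n + 1)%N) ->
  (forall n B, B \is n.-homog ->
     (B.@[p 0] != 0) = (size (pull B) == 4 * n + 1)%N) ->
  param_ring phi p = @loc_infty K.
Proof.
move=> ss sz val; have s0 : s != 0 by rewrite -size_poly_gt0 ss.
apply/funext => k; apply/propext; split.
- case=> n [A [B [hA hB Bp ->]]]; exists (pull A), (pull B).
  move: Bp; rewrite (val _ _ hB) => /eqP sB; split=> //.
    by rewrite -size_poly_gt0 sB; lia.
  by rewrite sB; apply: sz.
- case=> A [B [B0 sAB ->]].
  have sB : (0 < size B)%N by rewrite size_poly_gt0.
  pose j := (3 * size B + 3)%N.
  have Xj0 : 'X^j != 0 :> {poly K} by rewrite -size_poly_gt0 size_polyXn.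
  have sX (P : {poly K}) : P != 0 -> size (P * 'X^j) = (size P + j)%N.
    by move=> P0; rewrite addnC; apply: size_mulXn.
  have [|A2 hA2 EA] := @conductor (size B) (A * 'X^j).
    by have [->|A0] := eqVneq A 0; rewrite ?mul0r ?size_poly0 // sX // /j; lia.
  have [|B2 hB2 EB] := @conductor (size B) (B * 'X^j); first by rewrite sX // /j; lia.
  exists (size B).+2, A2, B2; split=> //.
    have BX0 : B * 'X^j != 0 by rewrite mulf_neq0.
    have ssz : size (s * (B * 'X^j)) = (size s + size (B * 'X^j)%R).-1.
      exact: size_mul.
    by rewrite (val _ _ hB2) EB ssz ss sX // /j; lia.
  rewrite -!/(pull _) EA EB; apply/eqP.
  rewrite eqr_div ?tofrac_eq0 ?mulf_neq0 // -!tofracM tofrac_eq.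
  by apply/eqP; ring.
Qed.

Lemma param_ring_pinched q s' L : s = q * s' -> size q = 3%N -> (size s' <= 5)%N ->
  s' != 0 -> coprimep s' q -> L \is 1.-homog -> pull L = s' ->
  (forall n B, B \is n.-homog -> (B.@[p 0] != 0) = coprimep (pull B) q) ->
  (forall n A, A \is n.-homog -> exists c, q %| pull A - c%:P * s' ^+ n) ->
  param_ring phi p = pinched q.
Proof.
move=> sE sq ss' s'0 cs' hL EL val md.
have q0 : q != 0 by rewrite -size_poly_gt0 sq.
have s0 : s != 0 by rewrite sE mulf_neq0.
have qN1 P : coprimep P q -> P != 0.
  by apply: contraTneq => ->; rewrite coprime0p -size_poly_eq1 sq.
apply/funext => k; apply/propext; split.
- case=> n [A [B [hA hB Bp ->]]]; rewrite -!/(pull _).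
  have [c /dvdpP [C EA]] := md _ _ hA; have [c' /dvdpP [C' EB]] := md _ _ hB.
  move: Bp; rewrite (val _ _ hB) => Bq; have B0 := qN1 _ Bq.
  have c'0 : c' != 0.
    apply: contraTneq Bq => c'0; move: EB; rewrite c'0 mul0r subr0 => ->.
    by rewrite coprimepMl coprimepp sq andbF.
  exists (c / c'), (tofrac (C - (c / c')%:P * C') / tofrac (pull B)).
    by exists (C - (c / c')%:P * C'), (pull B).
  rewrite mulrA -tofracM /= -[tofrac (c / c')%:P](mulfK (_ : tofrac (pull B) != 0));
    last by rewrite tofrac_eq0.
  rewrite -tofracM -mulrBl -tofracB; congr (tofrac _ / _).
  have -> : pull A = C * q + c%:P * s' ^+ n by rewrite -EA subrK.
  have -> : pull B = C' * q + c'%:P * s' ^+ n by rewrite -EB subrK.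
  have -> : c%:P = (c / c')%:P * c'%:P by rewrite -polyCM divfK.
  ring.
- case=> c [_ [A [B [Bq B0 ->]]]] /eqP; rewrite subr_eq => /eqP ->.
  have /Bezout_eq1_coprimepP [[x y] /= xy1] := Bq.
  pose e := (size A + size B)%N.
  pose t : {poly K} := (x * s' ^+ e.+1) %% q.
  have st : (size t <= 2)%N by rewrite -ltnS -sq ltn_modp.
  have : q %| B * t - s' ^+ e.+1.
    rewrite /t; set z := x * _.
    have -> : z %% q = z - z %/ q * q by rewrite {2}(divp_eq z q) addrC addKr.
    have -> : B * (z - z %/ q * q) - s' ^+ e.+1 =
        - (y * s' ^+ e.+1 + B * (z %/ q)) * q.
      by rewrite -[X in _ - X = _]mul1r -xy1 /z; ring.
    exact: dvdp_mulIr.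
  case/dvdpP => C EC.
  have sP (P P' : {poly K}) : (size (P * P')%R <= (size P + size P').-1)%N.
    exact: size_polyMleq.
  have sC : (size C <= 4 * e + 3)%N.
    have [->|C0] := eqVneq C 0; first by rewrite size_poly0.
    have : size (C * q) = (size C + size q).-1 by apply: size_mul.
    rewrite -EC sq => sCq.
    have : (size (B * t - s' ^+ e.+1)%R <= maxn (size (B * t)%R) (size (s' ^+ e.+1)%R))%N.
      by rewrite -[size (s' ^+ _)]size_polyN; apply: size_polyD.
    rewrite sCq leq_max => /orP [].
      by have := sP B t; rewrite /e; lia.
    have : (size (s' ^+ e.+1)%R <= ((size s').-1 * e.+1).+1)%N := size_poly_exp_leq _ _.
    have : ((size s').-1 * e.+1 <= 4 * e.+1)%N by rewrite leq_mul2r; lia.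
    lia.
  have [|A2 hA2 EA] := @conductor e (A * t).
    by have := sP A t; rewrite /e; lia.
  have [B2 hB2 EB] := @conductor e C sC.
  have hLe : L ^+ e.+2 \is (e.+2).-homog.
    by rewrite -[X in X.-homog]mul1n; apply: dhomogMn.
  have EB3 : pull (L ^+ e.+2 + B2) = B * (s' * t).
    rewrite pullD pullX EL EB sE.
    have -> : q * s' * C = s' * (C * q) by ring.
    by rewrite -EC exprS; ring.
  have copB3 : coprimep (pull (L ^+ e.+2 + B2)) q.
    rewrite pullD pullX EL EB sE coprimep_sym addrC -mulrA [q * _]mulrC.
    by rewrite coprimep_addl_mul coprimep_sym; apply: coprimep_expl.
  have B30 := qN1 _ copB3.
  exists e.+2, (A2 + c *: (L ^+ e.+2 + B2)), (L ^+ e.+2 + B2).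
  have hB3 : L ^+ e.+2 + B2 \is (e.+2).-homog by apply: rpredD.
  split=> //; first by apply: rpredD => //; apply: rpredZ.
    by rewrite (val _ _ hB3).
  rewrite -!/(pull _) pullD pullZ tofracD mulrDl -mul_polyC [in RHS]tofracM.
  rewrite mulfK ?tofrac_eq0 //; congr (_ + _).
  rewrite mulrA -tofracM; apply/eqP.
  rewrite eqr_div ?tofrac_eq0 // -!tofracM tofrac_eq EB3 EA sE.
  by apply/eqP; ring.
Qed.

End LocalRingOfTheCurve.

(** * The quartic with two nodes and a cusp in normal form *)

Definition i0 : 'I_3 := @Ordinal 3 0 isT.
Definition i1 : 'I_3 := @Ordinal 3 1 isT.
Definition i2 : 'I_3 := @Ordinal 3 2 isT.

Lemma forall_ord3 (P : 'I_3 -> Prop) : P i0 -> P i1 -> P i2 -> forall i, P i.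
Proof.
move=> P0 P1 P2 [[|[|[|i]]] //= h].
- by rewrite (_ : Ordinal h = i0) //; apply: val_inj.
- by rewrite (_ : Ordinal h = i1) //; apply: val_inj.
- by rewrite (_ : Ordinal h = i2) //; apply: val_inj.
Qed.

Lemma big_ord3 (R : Type) (idx : R) (op : Monoid.law idx) (F : 'I_3 -> R) :
  \big[op/idx]_i F i = op (op (F i0) (F i1)) (F i2).
Proof.
rewrite !big_ord_recl big_ord0 Monoid.mulm1 Monoid.mulmA.
by congr (op (op (F _) (F _)) (F _)); apply: val_inj.
Qed.

Definition row3 (R : nzRingType) (x y z : R) : 'rV[R]_3 :=
  \row_j nth 0 [:: x; y; z] j.

Lemma row3E (R : nzRingType) (x y z : R) :
  ((row3 x y z 0 i0 = x) * (row3 x y z 0 i1 = y) * (row3 x y z 0 i2 = z))%type.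
Proof. by rewrite !mxE. Qed.

Lemma row3_eta (R : nzRingType) (p : 'rV[R]_3) : p = row3 (p 0 i0) (p 0 i1) (p 0 i2).
Proof. by apply/rowP; apply: forall_ord3; rewrite row3E. Qed.

Notation "''Xx'" := ('X_i0 : {mpoly _[3]}).
Notation "''Xy'" := ('X_i1 : {mpoly _[3]}).
Notation "''Xz'" := ('X_i2 : {mpoly _[3]}).

Section Homogeneous.

Variable K : closedFieldType.
Implicit Types (A B : {mpoly K[3]}).

Lemma homogX i : ('X_i : {mpoly K[3]}) \is 1.-homog.
Proof. by rewrite dhomogX /= mdeg1. Qed.

Lemma homogXn i n : ('X_i ^+ n : {mpoly K[3]}) \is n.-homog.
Proof. by rewrite -[X in X.-homog]mul1n; apply/dhomogMn/homogX. Qed.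

Lemma mpolyX_ord3 m : 'X_[m] = 'X_i0 ^+ m i0 * 'X_i1 ^+ m i1 * 'X_i2 ^+ m i2 :> {mpoly K[3]}.
Proof. by rewrite mpolyXE_id big_ord3. Qed.

Lemma mdeg_ord3 (m : 'X_{1..3}) : mdeg m = (m i0 + m i1 + m i2)%N.
Proof. by rewrite mdegE big_ord3. Qed.

Lemma homog0_const A : A \is 0.-homog -> A = (A@_0%MM)%:MP.
Proof.
move/dhomogP => hA; apply/mpolyP => m; rewrite mcoeffC.
have [->|m0] := eqVneq m 0%MM; first by rewrite mulr1.
rewrite mulr0; apply/eqP; rewrite mcoeff_eq0; apply: contraNN m0 => /hA /= /eqP.
by rewrite mdeg_eq0.
Qed.

Lemma homog_ind n (P : {mpoly K[3]} -> Prop) :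
  P 0 -> (forall A B, P A -> P B -> P (A + B)) -> (forall c A, P A -> P (c *: A)) ->
  (forall i j l, (i + j + l)%N = n -> P ('X_i0 ^+ i * 'X_i1 ^+ j * 'X_i2 ^+ l)) ->
  forall A, A \is n.-homog -> P A.
Proof.
move=> P0 PD PZ PX A /dhomogP hA; rewrite [A]mpolyE big_seq.
apply: (big_ind P) => // m /hA /= md; apply: (PZ); rewrite mpolyX_ord3; apply: PX.
by rewrite -md mdeg_ord3.
Qed.

(** Splitting off the part of a form divisible by the last variable. *)
Lemma homog_split n A : A \is n.+1.-homog ->
  exists (al : nat -> K) A', A' \is n.-homog /\
   A = \sum_(i < n.+2) al i *: ('X_i0 ^+ i * 'X_i1 ^+ (n.+1 - i)) + 'X_i2 * A'.
Proof.
move: A; apply: homog_ind.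
- exists (fun=> 0), 0; rewrite rpred0 mulr0 addr0 big1 // => i _.
  by rewrite scale0r.
- move=> A B [al [A' [hA' ->]]] [bl [B' [hB' ->]]].
  exists (fun i => al i + bl i), (A' + B'); split; first exact: rpredD.
  rewrite addrACA -mulrDr -big_split /=; congr (_ + _); apply: eq_bigr => i _.
  by rewrite scalerDl.
- move=> c A [al [A' [hA' ->]]].
  exists (fun i => c * al i), (c *: A'); split; first exact: rpredZ.
  rewrite scalerDr scaler_sumr scalerAr; congr (_ + _); apply: eq_bigr => i _.
  by rewrite scalerA.
- move=> i j [|l] E.
    exists (fun h => (h == i)%:R), 0; rewrite rpred0 mulr0 addr0 expr0 mulr1.
    have hi : (i < n.+2)%N by lia.
    rewrite (bigD1 (Ordinal hi)) //= eqxx scale1r big1 ?addr0.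
      by split=> //; congr (_ * _ ^+ _); lia.
    move=> h hh; rewrite (_ : (h == i :> nat) = false) ?scale0r //.
    by apply/negbTE; rewrite -val_eqE in hh.
  exists (fun=> 0), ('X_i0 ^+ i * 'X_i1 ^+ j * 'X_i2 ^+ l); split.
    have -> : n = (i + j + l)%N by lia.
    by apply: dhomogM; [apply: dhomogM|]; apply: homogXn.
  by rewrite big1 ?add0r => [|h _]; rewrite ?scale0r // exprS; ring.
Qed.

(* [p] has degree at most [n], with coefficient [x] in degree [n]. *)
Let top_coef n (p : {poly K}) x := (size p <= n.+1)%N /\ p`_n = x.

Let top_coefM m n p q x y :
  top_coef m p x -> top_coef n q y -> top_coef (m + n) (p * q) (x * y).
Proof.
move=> [sp px] [sq qy]; split.
  have sz : (size (p * q)%R <= (size p + size q).-1)%N := size_polyMleq _ _.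
  by rewrite (leq_trans sz) //; lia.
have hm : (m < (m + n).+1)%N by lia.
rewrite coefM (bigD1 (Ordinal hm)) //= addKn px qy big1 ?addr0 // => i im.
have := ltn_ord i; rewrite -val_eqE /= in im.
have [lt_im|lt_mi|eq_im] := ltngtP i m.
- by move=> _; rewrite [q`__]nth_default ?mulr0 // (leq_trans sq) //; lia.
- by move=> _; rewrite nth_default ?mul0r // (leq_trans sp).
- by rewrite eq_im eqxx in im.
Qed.

Let top_coefX m n p x : top_coef m p x -> top_coef (m * n) (p ^+ n) (x ^+ n).
Proof.
move=> px; elim: n => [|n IHn].
  by rewrite muln0 !expr0; split; rewrite ?size_polyC ?coefC ?oner_neq0.
by rewrite mulnS !exprS; apply: top_coefM.
Qed.

(** The value of a form at the point at infinity of a parametrization by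
    polynomials of degree at most [d] is the coefficient of highest degree. *)
Lemma mmap_top_coef d n (h : 'I_3 -> {poly K}) A :
  (forall i, (size (h i) <= d.+1)%N) -> A \is n.-homog ->
  (size (mmap (@polyC K) h A) <= (d * n).+1)%N /\
  (mmap (@polyC K) h A)`_(d * n) = A.@[fun i => (h i)`_d].
Proof.
move=> sh; move: A; apply: homog_ind.
- by rewrite raddf0 meval0 size_poly0 coef0.
- move=> A B [sA EA] [sB EB]; rewrite !raddfD /= coefD EA EB; split=> //.
  by rewrite (leq_trans (size_polyD _ _)) // geq_max sA.
- move=> c A [sA EA]; rewrite mmapZ mul_polyC mevalZ coefZ EA; split=> //.
  by rewrite (leq_trans (size_scale_leq _ _)).
- move=> i j l <-; rewrite !rmorphM !rmorphXn /= !mmapX !mmap1U !mevalXU !mulnDr.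
  have tX i' m : top_coef (d * m) (h i' ^+ m) ((h i')`_d ^+ m) by apply: top_coefX.
  exact: top_coefM (top_coefM (tX _ _) (tX _ _)) (tX _ _).
Qed.

(** Modulo [q], a form restricts to the curve as its value at the point above
    the roots of [q]. *)
Lemma mmap_dvd n q s' (x : 'rV[K]_3) (h : 'I_3 -> {poly K}) A :
  (forall i, q %| h i - s' * (x 0 i)%:P) -> A \is n.-homog ->
  q %| mmap (@polyC K) h A - (A.@[x 0])%:P * s' ^+ n.
Proof.
move=> hq hA.
have -> : (A.@[x 0])%:P * s' ^+ n =
    mmap (@polyC K) (fun i => s' * (x 0 i)%:P) A.
  rewrite (mmap_homog _ _ _ hA) mulrC; congr (_ * _).
  elim/mpoly_alg_ind: (A) => [c|i|B C IB IC|B C IB IC].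
  - by rewrite mevalC mmapC.
  - by rewrite mevalXU mmapX mmap1U.
  - by rewrite !rmorphD /= IB IC.
  - by rewrite !rmorphM /= IB IC.
elim/mpoly_alg_ind: (A) => [c|i|B C IB IC|B C IB IC].
- by rewrite !mmapC subrr dvdp0.
- by rewrite !mmapX !mmap1U.
- by rewrite !rmorphD /= opprD addrACA dvdp_add.
- have dvdM (x1 x2 y1 y2 : {poly K}) : q %| x1 - x2 -> q %| y1 - y2 ->
      q %| x1 * y1 - x2 * y2.
    have -> : x1 * y1 - x2 * y2 = (x1 - x2) * y1 + x2 * (y1 - y2) by ring.
    by move=> dx dy; apply: dvdp_add; [apply: dvdp_mulr|apply: dvdp_mull].
  by rewrite !rmorphM /=; apply: dvdM.
Qed.

End Homogeneous.

Section NormalQuartic.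

Variables (K : closedFieldType).

Definition unit_quad (a c : K) : {poly K} := 1 + a%:P * 'X + c%:P * 'X^2.

Definition normal_quartic (a c d : K) : {mpoly K[3]} :=
  ('X_i1 * 'X_i2 - 'X_i0 * 'X_i2 - (c - d) *: ('X_i0 * 'X_i1)) ^+ 2 -
  'X_i0 * 'X_i1 * ('X_i1 * 'X_i2
    - a *: ('X_i1 * 'X_i2 - 'X_i0 * 'X_i2 - (c - d) *: ('X_i0 * 'X_i1))
    - c *: ('X_i0 * 'X_i1)).

Variables (a c d : K).

Let b := a - 1.
Let k := c - d.

Definition uu := unit_quad a c.
Definition vv := unit_quad b d.
Definition phi0 : 'rV[{poly K}]_3 := row3 ('X^2 * vv) ('X^2 * uu) (uu * vv).

Definition res_uv := k ^+ 2 - a * k + c.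

Hypotheses (c0 : c != 0) (d0 : d != 0) (R0 : res_uv != 0).
Hypotheses (Du0 : a ^+ 2 - 4 * c != 0) (Dv0 : b ^+ 2 - 4 * d != 0).

Let u := uu.
Let v := vv.

Lemma unit_quadE a' c' r : (unit_quad a' c').[r] = 1 + a' * r + c' * r ^+ 2.
Proof. by rewrite !hornerE. Qed.

Lemma size_unit_quad a' c' : c' != 0 -> size (unit_quad a' c') = 3%N.
Proof.
move=> c'0.
have sc : size (c'%:P * 'X^2) = 3%N by rewrite mul_polyC size_scale // size_polyXn.
rewrite /unit_quad addrC size_polyDl sc //.
rewrite (leq_ltn_trans (size_polyD _ _)) // gtn_max size_polyC oner_neq0.
by rewrite mul_polyC (leq_ltn_trans (size_scale_leq _ _)) // size_polyX.
Qed.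

Lemma unit_quad_root0 a' c' r : root (unit_quad a' c') r -> r != 0.
Proof.
by apply: contraTneq => ->; rewrite rootE unit_quadE mulr0 expr0n mulr0 !addr0 oner_neq0.
Qed.

Let size_u : size u = 3%N. Proof. exact: size_unit_quad. Qed.
Let size_v : size v = 3%N. Proof. exact: size_unit_quad. Qed.
Let u0 : u != 0. Proof. by rewrite -size_poly_gt0 size_u. Qed.
Let v0 : v != 0. Proof. by rewrite -size_poly_gt0 size_v. Qed.

Lemma unit_quad_roots (a' c' : K) : c' != 0 -> a' ^+ 2 - 4 * c' != 0 ->
  exists r s : K, [/\ r != s, a' = - (c' * (r + s)), c' * (r * s) = 1
    & unit_quad a' c' = c'%:P * (('X - r%:P) * ('X - s%:P))].
Proof.
move=> c'0 D0; pose p := unit_quad a' c'.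
have sp : size p = 3%N by apply: size_unit_quad.
have [r pr] : exists r, root p r by apply: closed_rootP; rewrite sp.
have r0 := unit_quad_root0 pr.
exists r, (c' * r)^-1.
have E : 1 + a' * r + c' * r ^+ 2 = 0 by rewrite -unit_quadE; apply/eqP.
have Ea : a' = - (c' * (r + (c' * r)^-1)).
  have -> : a' = (1 + a' * r + c' * r ^+ 2 - 1 - c' * r ^+ 2) / r by field.
  by rewrite E; field; rewrite r0 c'0.
split=> //.
- apply: contraNneq D0 => rs; apply/eqP.
  have cr : c' * r ^+ 2 = 1 by rewrite expr2 mulrA {2}rs mulfV // mulf_neq0.
  rewrite Ea -rs (_ : _ - _ = 4 * c' * (c' * r ^+ 2 - 1)); last by ring.
  by rewrite cr subrr mulr0.
- by field; rewrite r0 c'0.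
- rewrite /unit_quad {1}Ea.
  have -> : (1 : {poly K}) = (c' * (r * (c' * r)^-1))%:P.
    by rewrite (_ : _ * _ = 1) //; field; rewrite r0 c'0.
  by rewrite !(polyCN, polyCM, polyCD); ring.
Qed.

Let u_sub_v : u - v = 'X + k%:P * 'X^2.
Proof. by rewrite /u /v /uu /vv /unit_quad /b /k !polyCB polyC1; ring. Qed.

Let no_common_root r : root u r -> root v r -> False.
Proof.
move=> ur vr; have r0 := unit_quad_root0 ur.
have : (u - v).[r] = 0 by rewrite hornerD hornerN (eqP ur) (eqP vr) subr0.
rewrite u_sub_v !hornerE /= => E.
have kr : k * r = -1.
  apply: (mulIf r0); apply/eqP; rewrite -subr_eq0; apply/eqP.
  by rewrite -[RHS]E; ring.
case/negP: R0; rewrite /res_uv; apply/eqP.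
apply: (mulIf (expf_neq0 2 r0)); rewrite mul0r.
move: ur; rewrite rootE unit_quadE => /eqP <-.
have -> : (k ^+ 2 - a * k + c) * r ^+ 2 = (k * r) ^+ 2 - a * r * (k * r) + c * r ^+ 2 by ring.
by rewrite kr; ring.
Qed.

Lemma coprime_uv : coprimep u v.
Proof.
by apply/Pdiv.ClosedField.coprimepP => r ur; apply/negP => vr; apply: no_common_root ur vr.
Qed.

Lemma coprime_unit_quad_Xn a' c' n : coprimep ('X^n) (unit_quad a' c').
Proof.
apply: coprimep_expl; rewrite coprimep_sym coprimepX rootE unit_quadE.
by rewrite mulr0 expr0n mulr0 !addr0 oner_neq0.
Qed.

Let pull (A : {mpoly K[3]}) : {poly K} := mmap (@polyC K) (phi0 0) A.
Let pullM A B : pull (A * B) = pull A * pull B.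
Proof. exact: rmorphM. Qed.
Let pullD A B : pull (A + B) = pull A + pull B.
Proof. exact: rmorphD. Qed.
Let pullXn A n : pull (A ^+ n) = pull A ^+ n.
Proof. exact: rmorphXn. Qed.
Let pullZ e A : pull (e *: A) = e%:P * pull A.
Proof. by rewrite /pull mmapZ. Qed.
Let pullX i : pull 'X_i = phi0 0 i.
Proof. by rewrite /pull mmapX mmap1U. Qed.
Let pullE := (pullX, pullM, pullD, pullZ, pullXn).

Lemma pull_normal_quartic : pull (normal_quartic a c d) = 0.
Proof.
have pullB A B : pull (A - B) = pull A - pull B by exact: rmorphB.
rewrite /normal_quartic !(pullB, pullE) !row3E /uu /vv /unit_quad /b; ring.
Qed.

Definition conductor_poly := uu * vv * 'X^2.
Let s := conductor_poly.

Lemma bezout_split (p q f : {poly K}) n : coprimep p q -> p != 0 ->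
  q != 0 -> (size f <= n)%N -> (size q + size p <= n.+2)%N ->
  exists g h, [/\ f = p * g + q * h, (size h < size p)%N & (size g + size p <= n.+1)%N].
Proof.
move=> /Bezout_eq1_coprimepP [[x y] /= xy1] p0 q0 sf sq.
have q_gt0 : (0 < size q)%N by rewrite size_poly_gt0.
pose h : {poly K} := (f * y) %% p.
pose g : {poly K} := f * x + q * ((f * y) %/ p).
have sh : (size h < size p)%N by rewrite ltn_modp.
have E : f = p * g + q * h.
  have -> : h = f * y - (f * y) %/ p * p.
    by rewrite {1}(divp_eq (f * y) p) addrC addKr.
  by rewrite -[LHS]mulr1 -xy1 /g; ring.
exists g, h; split=> //.
have [->|g0] := eqVneq g 0.
  by rewrite size_poly0 add0n; clear -sq q_gt0; slia.
have spg : size (p * g) = (size p + size g).-1 by apply: size_mul.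
have : (size (f - q * h)%R <= maxn (size f) (size (q * h)%R))%N.
  by rewrite -[size (q * h)]size_polyN; apply: size_polyD.
have sqh : (size (q * h)%R <= (size q + size h).-1)%N := size_polyMleq _ _.
rewrite {1}E addrK spg leq_max; clear -sf sq sh sqh q_gt0.
by move=> /orP []; slia.
Qed.

Lemma normal_conductor e (P : {poly K}) : (size P <= 4 * e + 3)%N ->
  exists2 A, A \is (e.+2).-homog & pull A = s * P.
Proof.
have size_w : size ('X^2 : {poly K}) = 3%N by rewrite size_polyXn.
have size_uv : size (u * v) = 5%N.
  have -> : size (u * v) = (size u + size v).-1 by apply: size_mul.
  by rewrite size_u size_v.
elim: e P => [|e IHe] P sP.
  have -> : P = (P`_0)%:P + (P`_1)%:P * 'X + (P`_2)%:P * 'X^2.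
    rewrite [LHS](poly_sum_Xn (sP : size P <= 3)%N) !big_ord_recl big_ord0 addr0.
    by rewrite /= !mul_polyC expr0 expr1 alg_polyC addrA.
  pose q := P`_1 - a * P`_0.
  exists ((P`_0 + q) *: ('X_i1 * 'X_i2) - q *: ('X_i0 * 'X_i2)
          + (P`_2 - c * P`_0 - k * q) *: ('X_i0 * 'X_i1)).
    have hom2 i j : 'X_i * 'X_j \is [in K[3], 2.-homog].
      by apply: (@dhomogM _ _ _ 1 _ 1); apply: homogX.
    by apply: rpredD; [apply: rpredB|]; apply: rpredZ; apply: hom2.
  rewrite -scaleNr !pullE !row3E /s /conductor_poly /q /uu /vv /unit_quad /b /k; ring.
have [|||||k1 [l1 [-> sl1 sk1]]] := @bezout_split 'X^2 (u * v) P (4 * e + 7).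
- by rewrite coprimepMr !coprime_unit_quad_Xn.
- by rewrite -size_poly_gt0 size_w.
- by rewrite -size_poly_gt0 size_uv.
- by slia.
- by rewrite size_uv size_w; slia.
rewrite size_w in sl1 sk1.
have [|||||k2 [l2 [-> sl2 sk2]]] := @bezout_split u v k1 (4 * e + 5).
- exact: coprime_uv.
- exact: u0.
- exact: v0.
- by slia.
- by rewrite size_u size_v; slia.
rewrite size_u in sl2 sk2.
have [|A hA EA] := IHe l2; first by clear -sl2; slia.
have [|B hB EB] := IHe k2; first by clear -sk2; slia.
have [|C hC EC] := IHe l1; first by clear -sl1; slia.
exists ('X_i0 * A + 'X_i1 * B + 'X_i2 * C).
  by apply: rpredD; [apply: rpredD|]; apply: (@dhomogM _ _ _ 1) => //; apply: homogX.
rewrite !pullE !row3E EA EB EC; rewrite -/u -/v; ring.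
Qed.

Lemma unit_quad_root2 (a' c' : K) : c' != 0 -> a' ^+ 2 - 4 * c' != 0 ->
  exists r s : K, [/\ r != s, root (unit_quad a' c') r & root (unit_quad a' c') s].
Proof.
move=> c'0 D0; have [r [t [rt _ _ ->]]] := unit_quad_roots c'0 D0.
by exists r, t; rewrite !rootM !root_XsubC !eqxx !orbT.
Qed.

Let linear_eq0 (r t x y : K) : r != t -> x * r = y -> x * t = y -> x = 0 /\ y = 0.
Proof.
move=> rt xr xt; have x0 : x = 0.
  apply: (mulIf (_ : r - t != 0)); first by rewrite subr_eq0.
  by rewrite mulrBr xr xt subrr mul0r.
by split=> //; rewrite -xr x0 mul0r.
Qed.

Let pull_at_u n A r : A \is n.-homog -> root u r ->
  (pull A).[r] = (r ^+ 2 * v.[r]) ^+ n * A.@[row3 1 0 0 0].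
Proof.
move=> hA ur; rewrite /pull horner_mmap -(meval_homog _ _ hA); apply: meval_eq.
apply: forall_ord3; rewrite [RHS]mxE !row3E !(hornerXn, hornerM).
- by rewrite mulr1.
- by rewrite -/u (eqP ur) !mulr0.
- by rewrite -/u (eqP ur) mul0r mulr0.
Qed.

Let pull_at_v n A r : A \is n.-homog -> root v r ->
  (pull A).[r] = (r ^+ 2 * u.[r]) ^+ n * A.@[row3 0 1 0 0].
Proof.
move=> hA vr; rewrite /pull horner_mmap -(meval_homog _ _ hA); apply: meval_eq.
apply: forall_ord3; rewrite [RHS]mxE !row3E !(hornerXn, hornerM).
- by rewrite -/v (eqP vr) !mulr0.
- by rewrite mulr1.
- by rewrite -/v (eqP vr) !mulr0.
Qed.

Let u_neq0_v r : root v r -> u.[r] != 0.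
Proof. by move=> vr; apply/negP => ur; apply: no_common_root ur vr. Qed.

Let v_neq0_u r : root u r -> v.[r] != 0.
Proof. by move=> ur; apply/negP => vr; apply: no_common_root ur vr. Qed.

Let u_sub_v_at r : u.[r] - v.[r] = r * (1 + k * r).
Proof. by rewrite -hornerN -hornerD u_sub_v !hornerE /=; ring. Qed.

Let kernel_horner n (al : K) (p q S A' : {poly K}) x :
  ('X^2 ^+ n.+1 * (al%:P * p ^+ n + q * S) + p * A').[x] =
  (x ^+ 2) ^+ n.+1 * (al * p.[x] ^+ n + q.[x] * S.[x]) + p.[x] * A'.[x].
Proof.
by rewrite !(horner_exp, hornerC, hornerX, hornerD, hornerM).
Qed.

(* A form vanishing on the curve has no monomial in x, y alone outside of the
   ideal of x^2 y^2: the excluded ones are detected at the two nodes. *)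
Let kernel_coef_u n (al : K) (S A' : {poly K}) A :
  A \is n.-homog -> A' = pull A ->
  'X^2 ^+ n.+1 * (al%:P * v ^+ n + u * S) + v * A' = 0 -> al = 0.
Proof.
move=> hA -> E; have [r [t [rt ur ut]]] := unit_quad_root2 c0 Du0.
have H x : root u x -> (al - k * A.@[row3 1 0 0 0]) * x = A.@[row3 1 0 0 0].
  move=> ux; have x0 := unit_quad_root0 ux; have vx := v_neq0_u ux.
  have := congr1 (fun P : {poly K} => P.[x]) E.
  rewrite horner0 kernel_horner.
  rewrite (eqP (ux : u.[x] == 0)) mul0r addr0 (pull_at_u hA ux).
  have -> : v.[x] = - (x * (1 + k * x)).
    by rewrite -u_sub_v_at (eqP (ux : u.[x] == 0)) sub0r opprK.
  move: vx; rewrite -[v.[x]]opprK -[- v.[x]]add0r.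
  rewrite -{1}(eqP (ux : u.[x] == 0)) u_sub_v_at oppr_eq0.
  set z := x * (1 + k * x) => z0; set m := A.@[_].
  rewrite exprS; set y := (x ^+ 2) ^+ n.
  have -> : (x ^+ 2 * - z) ^+ n = y * (- z) ^+ n by rewrite exprMn.
  have -> : x ^+ 2 * y * (al * (- z) ^+ n) + - z * (y * (- z) ^+ n * m) =
     (y * (- z) ^+ n * x) * ((al - k * m) * x - m).
    by rewrite {2}/z; ring.
  move/eqP; rewrite mulf_eq0 (_ : _ * x == 0 = false) /=.
    by rewrite subr_eq0 => /eqP.
  by apply/negbTE; rewrite !mulf_neq0 ?expf_neq0 ?oppr_eq0.
have [E1 E2] := linear_eq0 rt (H _ ur) (H _ ut).
by move: E1; rewrite E2 mulr0 subr0.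
Qed.

Let kernel_coef_v n (al : K) (S A' : {poly K}) A :
  A \is n.-homog -> A' = pull A ->
  'X^2 ^+ n.+1 * (al%:P * u ^+ n + v * S) + u * A' = 0 -> al = 0.
Proof.
move=> hA -> E; have [r [t [rt vr vt]]] := unit_quad_root2 d0 Dv0.
have H x : root v x -> (al + k * A.@[row3 0 1 0 0]) * x = - A.@[row3 0 1 0 0].
  move=> vx; have x0 := unit_quad_root0 vx; have ux := u_neq0_v vx.
  have := congr1 (fun P : {poly K} => P.[x]) E.
  rewrite horner0 kernel_horner.
  rewrite (eqP (vx : v.[x] == 0)) mul0r addr0 (pull_at_v hA vx).
  have uE : u.[x] = x * (1 + k * x).
    by rewrite -u_sub_v_at (eqP (vx : v.[x] == 0)) subr0.
  move: ux; rewrite uE.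
  set z := x * (1 + k * x) => z0; set m := A.@[_].
  rewrite exprS; set y := (x ^+ 2) ^+ n.
  have -> : (x ^+ 2 * z) ^+ n = y * z ^+ n by rewrite exprMn.
  have -> : x ^+ 2 * y * (al * z ^+ n) + z * (y * z ^+ n * m) =
     (y * z ^+ n * x) * ((al + k * m) * x - - m).
    by rewrite {2}/z; ring.
  move/eqP; rewrite mulf_eq0 (_ : _ * x == 0 = false) /=.
    by rewrite subr_eq0 => /eqP.
  by apply/negbTE; rewrite !mulf_neq0 ?expf_neq0.
have [E1 /eqP] := linear_eq0 rt (H _ vr) (H _ vt).
by rewrite oppr_eq0 => /eqP E2; move: E1; rewrite E2 mulr0 addr0.
Qed.

Let normal_quarticE : normal_quartic a c d =
  res_uv%:MP * ('X_i0 ^+ 2 * 'X_i1 ^+ 2) +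
  'X_i2 * ('X_i2 * ('X_i1 - 'X_i0) ^+ 2 + (a - 2 * k)%:MP * ('X_i0 * 'X_i1 * ('X_i1 - 'X_i0))
           - 'X_i0 * 'X_i1 ^+ 2).
Proof. rewrite /normal_quartic -!mul_mpolyC /res_uv /k; ring. Qed.

(** The forms vanishing on the parametrized curve are the multiples of its
    equation: a form of degree [n] is reduced modulo the equation, which contains
    x^2 y^2, to a multiple of z, and the quotient by z vanishes again. *)
Lemma normal_kernel n A : A \is n.-homog -> pull A = 0 ->
  exists B, A = normal_quartic a c d * B.
Proof.
elim: n A => [|n IHn] A hA PA.
  move: PA; rewrite (homog0_const hA) /pull mmapC => /eqP; rewrite polyC_eq0 => /eqP ->.
  by exists 0; rewrite mulr0 mpolyC0.
have [al [A' [hA' EA]]] := homog_split hA.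
pose T := \sum_(i < n.+2) (al i)%:P * (v ^+ i * u ^+ (n.+1 - i)).
have E : 'X^2 ^+ n.+1 * T + u * v * pull A' = 0.
  rewrite -PA EA pullD pullM pullX row3E; congr (_ + _).
  rewrite [pull _]raddf_sum mulr_sumr; apply: eq_bigr => i _ /=.
  rewrite -/(pull _) pullZ pullM !pullXn !pullX !row3E -/u -/v.
  move: ('X^2 : {poly K}) => w.
  rewrite (exprMn _ w v) (exprMn _ w u) -{1}(@subnKC i n.+1) -1?ltnS // exprD.
  ring.
have [al_top al_topm] : al n.+1 = 0 /\ al n = 0.
  pose T1 := \sum_(i < n.+1) (al i)%:P * (v ^+ i * u ^+ (n - i)).
  have ET : T = u * T1 + (al n.+1)%:P * v ^+ n.+1.
    rewrite /T big_ord_recr /= subnn mulr1; congr (_ + _).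
    rewrite mulr_sumr; apply: eq_bigr => i _.
    by rewrite subSn ?exprS -1?ltnS //; ring.
  have al0 : al n.+1 = 0.
    have [r [_ [_ ur _]]] := unit_quad_root2 c0 Du0.
    have r0 := unit_quad_root0 ur; have vr := v_neq0_u ur.
    have := congr1 (fun P : {poly K} => P.[r]) E.
    rewrite ET hornerD (hornerM (u * v)) (hornerM u) (eqP (ur : u.[r] == 0)).
    rewrite !mul0r addr0 hornerM hornerD (hornerM u) (eqP (ur : u.[r] == 0)).
    rewrite mul0r add0r hornerM hornerC !horner_exp hornerX horner0 => /eqP.
    rewrite mulf_eq0 (negbTE (expf_neq0 _ (expf_neq0 _ r0))).
    by rewrite mulf_eq0 (negbTE (expf_neq0 _ vr)) orbF => /eqP.
  split=> //; pose T2 := \sum_(i < n) (al i)%:P * (v ^+ i * u ^+ (n - i.+1)).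
  have ET1 : T1 = (al n)%:P * v ^+ n + u * T2.
    rewrite /T1 big_ord_recr /= subnn mulr1 addrC; congr (_ + _).
    rewrite mulr_sumr; apply: eq_bigr => i _.
    by rewrite -(subnSK (ltn_ord i)) exprS; ring.
  apply: (kernel_coef_u (S := T2) hA' erefl); rewrite -ET1; apply: (mulfI u0).
  by rewrite mulr0 -[RHS]E ET al0 polyC0 mul0r addr0; ring.
have [al_0 al_1] : al 0%N = 0 /\ al 1%N = 0.
  pose T1 := \sum_(i < n.+1) (al i.+1)%:P * (v ^+ i * u ^+ (n - i)).
  have ET : T = (al 0%N)%:P * u ^+ n.+1 + v * T1.
    rewrite /T big_ord_recl /= subn0 mul1r; congr (_ + _).
    rewrite mulr_sumr; apply: eq_bigr => i _.
    by rewrite /bump /= add1n subSS exprS; ring.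
  have al0 : al 0%N = 0.
    have [r [_ [_ vr _]]] := unit_quad_root2 d0 Dv0.
    have r0 := unit_quad_root0 vr; have ur := u_neq0_v vr.
    have := congr1 (fun P : {poly K} => P.[r]) E.
    rewrite ET hornerD (hornerM (u * v)) (hornerM u) (eqP (vr : v.[r] == 0)).
    rewrite mulr0 mul0r addr0 hornerM hornerD (hornerM v) (eqP (vr : v.[r] == 0)).
    rewrite mul0r addr0 hornerM hornerC !horner_exp hornerX horner0 => /eqP.
    rewrite mulf_eq0 (negbTE (expf_neq0 _ (expf_neq0 _ r0))).
    by rewrite mulf_eq0 (negbTE (expf_neq0 _ ur)) orbF => /eqP.
  split=> //; pose T2 := \sum_(i < n) (al i.+2)%:P * (v ^+ i * u ^+ (n - i.+1)).
  have ET1 : T1 = (al 1%N)%:P * u ^+ n + v * T2.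
    rewrite /T1 big_ord_recl /= subn0 mul1r; congr (_ + _).
    rewrite mulr_sumr; apply: eq_bigr => i _.
    by rewrite /bump /= !add1n exprS; ring.
  apply: (kernel_coef_v (S := T2) hA' erefl); rewrite -ET1; apply: (mulfI v0).
  by rewrite mulr0 -[RHS]E ET al0 polyC0 mul0r add0r; ring.
pose B := \sum_(i < n.+2 | (2 <= i)%N && (i.+2 <= n.+1)%N)
  al i *: ('X_i0 ^+ (i - 2) * 'X_i1 ^+ (n.+1 - i.+2)) : {mpoly K[3]}.
have EB : \sum_(i < n.+2) al i *: ('X_i0 ^+ i * 'X_i1 ^+ (n.+1 - i)) =
    'X_i0 ^+ 2 * 'X_i1 ^+ 2 * B.
  rewrite mulr_sumr [RHS]big_mkcond /=; apply: eq_bigr => i _.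
  case: ifP => [/andP [i2 iN]|iN]; last first.
    suff -> : al i = 0 by rewrite scale0r.
    have := ltn_ord i; have [->|i_0] := eqVneq (i : nat) 0%N => //.
    have [->|i_1] := eqVneq (i : nat) 1%N => //.
    have [->|i_n] := eqVneq (i : nat) n => //.
    have [->|i_N] := eqVneq (i : nat) n.+1 => //.
    by move=> h; move: iN i_0 i_1 i_n i_N h; clear; lia.
  rewrite -scalerAr; congr (_ *: _).
  rewrite -{1}(subnKC i2) exprD (_ : n.+1 - i = 2 + (n.+1 - i.+2))%N; last first.
    by clear -i2 iN; lia.
  by rewrite exprD; ring.
pose E0 : {mpoly K[3]} := 'X_i2 * ('X_i1 - 'X_i0) ^+ 2
  + (a - 2 * k)%:MP * ('X_i0 * 'X_i1 * ('X_i1 - 'X_i0)) - 'X_i0 * 'X_i1 ^+ 2.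
have hE0B : E0 * B \is n.-homog.
  have hX i := homogX K i.
  have hX2 : 'X_i1 - 'X_i0 \is [in K[3], 1.-homog] by apply: rpredB.
  have hE0 : E0 \is 3.-homog.
    apply: rpredB; [apply: rpredD|].
    - by apply: (@dhomogM _ _ _ 1 _ 2) => //; apply: (@dhomogMn _ _ _ 1).
    - rewrite mul_mpolyC; apply: rpredZ; apply: (@dhomogM _ _ _ 2 _ 1) => //.
      exact: (@dhomogM _ _ _ 1 _ 1).
    - by apply: (@dhomogM _ _ _ 1 _ 2) => //; apply: homogXn.
  rewrite mulr_sumr; apply: rpred_sum => i /andP [i2 iN].
  rewrite -scalerAr; apply: rpredZ.
  have deg_n : (3 + ((i - 2) + (n.+1 - i.+2)) = n)%N by clear -i2 iN; lia.
  have := dhomogM hE0 (dhomogM (homogXn K i0 (i - 2)) (homogXn K i1 (n.+1 - i.+2))).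
  by rewrite deg_n.
have EN : normal_quartic a c d = res_uv%:MP * ('X_i0 ^+ 2 * 'X_i1 ^+ 2) + 'X_i2 * E0.
  exact: normal_quarticE.
have R1 : (res_uv^-1)%:MP * res_uv%:MP = 1 :> {mpoly K[3]}.
  by rewrite -mpolyCM mulVf.
pose A2 := A' - res_uv^-1 *: (E0 * B).
have hA2 : A2 \is n.-homog by apply: rpredB => //; apply: rpredZ.
have EA2 : A = normal_quartic a c d * (res_uv^-1 *: B) + 'X_i2 * A2.
  rewrite EA EB EN /A2 -!mul_mpolyC.
  have -> : 'X_i0 ^+ 2 * 'X_i1 ^+ 2 * B =
     (res_uv^-1)%:MP * res_uv%:MP * ('X_i0 ^+ 2 * 'X_i1 ^+ 2 * B) by rewrite R1 mul1r.
  ring.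
have [C EC] : exists C, A2 = normal_quartic a c d * C.
  apply: IHn => //; move: PA; rewrite EA2 pullD pullM pull_normal_quartic mul0r add0r.
  rewrite pullM pullX row3E => /eqP; rewrite mulf_eq0 mulf_eq0.
  by rewrite (negbTE u0) (negbTE v0) /= => /eqP.
by exists (res_uv^-1 *: B + 'X_i2 * C); rewrite EA2 {1}EC; ring.
Qed.

End NormalQuartic.

Lemma mup_factor (K : closedFieldType) (g : {poly K}) r : g != 0 ->
  exists2 h, g = ('X - r%:P) ^+ mup r g * h & ~~ root h r.
Proof.
move=> g0; have := mup_geq r (mup r g) g0; rewrite leqnn => /esym/dvdpP [h E].
exists h; first by rewrite {1}E mulrC.
apply/negP => /factor_theorem [h' Eh'].
have := mup_geq r (mup r g).+1 g0; rewrite ltnn => /esym/negP; apply.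
by rewrite {2}E Eh' -mulrA -exprS dvdp_mull.
Qed.

Section MultiplicitiesOnTheQuartic.

Variables (K : closedFieldType) (a c d : K).

Let b := a - 1.
Let u := uu a c.
Let v := vv a d.
Let s := conductor_poly a c d.

Hypotheses (c0 : c != 0) (d0 : d != 0) (R0 : res_uv a c d != 0).
Hypotheses (Du0 : a ^+ 2 - 4 * c != 0) (Dv0 : b ^+ 2 - 4 * d != 0).

Variables (Q : {mpoly K[3]}) (M : 'M[K]_3) (kap : K).
Hypotheses (M_unit : M \in unitmx) (kap0 : kap != 0).
Hypothesis Q_normal : lin_sub M Q = kap *: normal_quartic a c d.

Let phi := phi0 a c d *m map_mx (@polyC K) M.

(** The restriction of a form to the parametrized quartic. *)
Definition pullback (A : {mpoly K[3]}) : {poly K} :=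
  mmap (@polyC K) (phi0 a c d 0) A.

Let pull (A : {mpoly K[3]}) : {poly K} := mmap (@polyC K) (phi 0) A.

Let pullE A : pull A = pullback (lin_sub M A).
Proof. by rewrite /pull /pullback mmap_lin_sub. Qed.

Let Q_pull : pull Q = 0.
Proof. by rewrite pullE Q_normal /pullback mmapZ /= pull_normal_quartic mulr0. Qed.

Let Q_kernel n A : A \is n.-homog -> pull A = 0 -> exists B, A = Q * B.
Proof.
rewrite pullE => hA A0.
have [B EB] := normal_kernel c0 d0 R0 Du0 Dv0 (lin_sub_homog M hA) A0.
exists (kap^-1 *: lin_sub (invmx M) B).
rewrite -[LHS](lin_subK A M_unit) EB rmorphM /= -scalerAr.
rewrite -[X in _ *: (X * _)](lin_subK Q M_unit) Q_normal lin_subZ -scalerAl.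
by rewrite scalerA mulVf // scale1r.
Qed.

Let phi_conductor e (P : {poly K}) : (size P <= 4 * e + 3)%N ->
  exists2 A, A \is (e.+2).-homog & pull A = s * P.
Proof.
move=> sP; have [A hA EA] := normal_conductor c0 d0 R0 Du0 Dv0 sP.
exists (lin_sub (invmx M) A); first exact: lin_sub_homog.
by rewrite pullE lin_subKV.
Qed.

Let size_u : size u = 3%N. Proof. exact: size_unit_quad. Qed.
Let size_v : size v = 3%N. Proof. exact: size_unit_quad. Qed.
Let u0 : u != 0. Proof. by rewrite -size_poly_gt0 size_u. Qed.
Let v0 : v != 0. Proof. by rewrite -size_poly_gt0 size_v. Qed.
Let w0 : 'X^2 != 0 :> {poly K}. Proof. by rewrite -size_poly_gt0 size_polyXn. Qed.
Let size_uv : size (u * v) = 5%N.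
Proof.
have -> : size (u * v) = (size u + size v).-1 by apply: size_mul.
by rewrite size_u size_v.
Qed.
Let size_wv : size ('X^2 * v) = 5%N.
Proof.
have -> : size ('X^2 * v) = (size ('X^2 : {poly K}) + size v).-1 by apply: size_mul.
by rewrite size_polyXn size_v.
Qed.
Let size_wu : size ('X^2 * u) = 5%N.
Proof.
have -> : size ('X^2 * u) = (size ('X^2 : {poly K}) + size u).-1 by apply: size_mul.
by rewrite size_polyXn size_u.
Qed.

Definition point_at r : 'rV[K]_3 :=
  row3 (r ^+ 2 * v.[r]) (r ^+ 2 * u.[r]) (u.[r] * v.[r]).

Definition point_infty : 'rV[K]_3 := row3 d c (c * d).

Lemma pullback_normal_quartic : pullback (normal_quartic a c d) = 0.
Proof. exact: pull_normal_quartic. Qed.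

Lemma horner_pullback A r : (pullback A).[r] = A.@[point_at r 0].
Proof.
rewrite /pullback horner_mmap; apply: meval_eq.
apply: forall_ord3; rewrite !row3E.
- by rewrite hornerM hornerXn.
- by rewrite hornerM hornerXn.
- by rewrite hornerM.
Qed.

Lemma pullback_infty n A : A \is n.-homog ->
  (size (pullback A) <= (4 * n).+1)%N /\ (pullback A)`_(4 * n) = A.@[point_infty 0].
Proof.
move=> hA; have [|sA EA] := @mmap_top_coef K 4 n (phi0 a c d 0) A _ hA.
  by apply: forall_ord3; rewrite !row3E -?/u -?/v ?size_wv ?size_wu ?size_uv.
split=> //; rewrite [LHS]EA; apply: meval_eq.
have uvE : uu a c * vv a d = 1 + (a + b)%:P * 'X + (c + d + a * b)%:P * 'X^2 +
    (a * d + b * c)%:P * 'X^3 + (c * d)%:P * 'X^4.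
  by rewrite /uu /vv /unit_quad -/b; ring.
apply: forall_ord3; rewrite !row3E ?uvE ?coefXnM /= /uu /vv /unit_quad
  !(coefD, coefCM, coefXn, coefX, coefC) /=;
  by rewrite ?(mulr0, mulr1, addr0, add0r).
Qed.

Let form_at (p : 'rV[K]_3) : p != 0 ->
  exists2 L : {mpoly K[3]}, L \is 1.-homog & L.@[p 0] != 0.
Proof.
move=> /rV0Pn [i pi]; exists 'X_i; first exact: homogX.
by rewrite mevalXU.
Qed.

Let meval_scaled n B lam (q : 'rV[K]_3) : B \is n.-homog -> lam != 0 ->
  (B.@[(lam *: (q *m M)) 0] != 0) = ((lin_sub M B).@[q 0] != 0).
Proof.
move=> hB lam0; rewrite (meval_homog _ _ hB) mulf_eq0 (negbTE (expf_neq0 _ lam0)).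
by rewrite meval_lin_sub.
Qed.

Let multiplicity (p : 'rV[K]_3) m e G N (V : {fraction {poly K}} -> Prop) :
  G \is e.-homog -> pull G != 0 -> p != 0 ->
  (forall n B, B \is n.-homog -> B.@[p 0] != 0 -> pull B != 0) ->
  subspace (frac_scalar (@polyC K)) (param_ring phi p) ->
  subspace (frac_scalar (@polyC K)) V ->
  (forall x, param_ring phi p x -> V x) ->
  codim (frac_scalar (@polyC K)) (param_ring phi p) V N ->
  (forall L, L \is 1.-homog -> L.@[p 0] != 0 ->
    (forall x, scaled (tofrac (pull G) / tofrac (pull L ^+ e)) V x -> V x) /\
    codim (frac_scalar (@polyC K))
      (scaled (tofrac (pull G) / tofrac (pull L ^+ e)) V) V m) ->
  intersection_mult Q G p m.
Proof.
move=> hG G0 p0 val sR sV RV cRV cV.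
have [L hL Lp] := form_at p0; have L0 := val _ _ hL Lp.
apply: (intersection_mult_param Q_pull Q_kernel val).
rewrite (param_ideal_scaled G0 hG hL Lp L0 val).
have [gV cgV] := cV _ hL Lp.
apply: (codim_scaled_sub sR sV) cRV cgV => //.
  by rewrite mulf_neq0 ?invr_neq0 ?tofrac_eq0 ?expf_neq0.
by move=> x; apply: scaled_param_ring_sub hG hL Lp.
Qed.

Lemma root_conductor r : root s r = [|| root u r, root v r | r == 0].
Proof.
by rewrite /s /conductor_poly 2!rootM orbA; congr (_ || _); rewrite rootE horner_exp hornerX expf_eq0.
Qed.

Lemma point_at_neq0 r : ~~ root s r -> point_at r != 0.
Proof.
rewrite root_conductor !negb_or => /and3P [ur vr _].
apply/negP => /eqP /rowP /(_ i2); rewrite row3E mxE => /eqP.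
by rewrite mulf_eq0; apply/negP; rewrite negb_or; apply/andP.
Qed.

Lemma intersection_mult_smooth e G r lam :
  G \is e.-homog -> pullback (lin_sub M G) != 0 -> ~~ root s r -> lam != 0 ->
  intersection_mult Q G (lam *: (point_at r *m M)) (mup r (pullback (lin_sub M G))).
Proof.
move=> hG; rewrite -pullE => G0 sr lam0; set p := lam *: _.
have p0 : p != 0.
  rewrite scaler_eq0 negb_or lam0; apply: contraNneq (point_at_neq0 sr) => E.
  by rewrite -(mulmxK M_unit (point_at r)) E mul0mx.
have val n B : B \is n.-homog -> (B.@[p 0] != 0) = ~~ root (pull B) r.
  by move=> hB; rewrite (meval_scaled _ hB) // pullE rootE horner_pullback.
have val0 n B : B \is n.-homog -> B.@[p 0] != 0 -> pull B != 0.
  by move=> hB; rewrite (val _ _ hB); apply: contraNneq => ->; rewrite root0.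
have RE : param_ring phi p = loc ('X - r%:P) := param_ring_smooth phi_conductor sr val.
have sV := loc_subspace ('X - r%:P).
apply: (multiplicity (N := 0) (V := loc ('X - r%:P)) hG) => //.
- by rewrite RE.
- by rewrite RE.
- by rewrite RE; apply: codim_refl.
move=> L hL Lp; have L0 := val0 _ _ hL Lp.
have Lr : coprimep (pull L ^+ e) ('X - r%:P).
  by apply: coprimep_expl; rewrite coprimep_XsubC -(val _ _ hL).
have LeN0 : pull L ^+ e != 0 by rewrite expf_neq0.
split; first by move=> x; apply: scaled_loc_sub.
have [h Eh hr] := mup_factor r G0; set m := mup r _ in Eh *.
have h0 : h != 0 by apply: contraNneq hr => ->; rewrite root0.
have X0 : ('X - r%:P) ^+ m != 0 by rewrite expf_neq0 ?polyXsubC_eq0.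
have := codim_loc Lr LeN0 (_ : coprimep h ('X - r%:P)) h0 X0 (dvdpp _).
by rewrite -Eh size_exp_XsubC; apply; rewrite coprimep_XsubC.
Qed.

Lemma intersection_mult_infty e G m lam :
  G \is e.-homog -> pullback (lin_sub M G) != 0 -> lam != 0 ->
  (size (pullback (lin_sub M G)) + m = (4 * e).+1)%N ->
  intersection_mult Q G (lam *: (point_infty *m M)) m.
Proof.
move=> hG; rewrite -pullE => G0 lam0 sG; set p := lam *: _.
have p0 : p != 0.
  rewrite scaler_eq0 negb_or lam0; apply: contraNneq d0 => E.
  have : point_infty *m M *m invmx M = 0 by rewrite E mul0mx.
  by rewrite mulmxK // => /rowP /(_ i0); rewrite row3E mxE => /eqP.
have sz n B : B \is n.-homog -> (size (pull B) <= 4 * n + 1)%N.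
  by move=> hB; rewrite pullE addn1; have [] := pullback_infty (lin_sub_homog M hB).
have val n B : B \is n.-homog -> (B.@[p 0] != 0) = (size (pull B) == 4 * n + 1)%N.
  move=> hB; rewrite (meval_scaled _ hB) // pullE addn1.
  have [sB <-] := pullback_infty (lin_sub_homog M hB).
  rewrite eqn_leq sB /=; apply/idP/idP => [|lt].
    by apply: contraNT; rewrite -leqNgt => /(nth_default 0) ->.
  have sE : size (pullback (lin_sub M B)) = (4 * n).+1 by apply/eqP; rewrite eqn_leq sB.
  by have := lead_coef_eq0 (pullback (lin_sub M B)); rewrite /lead_coef sE /= => ->;
    rewrite -size_poly_gt0 sE.
have val0 n B : B \is n.-homog -> B.@[p 0] != 0 -> pull B != 0.
  by move=> hB; rewrite (val _ _ hB) -size_poly_gt0 => /eqP ->; rewrite addn1.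
have size_s : size s = 7%N.
  have -> : size s = (size (u * v)%R + size ('X^2 : {poly K})).-1.
    by apply: size_mul => //; rewrite mulf_neq0.
  by rewrite size_uv size_polyXn.
have RE : param_ring phi p = @loc_infty K :=
  param_ring_infty phi_conductor size_s sz val.
have sV := loc_infty_subspace K.
have szL (L : {mpoly K[3]}) : L \is 1.-homog -> L.@[p 0] != 0 ->
    size (pull L ^+ e) = (4 * e).+1.
  move=> hL; rewrite (val _ _ hL) => /eqP sL.
  have : (size (pull L ^+ e)).-1 = ((size (pull L)).-1 * e)%N := size_exp _ _.
  have : (0 < size (pull L ^+ e)%R)%N.
    by rewrite size_poly_gt0 expf_neq0 // -size_poly_gt0 sL.
  by rewrite sL; clear; slia.
apply: (multiplicity (N := 0) (V := @loc_infty K) hG) => //.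
- by rewrite RE.
- by rewrite RE.
- by rewrite RE; apply: codim_refl.
move=> L hL Lp; have sL := szL _ hL Lp.
have L0 : pull L ^+ e != 0 by rewrite -size_poly_gt0 sL.
split; last by apply: codim_loc_infty => //; rewrite sL sG.
move=> _ [_ [A [B [B0 sAB ->]]] ->].
exists (pull G * A), (pull L ^+ e * B); rewrite mulf_neq0 //; split=> //; last first.
  by rewrite mulf_div !tofracM.
have e1 : (size (pull G * A)%R <= (size (pull G) + size A).-1)%N := size_polyMleq _ _.
have e2 : size (pull L ^+ e * B)%R = (size (pull L ^+ e)%R + size B).-1.
  exact: size_mul.
by move: e1 e2 sAB sG; rewrite sL -/(pull G); clear; slia.
Qed.

Let multiplicity_double q s' L e G lam (x : 'rV[K]_3) g1 g2 j :
  s = q * s' -> size q = 3%N -> (size s' <= 5)%N -> s' != 0 -> coprimep s' q ->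
  L \is 1.-homog -> pullback L = s' ->
  (forall i, q %| phi0 a c d 0 i - s' * (x 0 i)%:P) -> x != 0 ->
  G \is e.-homog -> lam != 0 ->
  pullback (lin_sub M G) = g1 * g2 -> g1 != 0 -> g2 != 0 -> coprimep g2 q ->
  g1 %| q ^+ j ->
  intersection_mult Q G (lam *: (x *m M)) (size g1).-1.
Proof.
move=> sE sq ss' s'0 cs' hL EL qphi x0 hG lam0 EG g10 g20 cg2 g1q.
set p := lam *: _; have p0 : p != 0.
  rewrite scaler_eq0 negb_or lam0; apply: contraNneq x0 => E.
  by rewrite -(mulmxK M_unit x) E mul0mx.
have md n A : A \is n.-homog -> q %| pull A - ((lin_sub M A).@[x 0])%:P * s' ^+ n.
  by move=> hA; rewrite pullE; apply: mmap_dvd => //; apply: lin_sub_homog.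
have val n B : B \is n.-homog -> (B.@[p 0] != 0) = coprimep (pull B) q.
  move=> hB; rewrite (meval_scaled _ hB) //.
  have /dvdpP [C EC] := md _ _ hB.
  have -> : pull B = C * q + ((lin_sub M B).@[x 0])%:P * s' ^+ n by rewrite -EC subrK.
  rewrite coprimep_sym coprimep_addl_mul coprimep_sym mul_polyC.
  have [->|m0] := eqVneq ((lin_sub M B).@[x 0]) 0.
    by rewrite scale0r coprime0p -size_poly_eq1 sq.
  by rewrite coprimepZl // coprimep_expl.
have val0 n B : B \is n.-homog -> B.@[p 0] != 0 -> pull B != 0.
  move=> hB; rewrite (val _ _ hB); apply: contraTneq => ->.
  by rewrite coprime0p -size_poly_eq1 sq.
have hL' : lin_sub (invmx M) L \is 1.-homog by apply: lin_sub_homog.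
have EL' : pull (lin_sub (invmx M) L) = s' by rewrite pullE lin_subKV.
have RE : param_ring phi p = pinched q.
  apply: (param_ring_pinched phi_conductor sE sq ss' s'0 cs' hL' EL' val) => n A hA.
  by exists ((lin_sub M A).@[x 0]); apply: md.
have sV := loc_subspace q.
have G0 : pull G != 0 by rewrite pullE EG mulf_neq0.
apply: (multiplicity (N := 1) (V := loc q) hG G0 p0 val0) => //.
- by rewrite RE; apply: pinched_subspace.
- by rewrite RE; apply: pinched_loc.
- by rewrite RE; apply: codim_pinched.
move=> L1 hL1 Lp; have L0 := val0 _ _ hL1 Lp.
have Lq : coprimep (pull L1 ^+ e) q by apply: coprimep_expl; rewrite -(val _ _ hL1).
have LeN0 : pull L1 ^+ e != 0 by rewrite expf_neq0.
split; first by move=> y; apply: scaled_loc_sub.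
by rewrite pullE EG; apply: codim_loc Lq LeN0 cg2 g20 g10 g1q.
Qed.

Let root_dvd (f : {poly K}) q : q %| f -> forall r, root q r -> root f r.
Proof. by move=> /dvdpP [h ->] r qr; rewrite rootM qr orbT. Qed.

Lemma mup_factor2 (g : {poly K}) r t : g != 0 -> r != t ->
  exists h, [/\ g = ('X - r%:P) ^+ mup r g * ('X - t%:P) ^+ mup t g * h,
    ~~ root h r & ~~ root h t].
Proof.
move=> g0 rt; have [h1 E1 h1r] := mup_factor r g0.
have h10 : h1 != 0 by apply: contraNneq g0 => h10; rewrite E1 h10 mulr0.
have [h2 E2 h2t] := mup_factor t h10.
have Et : mup t g = mup t h1.
  rewrite {1}E1 mupMr // rootE horner_exp hornerXsubC expf_neq0 //.
  by rewrite subr_eq0 eq_sym.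
exists h2; rewrite Et; split=> //; first by rewrite -mulrA -E2 -E1.
by apply: contraNN h1r => h2r; rewrite E2 rootM h2r orbT.
Qed.

Let node_mult q s' L e G lam (x : 'rV[K]_3) c' r t :
  q = c'%:P * (('X - r%:P) * ('X - t%:P)) -> c' != 0 -> r != t ->
  s = q * s' -> (size s' <= 5)%N -> s' != 0 -> coprimep s' q ->
  L \is 1.-homog -> pullback L = s' ->
  (forall i, q %| phi0 a c d 0 i - s' * (x 0 i)%:P) -> x != 0 ->
  G \is e.-homog -> lam != 0 -> pullback (lin_sub M G) != 0 ->
  intersection_mult Q G (lam *: (x *m M))
    (mup r (pullback (lin_sub M G)) + mup t (pullback (lin_sub M G))).
Proof.
move=> qE c'0 rt sE ss' s'0 cs' hL EL qphi x0 hG lam0 g0.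
have sq : size q = 3%N.
  by rewrite qE mul_polyC size_scale // size_mul ?polyXsubC_eq0 // !size_XsubC.
have [h [Eh hr ht]] := mup_factor2 g0 rt.
set g := pullback _ in g0 Eh *; set m1 := mup r g in Eh *; set m2 := mup t g in Eh *.
have X0 x' n : ('X - x'%:P) ^+ n != 0 :> {poly K} by rewrite expf_neq0 ?polyXsubC_eq0.
have h0 : h != 0 by apply: contraNneq hr => ->; rewrite root0.
have hq : coprimep h q.
  rewrite qE mul_polyC coprimep_sym coprimepZl // coprimep_sym coprimepMr.
  by rewrite !coprimep_XsubC hr.
have gq : ('X - r%:P) ^+ m1 * ('X - t%:P) ^+ m2 %| q ^+ (m1 + m2).
  have rq : 'X - r%:P %| q by rewrite qE dvdp_mull // dvdp_mulr.
  have tq : 'X - t%:P %| q by rewrite qE dvdp_mull // dvdp_mull.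
  by rewrite exprD dvdp_mul // dvdp_exp2r.
have := multiplicity_double sE sq ss' s'0 cs' hL EL qphi x0 hG lam0 Eh
  (mulf_neq0 (X0 r m1) (X0 t m2)) h0 hq gq.
have -> : size (('X - r%:P) ^+ m1 * ('X - t%:P) ^+ m2) = (m1 + m2).+1.
  by rewrite size_mul ?X0 // !size_exp_XsubC addnS.
by [].
Qed.

Let coprime_wu : coprimep ('X^2) u. Proof. exact: coprime_unit_quad_Xn. Qed.
Let coprime_wv : coprimep ('X^2) v. Proof. exact: coprime_unit_quad_Xn. Qed.
Let coprime_u_v : coprimep u v. Proof. exact: coprime_uv. Qed.

Let row3_neq0 (x : 'rV[K]_3) i : x 0 i != 0 -> x != 0.
Proof. by apply: contraNneq => ->; rewrite mxE. Qed.

Let pullbackX i : pullback 'X_i = phi0 a c d 0 i.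
Proof. by rewrite /pullback mmapX mmap1U. Qed.

Lemma intersection_mult_node1 e G lam r t :
  u = c%:P * (('X - r%:P) * ('X - t%:P)) -> r != t ->
  G \is e.-homog -> lam != 0 -> pullback (lin_sub M G) != 0 ->
  intersection_mult Q G (lam *: (row3 1 0 0 *m M))
    (mup r (pullback (lin_sub M G)) + mup t (pullback (lin_sub M G))).
Proof.
move=> uE rt hG lam0 g0.
apply: (node_mult (s' := 'X^2 * v) (L := 'X_i0) uE c0 rt) (hG) lam0 g0.
- by rewrite /s /conductor_poly -/u -/v; ring.
- by rewrite size_wv.
- by rewrite mulf_neq0.
- by rewrite coprimepMl coprime_wu coprimep_sym.
- exact: homogX.
- by rewrite pullbackX row3E.
- apply: forall_ord3; rewrite !row3E ?mulr1 ?mulr0 ?subr0 ?subrr ?dvdp0 //.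
    exact: dvdp_mulIr.
  exact: dvdp_mulIl.
- by apply: (row3_neq0 (i := i0)); rewrite row3E oner_neq0.
Qed.

Lemma intersection_mult_node2 e G lam r t :
  v = d%:P * (('X - r%:P) * ('X - t%:P)) -> r != t ->
  G \is e.-homog -> lam != 0 -> pullback (lin_sub M G) != 0 ->
  intersection_mult Q G (lam *: (row3 0 1 0 *m M))
    (mup r (pullback (lin_sub M G)) + mup t (pullback (lin_sub M G))).
Proof.
move=> vE rt hG lam0 g0.
apply: (node_mult (s' := 'X^2 * u) (L := 'X_i1) vE d0 rt) (hG) lam0 g0.
- by rewrite /s /conductor_poly -/u -/v; ring.
- by rewrite size_wu.
- by rewrite mulf_neq0.
- by rewrite coprimepMl coprime_wv coprime_u_v.
- exact: homogX.
- by rewrite pullbackX row3E.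
- apply: forall_ord3; rewrite !row3E ?mulr1 ?mulr0 ?subr0 ?subrr ?dvdp0 //.
    exact: dvdp_mulIr.
  exact: dvdp_mulIr.
- by apply: (row3_neq0 (i := i1)); rewrite row3E oner_neq0.
Qed.

Lemma intersection_mult_cusp e G lam :
  G \is e.-homog -> lam != 0 -> pullback (lin_sub M G) != 0 ->
  intersection_mult Q G (lam *: (row3 0 0 1 *m M)) (mup 0 (pullback (lin_sub M G))).
Proof.
move=> hG lam0 g0.
have [h Eh hr] := mup_factor 0 g0; rewrite subr0 in Eh.
set g := pullback _ in g0 Eh *; set m := mup 0 g in Eh *.
have h0 : h != 0 by apply: contraNneq hr => ->; rewrite root0.
have Xm0 : 'X^m != 0 :> {poly K} by rewrite -size_poly_gt0 size_polyXn.
have hX : coprimep h 'X^2 by apply: coprimep_expr; rewrite coprimepX.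
have gX : 'X^m %| ('X^2 : {poly K}) ^+ m by rewrite -exprM dvdp_exp2l // mul2n -addnn leq_addr.
have -> : m = (size ('X^m : {poly K})).-1 by rewrite size_polyXn.
apply: (@multiplicity_double 'X^2 (u * v) 'X_i2 e G lam _ 'X^m h m) => //.
- by rewrite /s /conductor_poly mulrC.
- by rewrite size_polyXn.
- by rewrite size_uv.
- by rewrite mulf_neq0.
- by rewrite coprimepMl coprimep_sym coprime_wu coprimep_sym coprime_wv.
- exact: homogX.
- by rewrite pullbackX row3E.
- apply: forall_ord3; rewrite !row3E ?mulr1 ?mulr0 ?subr0 ?subrr ?dvdp0 //.
    exact: dvdp_mulIl.
  exact: dvdp_mulIl.
- by apply: (row3_neq0 (i := i2)); rewrite row3E oner_neq0.
Qed.

End MultiplicitiesOnTheQuartic.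

Lemma poly_sqrt_const (K : closedFieldType) (x : K) : exists y, y ^+ 2 = x.
Proof.
have [|y] := closed_rootP ('X^2 - x%:P : {poly K}) _.
  by rewrite size_XnsubC.
by rewrite rootE !hornerE subr_eq0 => /eqP; exists y.
Qed.

Lemma even_mup_square (K : closedFieldType) (g : {poly K}) :
  g != 0 -> (forall r, ~~ odd (mup r g)) -> exists h, g = h ^+ 2.
Proof.
have [n] := ubnP (size g); elim: n g => // n IHn g; rewrite ltnS => sg g0 ev.
have [/eqP sg1|sgN1] := boolP (size g == 1%N).
  have [x x2] := poly_sqrt_const g`_0.
  by exists x%:P; rewrite -polyC_exp x2; apply: size1_polyC; rewrite sg1.
have [r gr] := closed_rootP g sgN1.
have m2 : (2 <= mup r g)%N.
  have : (0 < mup r g)%N by rewrite -XsubC_dvd // dvdp_XsubCl.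
  by move: (ev r); case: (mup r g) => [|[|m]].
move: m2; rewrite mup_geq // => /dvdpP [h Eh].
have h0 : h != 0 by apply: contraNneq g0 => h0; rewrite Eh h0 mul0r.
have X0 : 'X - r%:P != 0 :> {poly K} by rewrite polyXsubC_eq0.
have [||k Ek] := IHn h _ h0.
- apply: leq_trans sg; rewrite Eh size_mul ?expf_neq0 // size_exp_XsubC.
  by rewrite addn3 /=; clear; slia.
- move=> t; move: (ev t).
  by rewrite Eh mupM ?expf_neq0 // oddD mup_XsubCX; case: (r == t); rewrite addbF.
by exists (k * ('X - r%:P)); rewrite Eh Ek exprMn.
Qed.

(** * Conics *)

Section QuadraticForms.

Variable K : closedFieldType.
Implicit Types (A B C D E F : K).

Definition quad A B C D E F : {mpoly K[3]} :=
  A *: 'X_i0 ^+ 2 + B *: 'X_i1 ^+ 2 + C *: 'X_i2 ^+ 2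
  + D *: ('X_i1 * 'X_i2) + E *: ('X_i0 * 'X_i2) + F *: ('X_i0 * 'X_i1).

(** Four times the determinant of the symmetric matrix of [quad]. *)
Definition disc_quad A B C D E F : K :=
  4 * A * B * C + D * E * F - A * D ^+ 2 - B * E ^+ 2 - C * F ^+ 2.

Lemma quad_homog A B C D E F : quad A B C D E F \is 2.-homog.
Proof.
have hom2 i j : 'X_i * 'X_j \is [in K[3], 2.-homog].
  by apply: (@dhomogM _ _ _ 1 _ 1); apply: homogX.
by rewrite /quad; do !apply: rpredD; apply: rpredZ; rewrite ?expr2; apply: hom2.
Qed.

Lemma homog2_quad H : H \is 2.-homog ->
  exists A B C D E F, H = quad A B C D E F.
Proof.
move: H; apply: homog_ind.
- by exists 0, 0, 0, 0, 0, 0; rewrite /quad !scale0r !addr0.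
- move=> _ _ [A [B [C [D [E [F ->]]]]]] [A' [B' [C' [D' [E' [F' ->]]]]]].
  exists (A + A'), (B + B'), (C + C'), (D + D'), (E + E'), (F + F').
  by rewrite /quad !scalerDl -!mul_mpolyC; ring.
- move=> l _ [A [B [C [D [E [F ->]]]]]].
  exists (l * A), (l * B), (l * C), (l * D), (l * E), (l * F).
  by rewrite /quad !scalerDr !scalerA.
- move=> [|[|[|i]]] [|[|[|j]]] [|[|[|l]]] // _.
  + by exists 0, 0, 1, 0, 0, 0; rewrite /quad -!mul_mpolyC; ring.
  + by exists 0, 0, 0, 1, 0, 0; rewrite /quad -!mul_mpolyC; ring.
  + by exists 0, 1, 0, 0, 0, 0; rewrite /quad -!mul_mpolyC; ring.
  + by exists 0, 0, 0, 0, 1, 0; rewrite /quad -!mul_mpolyC; ring.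
  + by exists 0, 0, 0, 0, 0, 1; rewrite /quad -!mul_mpolyC; ring.
  + by exists 1, 0, 0, 0, 0, 0; rewrite /quad -!mul_mpolyC; ring.
Qed.

Lemma meval_quad A B C D E F (p : 'rV[K]_3) :
  (quad A B C D E F).@[p 0] =
  A * p 0 i0 ^+ 2 + B * p 0 i1 ^+ 2 + C * p 0 i2 ^+ 2
  + D * (p 0 i1 * p 0 i2) + E * (p 0 i0 * p 0 i2) + F * (p 0 i0 * p 0 i1).
Proof. by rewrite /quad !mevalD !mevalZ !rmorphXn /= !mevalM !mevalXU. Qed.

Lemma mderivXU i j : ('X_i : {mpoly K[3]})^`M(j) = (i == j)%:R.
Proof.
rewrite mderivX mnm1E; case: eqP => [->|_]; last by rewrite scale0r.
rewrite scale1r (_ : (_ - _)%MM = 0%MM) ?mpolyX0 //.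
by rewrite -[X in (X - _)%MM]add0m addmK.
Qed.

Lemma grad_quad A B C D E F (p : 'rV[K]_3) :
  grad (quad A B C D E F) p =
  row3 (2 * A * p 0 i0 + F * p 0 i1 + E * p 0 i2)
       (F * p 0 i0 + 2 * B * p 0 i1 + D * p 0 i2)
       (E * p 0 i0 + D * p 0 i1 + 2 * C * p 0 i2).
Proof.
by apply/rowP; apply: forall_ord3; rewrite row3E mxE /quad !expr2 !mderivD !mderivZ
  !mderivM !mderivXU /= !mevalD !mevalZ !mevalD !mevalM !mevalXU ?meval0 ?meval1; ring.
Qed.

Definition quad_mx A B C D E F : 'M[K]_3 :=
  \matrix_(i, j) nth 0 (nth [::] [:: [:: 2 * A; F; E]; [:: F; 2 * B; D]; [:: E; D; 2 * C]] i) j.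

Lemma grad_quad_mx A B C D E F (p : 'rV[K]_3) :
  grad (quad A B C D E F) p = p *m quad_mx A B C D E F.
Proof.
rewrite grad_quad; apply/rowP; apply: forall_ord3; rewrite row3E mxE big_ord3 !mxE /=; ring.
Qed.

Lemma det_quad_mx A B C D E F :
  \det (quad_mx A B C D E F) = 2 * disc_quad A B C D E F.
Proof.
rewrite (expand_det_row _ i0) big_ord3 /cofactor !(expand_det_row _ ord0).
rewrite !big_ord_recl !big_ord0 /cofactor !det_mx11 !mxE /= /disc_quad.
by rewrite /bump /=; ring.
Qed.

Hypothesis two0 : 2 != 0 :> K.

Lemma quad_euler A B C D E F (p : 'rV[K]_3) :
  grad (quad A B C D E F) p 0 i0 * p 0 i0 + grad (quad A B C D E F) p 0 i1 * p 0 i1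
  + grad (quad A B C D E F) p 0 i2 * p 0 i2 = 2 * (quad A B C D E F).@[p 0].
Proof. rewrite grad_quad !row3E meval_quad; ring. Qed.

Lemma smooth_quad A B C D E F :
  (forall p : 'rV[K]_3, p != 0 -> (quad A B C D E F).@[p 0] = 0 ->
     grad (quad A B C D E F) p != 0) <-> disc_quad A B C D E F != 0.
Proof.
split=> [sm|d0 p p0 _].
  apply/negP => /eqP d0.
  have /eqP/det0P [p p0 pS] : \det (quad_mx A B C D E F) = 0.
    by rewrite det_quad_mx d0 mulr0.
  have gp : grad (quad A B C D E F) p = 0 by rewrite grad_quad_mx.
  suff /(sm p p0) : (quad A B C D E F).@[p 0] = 0 by rewrite gp eqxx.
  by apply: (mulfI two0); rewrite -quad_euler gp !mxE; ring.
apply/negP => /eqP gp; have : \det (quad_mx A B C D E F) != 0.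
  by rewrite det_quad_mx mulf_neq0.
by apply/negP; rewrite negbK; apply/det0P; exists p; rewrite -?grad_quad_mx.
Qed.

End QuadraticForms.

Section SquaresUpToNodes.

Variables (K : closedFieldType) (u v g : {poly K}) (c d r1 r2 t1 t2 : K).
Hypotheses (c0 : c != 0) (d0 : d != 0) (r12 : r1 != r2) (t12 : t1 != t2).
Hypothesis uE : u = c%:P * (('X - r1%:P) * ('X - r2%:P)).
Hypothesis vE : v = d%:P * (('X - t1%:P) * ('X - t2%:P)).
Hypotheses (cuv : coprimep u v) (g0 : g != 0).

(* The multiplicity is kept abstract, for the sake of unification. *)
Variable mu : K -> {poly K} -> nat.
Hypothesis mu_def : forall x q, mu x q = mup x q.

Let muM x (p q : {poly K}) : p != 0 -> q != 0 -> mu x (p * q) = (mu x p + mu x q)%N.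
Proof. by rewrite !mu_def; apply: mupM. Qed.

Let mu_Nroot x (q : {poly K}) : ~~ root q x -> mu x q = 0%N.
Proof. by rewrite mu_def; apply: mupNroot. Qed.

Let mu_gt0 x (q : {poly K}) : q != 0 -> ('X - x%:P %| q) = (0 < mu x q)%N.
Proof. by rewrite mu_def; apply: XsubC_dvd. Qed.

Let mu_even_square (f : {poly K}) : f != 0 -> (forall x, ~~ odd (mu x f)) ->
  exists h, f = h ^+ 2.
Proof.
by move=> f0 ev; apply: even_mup_square => // x; rewrite -mu_def.
Qed.

Let mu_quad (q : {poly K}) e r t x : e != 0 ->
  q = e%:P * (('X - r%:P) * ('X - t%:P)) -> mu x q = ((r == x) + (t == x))%N.
Proof.
move=> e0 ->; rewrite mu_def.
rewrite mupMr ?rootC // mupM ?polyXsubC_eq0 // -['X - r%:P]expr1 -['X - t%:P]expr1.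
by rewrite !mup_XsubCX; case: (r == x); case: (t == x).
Qed.

Let muu x : mu x u = ((r1 == x) + (r2 == x))%N. Proof. exact: mu_quad c0 uE. Qed.
Let muv x : mu x v = ((t1 == x) + (t2 == x))%N. Proof. exact: mu_quad d0 vE. Qed.

Let quad_neq0 (q : {poly K}) e r t : e != 0 ->
  q = e%:P * (('X - r%:P) * ('X - t%:P)) -> q != 0.
Proof. by move=> e0 ->; rewrite !mulf_neq0 ?polyC_eq0 ?polyXsubC_eq0. Qed.

Let u0 : u != 0. Proof. exact: quad_neq0 c0 uE. Qed.
Let v0 : v != 0. Proof. exact: quad_neq0 d0 vE. Qed.

Let root_quad (q : {poly K}) e r t x : e != 0 ->
  q = e%:P * (('X - r%:P) * ('X - t%:P)) -> root q x = (x == r) || (x == t).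
Proof. by move=> e0 ->; rewrite !rootM !root_XsubC rootC (negbTE e0). Qed.

Let rootu x : root u x = (x == r1) || (x == r2). Proof. exact: root_quad c0 uE. Qed.
Let rootv x : root v x = (x == t1) || (x == t2). Proof. exact: root_quad d0 vE. Qed.

Let uv r : root u r -> ~~ root v r.
Proof. by move: cuv => /Pdiv.ClosedField.coprimepP /(_ r) H /H. Qed.

Let mu_uv (e1 e2 : bool) x : odd (mu x (u ^+ e1 * v ^+ e2)) =
  (e1 && odd (mu x u)) (+) (e2 && odd (mu x v)).
Proof.
have muX q (e' : bool) : mu x (q ^+ e') = (e' * mu x q)%N.
  by case: e'; rewrite ?mul1n // expr0 mu_Nroot // rootC oner_neq0.
by rewrite muM ?expf_neq0 // !muX oddD !oddM !oddb.
Qed.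

Let dvd_odd (q : {poly K}) e r t : e != 0 -> r != t ->
  q = e%:P * (('X - r%:P) * ('X - t%:P)) ->
  ~~ odd (mu r g + mu t g) -> q ^+ odd (mu r g) %| g.
Proof.
move=> e0 rt -> ev; case o1 : (odd (mu r g)); last exact: dvd1p.
have o2 : odd (mu t g) by move: ev; rewrite oddD o1 negbK.
rewrite expr1 mul_polyC dvdpZl // Gauss_dvdp; last first.
  by rewrite coprimep_XsubC root_XsubC eq_sym.
by rewrite (mu_gt0 r g0) (mu_gt0 t g0) !odd_gt0.
Qed.

(** Even contact outside of the nodes, and even total contact at each node,
    forces a polynomial to be a square, up to the equations of the nodes. *)
Lemma square_of_even :
  (forall x, ~~ root u x -> ~~ root v x -> ~~ odd (mu x g)) ->
  ~~ odd (mu r1 g + mu r2 g) -> ~~ odd (mu t1 g + mu t2 g) ->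
  exists (e1 e2 : bool) h, g = u ^+ e1 * v ^+ e2 * h ^+ 2.
Proof.
move=> evr evu evv.
have ug := dvd_odd c0 r12 uE evu; have vg := dvd_odd d0 t12 vE evv.
move: ug vg; set e1 := odd (mu r1 g); set e2 := odd (mu t1 g) => ug vg.
exists e1, e2.
have : u ^+ e1 * v ^+ e2 %| g.
  rewrite Gauss_dvdp ?ug ?vg //; apply: coprimep_expl; exact: coprimep_expr.
case/dvdpP => f Ef.
have ue0 : u ^+ e1 * v ^+ e2 != 0 by rewrite mulf_neq0 ?expf_neq0.
have f0 : f != 0 by apply: contraNneq g0 => f0; rewrite Ef f0 mul0r.
have [x|h Eh] := mu_even_square f0; last by exists h; rewrite Ef Eh mulrC.
suff odd_g : odd (mu x g) = (e1 && odd (mu x u)) (+) (e2 && odd (mu x v)).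
  move: odd_g; rewrite {1}Ef muM // oddD -mu_uv.
  by rewrite -[X in _ = X]addFb => /addIb ->.
have [ux|uxN] := boolP (root u x).
  rewrite (mu_Nroot (uv ux)) andbF addbF muu.
  move: ux; rewrite rootu => /orP [] /eqP ->; rewrite eqxx.
    by rewrite eq_sym (negbTE r12) andbT.
  rewrite (negbTE r12) andbT /e1.
  by move: evu; rewrite oddD negb_add => /eqP ->.
rewrite (mu_Nroot uxN) andbF addFb.
have [vx|vxN] := boolP (root v x).
  rewrite muv.
  move: vx; rewrite rootv => /orP [] /eqP ->; rewrite eqxx.
    by rewrite eq_sym (negbTE t12) andbT.
  rewrite (negbTE t12) andbT /e2.
  by move: evv; rewrite oddD negb_add => /eqP ->.
by rewrite (mu_Nroot vxN) andbF; apply/negbTE/evr.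
Qed.

Lemma even_of_square (e1 e2 : bool) h : g = u ^+ e1 * v ^+ e2 * h ^+ 2 ->
  [/\ forall x, ~~ root u x -> ~~ root v x -> ~~ odd (mu x g),
      ~~ odd (mu r1 g + mu r2 g), ~~ odd (mu t1 g + mu t2 g) & odd (size g)].
Proof.
move=> Eg; have h0 : h != 0.
  by apply: contraNneq g0 => h0; rewrite Eg h0 expr0n /= mulr0.
have ue0 : u ^+ e1 * v ^+ e2 != 0 by rewrite mulf_neq0 ?expf_neq0.
have mu_g x : odd (mu x g) = (e1 && odd (mu x u)) (+) (e2 && odd (mu x v)).
  rewrite Eg muM ?expf_neq0 //.
  by rewrite oddD mu_uv expr2 muM // oddD addbb addbF.
have ur1 : root u r1 by rewrite rootu eqxx.
have ur2 : root u r2 by rewrite rootu eqxx orbT.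
have vt1 : root v t1 by rewrite rootv eqxx.
have vt2 : root v t2 by rewrite rootv eqxx orbT.
split.
- by move=> x ux vx; rewrite mu_g (mu_Nroot ux) (mu_Nroot vx) !andbF.
- rewrite oddD !mu_g !muu (mu_Nroot (uv ur1)) (mu_Nroot (uv ur2)) !eqxx.
  by rewrite [r2 == r1]eq_sym (negbTE r12) /= !andbF !addbF !andbT addbb.
- have ut1 : ~~ root u t1 by apply/negP => /uv; rewrite vt1.
  have ut2 : ~~ root u t2 by apply/negP => /uv; rewrite vt2.
  rewrite oddD !mu_g !muv (mu_Nroot ut1) (mu_Nroot ut2) !eqxx.
  by rewrite [t2 == t1]eq_sym (negbTE t12) /= !andbF !addFb !andbT addbb.
- have sX (f : {poly K}) n : f != 0 -> size (f ^+ n) = ((size f).-1 * n).+1.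
    by move=> f0; rewrite -size_exp prednK // size_poly_gt0 expf_neq0.
  have s3 (q : {poly K}) e r t : e != 0 ->
      q = e%:P * (('X - r%:P) * ('X - t%:P)) -> size q = 3%N.
    by move=> e0 ->; rewrite mul_polyC size_scale // size_mul ?polyXsubC_eq0 // !size_XsubC.
  rewrite Eg size_mul ?expf_neq0 // size_mul ?expf_neq0 // !sX //.
  rewrite (s3 _ _ _ _ c0 uE) (s3 _ _ _ _ d0 vE) /= !addnS !addSn /=.
  by rewrite !oddD !oddM /= andbF !addbF !addbb.
Qed.

End SquaresUpToNodes.

Section ContactConics.

Variables (K : closedFieldType) (a c d : K).

Let b := a - 1.
Let k := c - d.
Let m := a * d - b * c.
Let u := uu a c.
Let v := vv a d.
Let s := conductor_poly a c d.

Hypotheses (two0 : 2 != 0 :> K).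
Hypotheses (c0 : c != 0) (d0 : d != 0) (R0 : res_uv a c d != 0).
Hypotheses (Du0 : a ^+ 2 - 4 * c != 0) (Dv0 : b ^+ 2 - 4 * d != 0).

Lemma meval_normal_quartic (p : 'rV[K]_3) :
  let x := p 0 i0 in let y := p 0 i1 in let z := p 0 i2 in
  let T := y * z - x * z - k * (x * y) in
  (normal_quartic a c d).@[p 0] =
  T ^+ 2 - x * y * (y * z - a * T - c * (x * y)).
Proof.
rewrite /= /normal_quartic.
by rewrite !(mevalB, mevalM, mevalZ, mevalXU, rmorphXn) /= -/k; ring.
Qed.

Lemma normal_quartic_points (p : 'rV[K]_3) : p != 0 ->
  (normal_quartic a c d).@[p 0] = 0 ->
  exists2 lam, lam != 0 &
    [\/ p = lam *: row3 1 0 0 \/ p = lam *: row3 0 1 0, p = lam *: row3 0 0 1,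
        p = lam *: point_infty c d
      | exists2 r, ~~ root s r & p = lam *: point_at a c d r].
Proof.
move=> p0; rewrite meval_normal_quartic /=.
set x := p 0 i0; set y := p 0 i1; set z := p 0 i2; set T := _ - _ - _ => E.
have pE : p = row3 x y z by apply: row3_eta.
have R3 l x' y' z' : l *: row3 x' y' z' = row3 (l * x') (l * y') (l * z') :> 'rV[K]_3.
  by apply/rowP; apply: forall_ord3; rewrite !mxE.
have [x0|xN0] := eqVneq x 0.
  move: E; rewrite /T x0 !(mul0r, mulr0, subr0) => /eqP; rewrite expf_eq0 /= mulf_eq0.
  case/orP => /eqP y0; move: p0; rewrite pE x0 y0.
    move=> p0; exists z.
      by apply: contraNneq p0 => ->; apply/eqP/rowP; apply: forall_ord3; rewrite !mxE.
    by constructor 2; rewrite R3 !mulr0 mulr1.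
  move=> p0; exists y.
    by apply: contraNneq p0 => ->; apply/eqP/rowP; apply: forall_ord3; rewrite !mxE.
  by constructor 1; right; rewrite R3 !mulr0 mulr1.
have [y0|yN0] := eqVneq y 0.
  move: E; rewrite /T y0 !(mul0r, mulr0, subr0, sub0r) => /eqP.
  rewrite expf_eq0 /= oppr_eq0 mulf_eq0 (negbTE xN0) /= => /eqP z0.
  by exists x => //; constructor 1; left; rewrite pE y0 z0 R3 !mulr0 mulr1.
have [z0|zN0] := eqVneq z 0.
  have := E; rewrite (_ : _ - _ = res_uv a c d * (x * y) ^+ 2); last first.
    by rewrite /T z0 /res_uv -/k; ring.
  move/eqP; rewrite mulf_eq0 (negbTE R0) expf_eq0 /= mulf_eq0.
  by rewrite (negbTE xN0) (negbTE yN0).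
have [T0|TN0] := eqVneq T 0.
  have yz : y * z = c * (x * y).
    move: E; rewrite T0 expr0n /= mulr0 subr0 sub0r => /eqP.
    by rewrite oppr_eq0 !mulf_eq0 (negbTE xN0) (negbTE yN0) /= subr_eq0 => /eqP.
  have zE : z = c * x by apply: (mulIf yN0); rewrite mulrC yz; ring.
  have yE : x * c = y * d.
    apply: (mulIf xN0); apply/eqP; rewrite -subr_eq0 -oppr_eq0 -T0 /T zE /k; apply/eqP; ring.
  exists (x / d); first by rewrite mulf_neq0 ?invr_neq0.
  constructor 3; rewrite pE /point_infty R3; congr row3.
  - by rewrite divfK.
  - by rewrite mulrAC yE mulfK.
  - by rewrite zE mulrA mulrAC divfK // mulrC.
pose r := x * y / T.
have xy : x * y = r * T by rewrite /r divfK.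
have rN0 : r != 0 by rewrite mulf_neq0 ?invr_neq0 ?mulf_neq0.
have yz : y * z = T / r * u.[r].
  rewrite unit_quadE; apply: (mulfI (mulf_neq0 rN0 TN0)).
  have -> : r * T * (T / r * (1 + a * r + c * r ^+ 2)) =
            T * T * (1 + a * r + c * r ^+ 2) by field; rewrite rN0.
  apply/eqP; rewrite -subr_eq0 -oppr_eq0 -E xy; apply/eqP; ring.
have xz : x * z = T / r * v.[r].
  have -> : x * z = y * z - T - k * (x * y) by rewrite /T; ring.
  by rewrite yz xy !unit_quadE -/b /b /k; field; rewrite rN0.
have ur : u.[r] != 0.
  by apply: contraNneq (mulf_neq0 yN0 zN0) => ur; rewrite yz ur mulr0.
have vr : v.[r] != 0.
  by apply: contraNneq (mulf_neq0 xN0 zN0) => vr; rewrite xz vr mulr0.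
have sr : ~~ root s r.
  by rewrite root_conductor !negb_or !rootE ur vr rN0.
pose l := z / (u.[r] * v.[r]).
have l0 : l != 0 by rewrite mulf_neq0 ?invr_neq0 ?mulf_neq0.
exists l => //; constructor 4; exists r => //.
rewrite pE /point_at -/u -/v R3; congr row3.
- apply: (mulIf (mulf_neq0 yN0 ur)).
  have -> : l * (r ^+ 2 * v.[r]) * (y * u.[r]) = r ^+ 2 * (y * z).
    by rewrite /l; field; rewrite vr ur.
  by rewrite yz mulrA xy; field.
- apply: (mulIf (mulf_neq0 xN0 vr)).
  have -> : l * (r ^+ 2 * u.[r]) * (x * v.[r]) = r ^+ 2 * (x * z).
    by rewrite /l; field; rewrite vr ur.
  by rewrite xz mulrA [y * x]mulrC xy; field.
- by rewrite /l divfK // mulf_neq0.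
Qed.

Variables (Q : {mpoly K[3]}) (M : 'M[K]_3) (kap : K).
Hypotheses (M_unit : M \in unitmx) (kap0 : kap != 0).
Hypothesis Q_normal : lin_sub M Q = kap *: normal_quartic a c d.

Lemma on_quartic q : q != 0 -> on_curve Q (q *m M) <->
  (normal_quartic a c d).@[q 0] = 0.
Proof.
move=> q0; rewrite /on_curve -meval_lin_sub Q_normal mevalZ; split.
  by case=> _ /eqP; rewrite mulf_eq0 (negbTE kap0) => /eqP.
move=> ->; rewrite mulr0; split=> //; apply: contraNneq q0 => E.
by rewrite -(mulmxK M_unit q) E mul0mx.
Qed.

Lemma on_curve_lin_sub F (q : 'rV[K]_3) :
  on_curve (lin_sub M F) q <-> on_curve F (q *m M).
Proof.
rewrite /on_curve meval_lin_sub; split=> -[q0 E]; split=> //.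
  by apply: contraNneq q0 => E'; rewrite -(mulmxK M_unit q) E' mul0mx.
by apply: contraNneq q0 => ->; rewrite mul0mx.
Qed.

Lemma quartic_at r : (normal_quartic a c d).@[point_at a c d r 0] = 0.
Proof.
by rewrite -horner_pullback pullback_normal_quartic horner0.
Qed.

Lemma quartic_infty : (normal_quartic a c d).@[point_infty c d 0] = 0.
Proof. by rewrite meval_normal_quartic !row3E /= /k; ring. Qed.

Lemma quartic_e0 : (normal_quartic a c d).@[row3 1 0 0 0] = 0.
Proof. by rewrite meval_normal_quartic !row3E /=; ring. Qed.

Lemma quartic_e1 : (normal_quartic a c d).@[row3 0 1 0 0] = 0.
Proof. by rewrite meval_normal_quartic !row3E /=; ring. Qed.

Lemma quartic_e2 : (normal_quartic a c d).@[row3 0 0 1 0] = 0.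
Proof. by rewrite meval_normal_quartic !row3E /=; ring. Qed.

Lemma row3_e_neq0 : [/\ row3 1 0 0 != 0 :> 'rV[K]_3, row3 0 1 0 != 0 :> 'rV[K]_3
  & row3 0 0 1 != 0 :> 'rV[K]_3].
Proof.
by split; apply/negP => /eqP /rowP;
  [move/(_ i0)|move/(_ i1)|move/(_ i2)]; rewrite row3E mxE => /eqP; rewrite oner_eq0.
Qed.

Lemma point_infty_neq0 : point_infty c d != 0.
Proof.
by apply: contraNneq d0 => /rowP /(_ i0); rewrite row3E mxE => /eqP.
Qed.

Let even_contact G : Prop := forall p, on_curve Q p -> on_curve G p ->
  exists2 n, intersection_mult Q G p n & ~~ odd n.

Let even_at G (q : 'rV[K]_3) n e : G \is e.-homog -> even_contact G -> q != 0 ->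
  (normal_quartic a c d).@[q 0] = 0 ->
  intersection_mult Q G (1 *: (q *m M)) n ->
  ((lin_sub M G).@[q 0] != 0 -> n = 0%N) -> ~~ odd n.
Proof.
move=> hG ev q0 Qq In n0.
have [Gq|/n0 -> //] := eqVneq ((lin_sub M G).@[q 0]) 0.
have /on_curve_lin_sub Gp : on_curve (lin_sub M G) q by [].
have [n' In' ev'] := ev _ ((on_quartic q0).2 Qq) Gp.
by rewrite scale1r in In; rewrite (intersection_mult_uniq In In').
Qed.

Let not_double_root r : ~~ root s r ->
  [/\ ~~ root u r, ~~ root v r & r != 0].
Proof. by rewrite root_conductor !negb_or => /and3P []. Qed.

Lemma even_contactP e G : G \is e.-homog ->
  pullback a c d (lin_sub M G) != 0 ->
  even_contact G <->
  exists (e1 e2 : bool) (h : {poly K}), pullback a c d (lin_sub M G) = u ^+ e1 * v ^+ e2 * h ^+ 2.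
Proof.
move=> hG g0.
have [r1 [r2 [r12 _ _ uE]]] := unit_quad_roots c0 Du0.
have [t1 [t2 [t12 _ _ vE]]] := unit_quad_roots d0 Dv0.
rewrite -/(uu a c) -/u in uE; rewrite -[unit_quad _ d]/(vv a d) -/v in vE.
have [e0N0 e1N0 e2N0] := row3_e_neq0.
have hH := lin_sub_homog M hG.
have cuv : coprimep u v := coprime_uv R0.
have uv r : root u r -> v.[r] != 0.
  by move: cuv => /Pdiv.ClosedField.coprimepP; apply.
have vu r : root v r -> u.[r] != 0.
  by move: cuv; rewrite coprimep_sym => /Pdiv.ClosedField.coprimepP; apply.
have sq := square_of_even c0 d0 r12 t12 uE vE cuv g0 (fun _ _ => erefl).
have ev := even_of_square c0 d0 r12 t12 uE vE cuv g0 (fun _ _ => erefl).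
have at_smooth := intersection_mult_smooth c0 d0 R0 Du0 Dv0 M_unit kap0 Q_normal hG g0.
have at_cusp lam (lam0 : lam != 0) :=
  intersection_mult_cusp c0 d0 R0 Du0 Dv0 M_unit kap0 Q_normal hG lam0 g0.
have at_node1 lam (lam0 : lam != 0) :=
  intersection_mult_node1 c0 d0 R0 Du0 Dv0 M_unit kap0 Q_normal uE r12 hG lam0 g0.
have at_node2 lam (lam0 : lam != 0) :=
  intersection_mult_node2 c0 d0 R0 Du0 Dv0 M_unit kap0 Q_normal vE t12 hG lam0 g0.
have at_infty n lam :=
  @intersection_mult_infty _ _ _ _ c0 d0 R0 Du0 Dv0 _ _ _ M_unit kap0 Q_normal _ _ n lam hG g0.
have root_g x : root (pullback a c d (lin_sub M G)) x = ((lin_sub M G).@[point_at a c d x 0] == 0).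
  by rewrite rootE horner_pullback.
have [sg _] := pullback_infty a c0 d0 hH.
move: g0 sq ev at_smooth at_cusp at_node1 at_node2 at_infty root_g sg.
move: (pullback a c d (lin_sub M G)) => g g0 sq ev at_smooth at_cusp at_node1 at_node2
  at_infty root_g sg.
have one0 : (1 : K) != 0 by apply: oner_neq0.
split=> [ec|[e1 [e2 [h Eg]]] p Qp Gp].
- apply: sq => [x ux vx||].
  + have [->|xN0] := eqVneq x 0.
      apply: (even_at hG ec e2N0 quartic_e2 (at_cusp _ one0)) => gq.
      apply: mupNroot; rewrite root_g.
      have -> : point_at a c d 0 = row3 0 0 1.
        by rewrite /point_at !unit_quadE; congr row3; ring.
      by [].
    have sr : ~~ root s x by rewrite root_conductor !negb_or ux vx xN0.
    apply: (even_at hG ec (point_at_neq0 sr) (quartic_at x) (at_smooth _ _ sr one0)).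
    by move=> gr; apply: mupNroot; rewrite root_g.
  + apply: (even_at hG ec e0N0 quartic_e0 (at_node1 _ one0)).
    suff H x : root u x -> (lin_sub M G).@[row3 1 0 0 0] != 0 -> mup x g = 0%N.
      by move=> Hx; rewrite !H // uE !rootM !root_XsubC eqxx !orbT.
    move=> ux Hx; apply: mupNroot; rewrite root_g.
    have -> : point_at a c d x = (x ^+ 2 * v.[x]) *: row3 1 0 0.
      by apply/rowP; apply: forall_ord3; rewrite row3E mxE row3E -/u -/v
        ?(eqP (ux : u.[x] == 0)) ?mulr1 ?mul0r ?mulr0.
    rewrite (meval_homog _ _ hH) mulf_neq0 // expf_neq0 // mulf_neq0 ?uv //.
    by rewrite expf_neq0 // (unit_quad_root0 ux).
  + apply: (even_at hG ec e1N0 quartic_e1 (at_node2 _ one0)).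
    suff H x : root v x -> (lin_sub M G).@[row3 0 1 0 0] != 0 -> mup x g = 0%N.
      by move=> Hx; rewrite !H // vE !rootM !root_XsubC eqxx !orbT.
    move=> vx Hx; apply: mupNroot; rewrite root_g.
    have -> : point_at a c d x = (x ^+ 2 * u.[x]) *: row3 0 1 0.
      by apply/rowP; apply: forall_ord3; rewrite row3E mxE row3E -/u -/v
        ?(eqP (vx : v.[x] == 0)) ?mulr1 ?mul0r ?mulr0.
    rewrite (meval_homog _ _ hH) mulf_neq0 // expf_neq0 // mulf_neq0 ?vu //.
    by rewrite expf_neq0 // (unit_quad_root0 vx).
- have [evr evu evv odd_g] := ev _ _ _ Eg.
  have p0 : p != 0 by case: Qp.
  pose q := p *m invmx M; have pE : p = q *m M by rewrite mulmxKV.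
  have q0 : q != 0 by apply: contraNneq p0 => E; rewrite pE E mul0mx.
  have Qq : on_curve Q (q *m M) by rewrite -pE.
  have [lam lam0] := normal_quartic_points q0 ((on_quartic q0).1 Qq).
  case=> [[]|||[r sr]] qE; rewrite pE qE -scalemxAl.
  + by exists (mup r1 g + mup r2 g)%N => //; apply: at_node1.
  + by exists (mup t1 g + mup t2 g)%N => //; apply: at_node2.
  + exists (mup 0 g); first exact: at_cusp.
    by apply: evr; apply/negP => /unit_quad_root0; rewrite eqxx.
  + exists ((4 * e).+1 - size g)%N; first by apply: at_infty => //; rewrite subnKC.
    by rewrite oddB // /= oddM /= odd_g.
  + exists (mup r g); first exact: at_smooth.
    by have [ur vr _] := not_double_root sr; apply: evr.
Qed.

End ContactConics.

(** * Tangent lines *)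

Section TangentLines.

Variable K : closedFieldType.
Implicit Types (F G : {mpoly K[3]}) (p q g : 'rV[K]_3).

Definition lin_form g : {mpoly K[3]} := \sum_i g 0 i *: 'X_i.

Lemma tangent_lineE F p : tangent_line F p = lin_form (grad F p).
Proof. by apply: eq_bigr => i _; rewrite mxE. Qed.

Lemma meval_lin_form g p : (lin_form g).@[p 0] = \sum_i g 0 i * p 0 i.
Proof. by rewrite raddf_sum; apply: eq_bigr => i _; rewrite /= mevalZ mevalXU. Qed.

Lemma lin_form_homog1 g : lin_form g \is 1.-homog.
Proof. exact: lin_form_homog. Qed.

Lemma grad_lin_form g p : grad (lin_form g) p = g.
Proof.
apply/rowP; apply: forall_ord3; rewrite mxE /lin_form big_ord3 !mderivD !mderivZ
  !mderivXU !mevalD !mevalZ ?meval0 ?meval1; ring.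
Qed.

Lemma lin_formZ (l : K) g : lin_form (l *: g) = l *: lin_form g.
Proof.
by rewrite /lin_form scaler_sumr; apply: eq_bigr => i _; rewrite mxE scalerA.
Qed.

Lemma lin_form_inj : injective lin_form.
Proof. by move=> g h E; rewrite -(grad_lin_form g 0) E grad_lin_form. Qed.

Lemma proportional_lin_form g h :
  proportional (lin_form g) (lin_form h) <-> proportional g h.
Proof.
split=> -[l l0 E]; exists l => //; last by rewrite -lin_formZ -E.
by apply: lin_form_inj; rewrite lin_formZ.
Qed.

Lemma smooth_pointE F p : smooth_point F p <-> on_curve F p /\ grad F p != 0.
Proof.
split=> -[Fp].
  by case=> i gi; split=> //; apply/rV0Pn; exists i; rewrite mxE.
by case/rV0Pn=> i gi; split=> //; exists i; move: gi; rewrite mxE.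
Qed.

Lemma singular_pointE F p : singular_point F p <-> on_curve F p /\ grad F p = 0.
Proof.
split=> -[Fp]; first by move=> g0; split=> //; apply/rowP => i; rewrite !mxE.
by move=> g0; split=> // i; have /rowP /(_ i) := g0; rewrite !mxE.
Qed.

Lemma lin_sub_lin_form (M : 'M[K]_3) g : lin_sub M (lin_form g) = lin_form (g *m M^T).
Proof.
rewrite /lin_form raddf_sum /=.
under eq_bigr do rewrite lin_subZ lin_subX scaler_sumr.
rewrite exchange_big /=; apply: eq_bigr => i _.
by rewrite mxE scaler_suml; apply: eq_bigr => j _; rewrite scalerA mxE.
Qed.

Lemma mulmx_tr_eq0 (M : 'M[K]_3) g : M \in unitmx -> (g *m M^T == 0) = (g == 0).
Proof.
move=> uM; apply/eqP/eqP => [E|->]; last by rewrite mul0mx.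
by rewrite -(mulmxK (_ : M^T \in unitmx) g) ?unitmx_tr // E mul0mx.
Qed.

Lemma proportional_mulmx (M : 'M[K]_3) g h : M \in unitmx ->
  proportional (g *m M) (h *m M) <-> proportional g h.
Proof.
move=> uM; split=> -[l l0 E]; exists l => //; last by rewrite E scalemxAl.
by rewrite -(mulmxK uM h) E -scalemxAl mulmxK.
Qed.

Lemma tangent_atE F G p : tangent_at F G p <->
  [/\ on_curve F p, on_curve G p, grad F p != 0, grad G p != 0
    & proportional (grad F p) (grad G p)].
Proof.
rewrite /tangent_at !tangent_lineE; split.
  by case=> /smooth_pointE [? ?] /smooth_pointE [? ?] /proportional_lin_form.
by case=> ? ? ? ? /proportional_lin_form; split=> //; apply/smooth_pointE.
Qed.

Lemma proportional_sym (V : lmodType K) (x y : V) : proportional x y -> proportional y x.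
Proof.
by case=> l l0 ->; exists l^-1; rewrite ?invr_eq0 // scalerA mulVf // scale1r.
Qed.

Lemma proportional_trans (V : lmodType K) (x y z : V) :
  proportional x y -> proportional y z -> proportional x z.
Proof.
by case=> l l0 -> [l' l0' ->]; exists (l' * l); rewrite ?mulf_neq0 // scalerA.
Qed.

Lemma proportional_refl (V : lmodType K) (x : V) : proportional x x.
Proof. by exists 1; rewrite ?oner_neq0 // scale1r. Qed.

Lemma on_curve_scale n F p (l : K) : F \is n.-homog -> l != 0 ->
  on_curve F (l *: p) <-> on_curve F p.
Proof.
move=> hF l0; rewrite /on_curve scaler_eq0 negb_or l0 (meval_homog _ _ hF).
split=> -[p0 E]; split=> //; last by rewrite E mulr0.
by move/eqP: E; rewrite mulf_eq0 (negbTE (expf_neq0 _ l0)) => /eqP.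
Qed.

(** Vectors orthogonal to the same two independent vectors are proportional. *)
Lemma cross_proportional (g h : 'rV[K]_3) : g != 0 -> h != 0 ->
  g 0 i0 * h 0 i1 = g 0 i1 * h 0 i0 -> g 0 i0 * h 0 i2 = g 0 i2 * h 0 i0 ->
  g 0 i1 * h 0 i2 = g 0 i2 * h 0 i1 -> proportional g h.
Proof.
move=> /rV0Pn [j gj] h0 E01 E02 E12.
have sym : forall i l, g 0 i * h 0 l = g 0 l * h 0 i.
  by apply: forall_ord3; apply: forall_ord3.
have E i : h 0 i = h 0 j / g 0 j * g 0 i.
  by apply: (mulIf gj); rewrite mulrAC divfK // mulrC sym mulrC.
exists (h 0 j / g 0 j); last by apply/rowP => i; rewrite mxE.
rewrite mulf_neq0 ?invr_neq0 //; apply: contraNneq h0 => hj.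
by apply/eqP/rowP => i; rewrite E hj mul0r mul0r mxE.
Qed.

Definition cross (w : K) p q : 'rV[K]_3 :=
  row3 (w * (p 0 i1 * q 0 i2 - p 0 i2 * q 0 i1))
       (w * (p 0 i2 * q 0 i0 - p 0 i0 * q 0 i2))
       (w * (p 0 i0 * q 0 i1 - p 0 i1 * q 0 i0)).

Lemma orthogonal_cross w (t p q : 'rV[K]_3) : t != 0 -> cross w p q != 0 ->
  \sum_i t 0 i * p 0 i = 0 -> \sum_i t 0 i * q 0 i = 0 ->
  proportional t (cross w p q).
Proof.
rewrite !big_ord3 /= => t0 g0 Ep Eq.
apply: cross_proportional => //; apply/eqP; rewrite -subr_eq0 !row3E; apply/eqP.
- transitivity (w * (p 0 i2 * (t 0 i0 * q 0 i0 + t 0 i1 * q 0 i1 + t 0 i2 * q 0 i2)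
    - q 0 i2 * (t 0 i0 * p 0 i0 + t 0 i1 * p 0 i1 + t 0 i2 * p 0 i2))); first by ring.
  by rewrite Ep Eq; ring.
- transitivity (w * (q 0 i1 * (t 0 i0 * p 0 i0 + t 0 i1 * p 0 i1 + t 0 i2 * p 0 i2)
    - p 0 i1 * (t 0 i0 * q 0 i0 + t 0 i1 * q 0 i1 + t 0 i2 * q 0 i2))); first by ring.
  by rewrite Ep Eq; ring.
- transitivity (w * (p 0 i0 * (t 0 i0 * q 0 i0 + t 0 i1 * q 0 i1 + t 0 i2 * q 0 i2)
    - q 0 i0 * (t 0 i0 * p 0 i0 + t 0 i1 * p 0 i1 + t 0 i2 * p 0 i2))); first by ring.
  by rewrite Ep Eq; ring.
Qed.

Lemma cross_orthogonal w (t p q : 'rV[K]_3) : proportional t (cross w p q) ->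
  \sum_i t 0 i * q 0 i = 0.
Proof.
case/proportional_sym => l l0 ->; rewrite big_ord3 /= !mxE /=; ring.
Qed.

End TangentLines.

Section TangentsOfTheQuartic.

Variables (K : closedFieldType) (a c d : K).

Let b := a - 1.
Let k := c - d.
Let m := a * d - b * c.
Let u := uu a c.
Let v := vv a d.
Let s := conductor_poly a c d.

(* The coefficients of the products of the coordinates of the curve. *)
Let xx : seq K := [:: 0; 0; 0; 0; 1; 2 * b; b ^+ 2 + 2 * d; 2 * b * d; d ^+ 2].
Let yy : seq K := [:: 0; 0; 0; 0; 1; 2 * a; a ^+ 2 + 2 * c; 2 * a * c; c ^+ 2].
Let zz : seq K := [:: 1; 2 * a + 2 * b; 4 * a * b + a ^+ 2 + b ^+ 2 + 2 * d + 2 * c; 2 * a ^+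
  2 * b + 2 * a * b ^+ 2 + 4 * a * d + 2 * a * c + 2 * b * d + 4 * b * c; a
  ^+ 2 * b ^+ 2 + 4 * a * b * d + 4 * a * b * c + 2 * a ^+ 2 * d + 2 * b ^+ 2
  * c + 4 * c * d + d ^+ 2 + c ^+ 2; 2 * a ^+ 2 * b * d + 2 * a * b ^+ 2 * c
  + 4 * a * c * d + 2 * a * d ^+ 2 + 4 * b * c * d + 2 * b * c ^+ 2; 4 * a *
  b * c * d + a ^+ 2 * d ^+ 2 + 2 * c * d ^+ 2 + b ^+ 2 * c ^+ 2 + 2 * c ^+ 2
  * d; 2 * a * c * d ^+ 2 + 2 * b * c ^+ 2 * d; c ^+ 2 * d ^+ 2].
Let yz : seq K := [:: 0; 0; 1; 2 * a + b; a ^+ 2 + 2 * a * b + d + 2 * c; a ^+ 2 * b + 2 * a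
  * d + 2 * a * c + 2 * b * c; a ^+ 2 * d + 2 * a * b * c + 2 * c * d + c ^+
  2; 2 * a * c * d + b * c ^+ 2; c ^+ 2 * d].
Let xz : seq K := [:: 0; 0; 1; 2 * b + a; 2 * a * b + b ^+ 2 + 2 * d + c; a * b ^+ 2 + 2 * b
  * d + 2 * b * c + 2 * a * d; 2 * a * b * d + b ^+ 2 * c + 2 * c * d + d ^+
  2; 2 * b * c * d + a * d ^+ 2; c * d ^+ 2].
Let xy : seq K := [:: 0; 0; 0; 0; 1; b + a; a * b + c + d; b * c + a * d; c * d].

Let xxE : ('X^2 * v) ^+ 2 = Poly xx.
Proof. rewrite /u /v /uu /vv /unit_quad -/b /= !cons_poly_def; ring. Qed.
Let yyE : ('X^2 * u) ^+ 2 = Poly yy.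
Proof. rewrite /u /v /uu /vv /unit_quad -/b /= !cons_poly_def; ring. Qed.
Let zzE : (u * v) ^+ 2 = Poly zz.
Proof. rewrite /u /v /uu /vv /unit_quad -/b /= !cons_poly_def; ring. Qed.
Let yzE : 'X^2 * u * (u * v) = Poly yz.
Proof. rewrite /u /v /uu /vv /unit_quad -/b /= !cons_poly_def; ring. Qed.
Let xzE : 'X^2 * v * (u * v) = Poly xz.
Proof. rewrite /u /v /uu /vv /unit_quad -/b /= !cons_poly_def; ring. Qed.
Let xyE : 'X^2 * v * ('X^2 * u) = Poly xy.
Proof. rewrite /u /v /uu /vv /unit_quad -/b /= !cons_poly_def; ring. Qed.

(** The coefficients of a conic restricted to the quartic. *)
Definition quad_coef (A B C D E F : K) i : K :=
  A * xx`_i + B * yy`_i + C * zz`_i + D * yz`_i + E * xz`_i + F * xy`_i.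

Lemma pullback_quad A B C D E F :
  pullback a c d (quad A B C D E F) =
  A%:P * ('X^2 * v) ^+ 2 + B%:P * ('X^2 * u) ^+ 2 + C%:P * (u * v) ^+ 2 +
  D%:P * ('X^2 * u * (u * v)) + E%:P * ('X^2 * v * (u * v)) +
  F%:P * ('X^2 * v * ('X^2 * u)).
Proof.
rewrite /pullback /quad !raddfD /= !mmapZ !rmorphXn !rmorphM /= !mmapX !mmap1U.
by rewrite !row3E.
Qed.

Lemma coef_pullback_quad A B C D E F i :
  (pullback a c d (quad A B C D E F))`_i = quad_coef A B C D E F i.
Proof.
by rewrite pullback_quad xxE yyE zzE yzE xzE xyE !coefD !coefCM !coef_Poly.
Qed.

Lemma size_pullback_quad A B C D E F :
  ((size (pullback a c d (quad A B C D E F)) <= 7)%N) =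
  (quad_coef A B C D E F 7 == 0) && (quad_coef A B C D E F 8 == 0).
Proof.
rewrite -!coef_pullback_quad; apply/idP/andP => [sg|[/eqP g7 /eqP g8]].
  by rewrite !nth_default ?(leq_trans sg).
apply/leq_sizeP => j j7.
case: j j7 => [|[|[|[|[|[|[|[|[|j]]]]]]]]] // _.
by rewrite coef_pullback_quad /quad_coef !nth_default // !mulr0 !addr0.
Qed.

Hypotheses (c0 : c != 0) (d0 : d != 0).

(** The tangent line at the point at infinity. *)
Definition tau : 'rV[K]_3 := row3 (b * c ^+ 2) (- (a * d ^+ 2)) m.

Lemma tau_neq0 : tau != 0.
Proof.
apply/negP => /eqP /rowP t0.
have /eqP : tau 0 i0 = 0 by rewrite t0 mxE.
have /eqP : tau 0 i1 = 0 by rewrite t0 mxE.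
rewrite !row3E oppr_eq0 !mulf_eq0 (negbTE c0) (negbTE d0) !orbF.
by rewrite /b => /eqP ->; rewrite sub0r oppr_eq0 oner_eq0.
Qed.

Lemma grad_normal_quartic (p : 'rV[K]_3) :
  let x := p 0 i0 in let y := p 0 i1 in let z := p 0 i2 in
  let T := y * z - x * z - k * (x * y) in
  let N := y * z - a * T - c * (x * y) in
  grad (normal_quartic a c d) p =
  row3 (2 * T * (- z - k * y) - y * N - x * y * (- a * (- z - k * y) - c * y))
       (2 * T * (z - k * x) - x * N - x * y * (z - a * (z - k * x) - c * x))
       (2 * T * (y - x) - x * y * (y - a * (y - x))).
Proof.
move=> x y z T N; rewrite {}/N {}/T {}/x {}/y {}/z.
by apply/rowP; apply: forall_ord3; rewrite row3E mxE /normal_quartic -/k expr2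
  !(mderivB, mderivM, mderivZ, mderivXU) /=
  !(mevalB, mevalD, mevalM, mevalZ, mevalXU, meval0, meval1); ring.
Qed.

Lemma grad_infty : grad (normal_quartic a c d) (point_infty c d) = (- (c * d)) *: tau.
Proof.
rewrite grad_normal_quartic /= !row3E; apply/rowP; apply: forall_ord3;
  rewrite row3E mxE row3E /m /k /b; ring.
Qed.

Lemma grad_e : [/\ grad (normal_quartic a c d) (row3 1 0 0) = 0,
  grad (normal_quartic a c d) (row3 0 1 0) = 0
  & grad (normal_quartic a c d) (row3 0 0 1) = 0].
Proof.
by split; rewrite grad_normal_quartic /= !row3E; apply/rowP; apply: forall_ord3;
  rewrite row3E mxE; ring.
Qed.

(* The derivative of the parametrization. *)
Definition velocity r : 'rV[K]_3 :=
  row3 (2 * r + 3 * b * r ^+ 2 + 4 * d * r ^+ 3)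
       (2 * r + 3 * a * r ^+ 2 + 4 * c * r ^+ 3)
       ((a + b) + 2 * (c + d + a * b) * r + 3 * (a * d + b * c) * r ^+ 2
        + 4 * (c * d) * r ^+ 3).

Lemma grad_at r :
  grad (normal_quartic a c d) (point_at a c d r) =
  cross (r ^+ 2 * u.[r] * v.[r]) (point_at a c d r) (velocity r).
Proof.
rewrite grad_normal_quartic /= /cross !row3E !unit_quadE -/b.
by congr row3; rewrite /k /b; ring.
Qed.

(** The tangent line at infinity, restricted to the quartic. *)
Definition tau_poly : {poly K} :=
  m%:P + (m * (a + b))%:P * 'X + (a * b * m + c * d)%:P * 'X^2.

Lemma pullback_tau : pullback a c d (lin_form tau) = tau_poly.
Proof.
rewrite /pullback /lin_form big_ord3 !raddfD /= !mmapZ !mmapX !mmap1U !row3E /=.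
by rewrite /tau_poly /uu /vv /unit_quad /m /b; ring.
Qed.

Lemma tau_poly_at r : tau_poly.[r] = \sum_i tau 0 i * point_at a c d r 0 i.
Proof. by rewrite -pullback_tau horner_pullback meval_lin_form. Qed.

Lemma tau_velocity r : \sum_i tau 0 i * velocity r 0 i =
  m * (a + b) + 2 * (a * b * m + c * d) * r.
Proof. rewrite big_ord3 /= !row3E /m /b; ring. Qed.

End TangentsOfTheQuartic.

Section Positions.

Variables (K : closedFieldType) (a c d : K).

Let b := a - 1.
Let k := c - d.
Let m := a * d - b * c.
Let u := uu a c.
Let v := vv a d.
Let s := conductor_poly a c d.

Hypotheses (two0 : 2 != 0 :> K).
Hypotheses (c0 : c != 0) (d0 : d != 0) (R0 : res_uv a c d != 0).
Hypotheses (Du0 : a ^+ 2 - 4 * c != 0) (Dv0 : b ^+ 2 - 4 * d != 0).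

Variables (Q : {mpoly K[3]}) (M : 'M[K]_3) (kap : K).
Hypotheses (M_unit : M \in unitmx) (kap0 : kap != 0).
Hypothesis Q_normal : lin_sub M Q = kap *: normal_quartic a c d.

Let Qn := normal_quartic a c d.
Let z := point_infty c d.
Let zo := z *m M.

Lemma gradZ (l : K) (F : {mpoly K[3]}) p : grad (l *: F) p = l *: grad F p.
Proof. by apply/rowP => i; rewrite !mxE mderivZ mevalZ. Qed.

Lemma grad_quartic (q : 'rV[K]_3) : grad Q (q *m M) *m M^T = kap *: grad Qn q.
Proof. by rewrite -grad_lin_sub Q_normal gradZ. Qed.

Lemma grad_quartic_eq0 (q : 'rV[K]_3) : (grad Q (q *m M) == 0) = (grad Qn q == 0).
Proof.
by rewrite -(mulmx_tr_eq0 _ M_unit) grad_quartic scaler_eq0 (negbTE kap0).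
Qed.

Let nu := kap * - (c * d).
Let nu0 : nu != 0. Proof. by rewrite mulf_neq0 // oppr_eq0 mulf_neq0. Qed.

Let grad_zo : grad Q zo *m M^T = nu *: tau a c d.
Proof. by rewrite grad_quartic grad_infty scalerA. Qed.

Let tau0 : tau a c d != 0. Proof. exact: tau_neq0. Qed.

Let z0 : z != 0. Proof. exact: point_infty_neq0. Qed.

Let MT_unit : M^T \in unitmx. Proof. by rewrite unitmx_tr. Qed.

Let proportional_scale (x y : 'rV[K]_3) (l l' : K) : l != 0 -> l' != 0 ->
  proportional (l *: x) (l' *: y) <-> proportional x y.
Proof.
move=> l0 l0'; have scl (w : 'rV[K]_3) (e : K) : e != 0 -> proportional w (e *: w).
  by exists e.
split=> H.
  apply: proportional_trans (scl x _ l0) _; apply: proportional_trans H _.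
  exact/proportional_sym/scl.
apply: proportional_trans (proportional_sym (scl x _ l0)) _.
exact: proportional_trans H (scl _ _ l0').
Qed.

Lemma tangent_conicP G A B C D E F : lin_sub M G = quad A B C D E F ->
  disc_quad A B C D E F != 0 ->
  tangent_at Q G zo <-> (size (pullback a c d (quad A B C D E F)) <= 7)%N.
Proof.
move=> EG disc0; set H := quad A B C D E F.
have gH : grad G zo *m M^T = grad H z by rewrite -grad_lin_sub EG.
set g := grad H z in gH.
have g8 : quad_coef a c d A B C D E F 8 = H.@[z 0].
  by rewrite /H meval_quad !row3E /quad_coef /=; ring.
have g7 : quad_coef a c d A B C D E F 7 =
    b * g 0 i0 + a * g 0 i1 + (a * d + b * c) * g 0 i2.
  by rewrite /g /H grad_quad !row3E /quad_coef /= -/b; ring.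
have euler : d * g 0 i0 + c * g 0 i1 + c * d * g 0 i2 = 2 * H.@[z 0].
  by rewrite -quad_euler -/H -/g /z /point_infty !row3E; ring.
rewrite size_pullback_quad g7 g8; split.
- case/tangent_atE => Qz Gz gQ0 gG0 gprop.
  have Hz : H.@[z 0] = 0 by case: Gz => _; rewrite -meval_lin_sub EG.
  have [l l0 El] : proportional (nu *: tau a c d) g.
    by rewrite -grad_zo -gH; apply/proportional_mulmx.
  by rewrite Hz eqxx andbT El !mxE /=; apply/eqP; rewrite /b; ring.
- case/andP => /eqP E7 /eqP E8.
  have Hz : on_curve H z by split.
  have gN0 : g != 0.
    by have [_ sm] := smooth_quad two0 A B C D E F; apply: sm.
  rewrite E8 mulr0 in euler.
  apply/tangent_atE; split.
  + apply/(on_quartic M_unit kap0 Q_normal z0); exact: quartic_infty.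
  + by apply/(on_curve_lin_sub M_unit); rewrite EG.
  + by rewrite grad_quartic_eq0 grad_infty scaler_eq0 oppr_eq0 negb_or mulf_neq0.
  + by rewrite -(mulmx_tr_eq0 _ M_unit) gH.
  + apply/(proportional_mulmx _ _ MT_unit); rewrite grad_zo gH.
    rewrite -[g]scale1r; apply/proportional_scale => //; first exact: oner_neq0.
    apply: cross_proportional => //; apply/eqP; rewrite -subr_eq0; apply/eqP; rewrite !row3E -/b.
    * transitivity ((a * d + b * c) * (d * g 0 i0 + c * g 0 i1 + c * d * g 0 i2) -
        c * d * (b * g 0 i0 + a * g 0 i1 + (a * d + b * c) * g 0 i2)).
        by rewrite /b; ring.
      by rewrite euler E7; ring.
    * transitivity (- a * (d * g 0 i0 + c * g 0 i1 + c * d * g 0 i2) +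
        c * (b * g 0 i0 + a * g 0 i1 + (a * d + b * c) * g 0 i2)).
        by rewrite /b; ring.
      by rewrite euler E7; ring.
    * transitivity (b * (d * g 0 i0 + c * g 0 i1 + c * d * g 0 i2) -
        d * (b * g 0 i0 + a * g 0 i1 + (a * d + b * c) * g 0 i2)).
        by rewrite /b; ring.
      by rewrite euler E7; ring.
Qed.

Let tau_grad_at r :
  \sum_i tau a c d 0 i * point_at a c d r 0 i = 0 ->
  \sum_i tau a c d 0 i * velocity a c d r 0 i = 0 ->
  grad Qn (point_at a c d r) != 0 ->
  proportional (tau a c d) (grad Qn (point_at a c d r)).
Proof. by rewrite /Qn grad_at => *; apply: orthogonal_cross. Qed.

Let grad_at_tau r : proportional (tau a c d) (grad Qn (point_at a c d r)) ->
  \sum_i tau a c d 0 i * velocity a c d r 0 i = 0.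
Proof. by rewrite /Qn grad_at; apply: cross_orthogonal. Qed.

Let l := tangent_line Q zo.

Let lE : lin_sub M l = nu *: lin_form (tau a c d).
Proof. by rewrite /l tangent_lineE lin_sub_lin_form grad_zo lin_formZ. Qed.

Let on_l (q : 'rV[K]_3) : q != 0 ->
  on_curve l (q *m M) <-> \sum_i tau a c d 0 i * q 0 i = 0.
Proof.
move=> q0; split.
  case/(on_curve_lin_sub M_unit) => _; rewrite lE mevalZ meval_lin_form => /eqP.
  by rewrite mulf_eq0 (negbTE nu0) => /eqP.
move=> E; apply/(on_curve_lin_sub M_unit); split=> //.
by rewrite lE mevalZ meval_lin_form E mulr0.
Qed.

Let tau_poly0 : tau_poly a c d != 0.
Proof.
apply/negP => /eqP E; have : m = 0.
  have := congr1 (fun P : {poly K} => P.[0]) E.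
  by rewrite /tau_poly !hornerE /= => <-; rewrite -/b -/m; ring.
move=> m0; have : c * d = 0.
  have := congr1 (fun P : {poly K} => P.[1]) E.
  by rewrite /tau_poly !hornerE /= -/b -/m m0 => <-; ring.
by move/eqP; rewrite mulf_eq0 (negbTE c0) (negbTE d0).
Qed.

Let mult_l n : (size (tau_poly a c d) + n = 5)%N -> intersection_mult l Q zo n.
Proof.
move=> sn; apply: intersection_multC.
have hl : l \is 1.-homog by rewrite /l tangent_lineE; apply: lin_form_homog1.
have El : pullback a c d (lin_sub M l) = nu *: tau_poly a c d.
  by rewrite lE /pullback mmapZ mul_polyC -pullback_tau.
have := @intersection_mult_infty _ _ _ _ c0 d0 R0 Du0 Dv0 _ _ _ M_unit kap0 Q_normal
  _ _ n 1 hl; rewrite El scale1r; apply.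
- by rewrite scaler_eq0 negb_or nu0.
- exact: oner_neq0.
- by rewrite size_scale.
Qed.

Let size_tau_poly_le : (size (tau_poly a c d) <= 3)%N.
Proof.
apply/leq_sizeP => j j3; rewrite /tau_poly !(coefD, coefCM, coefC, coefX, coefXn).
by case: j j3 => [|[|[|j]]] //= _; rewrite !mulr0 !addr0.
Qed.

Let mult_l_size n : intersection_mult l Q zo n -> (size (tau_poly a c d) + n = 5)%N.
Proof.
move=> ln; have sl := size_tau_poly_le.
have := @mult_l (5 - size (tau_poly a c d)); rewrite subnKC; last by clear -sl; slia.
by move/(_ erefl)/(intersection_mult_uniq ln) ->; clear -sl; slia.
Qed.

Let tau_coef : [/\ (tau_poly a c d)`_0 = m, (tau_poly a c d)`_1 = m * (a + b)
  & (tau_poly a c d)`_2 = a * b * m + c * d].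
Proof.
by split; rewrite /tau_poly !(coefD, coefCM, coefC, coefX, coefXn) /= -/b -/m; ring.
Qed.

(** The tangent at [zo] is a bitangent, or a hyperflex tangent. *)
Definition bitangency := a * d - (a - 1) * c - 4 * (c * d).

Let beta := bitangency.

Let mult4 : intersection_mult l Q zo 4 -> beta = 0.
Proof.
move/mult_l_size => s5; have s1 : size (tau_poly a c d) = 1%N by clear -s5; slia.
have [_ t1 t2] := tau_coef; move: t1 t2.
rewrite !nth_default ?s1 // => /esym/eqP; rewrite mulf_eq0 => /orP [/eqP m0|/eqP ab].
  rewrite m0 mulr0 add0r => /esym/eqP.
  by rewrite mulf_eq0 (negbTE c0) (negbTE d0).
move=> E; have a2 : 2 * a = 1 by rewrite -[RHS]addr0 -ab /b; ring.
have : 4 * a * b = -1.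
  have -> : 4 * a * b = (2 * a) * (2 * a - 2) by rewrite /b; ring.
  by rewrite a2; ring.
move=> E4; rewrite /beta /bitangency -/b -/m.
transitivity (m - 4 * (a * b * m + c * d) + (4 * a * b) * m); first by ring.
by rewrite -E E4; ring.
Qed.

Lemma position_bP : position_b Q zo -> beta = 0.
Proof.
case=> [[p zp]|]; last exact: mult4.
case/tangent_atE => lp Qp _ gQ prop.
have p0 : p != 0 by case: Qp.
pose q := p *m invmx M; have pE : p = q *m M by rewrite mulmxKV.
have q0 : q != 0 by apply: contraNneq p0 => E; rewrite pE E mul0mx.
have Qq : (normal_quartic a c d).@[q 0] = 0.
  by apply/(on_quartic M_unit kap0 Q_normal q0); rewrite -pE.
have gq : grad Qn q != 0 by rewrite -grad_quartic_eq0 -pE.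
have hQ : Qn \is 4.-homog.
  rewrite /Qn /normal_quartic; have hX i := homogX K i.
  have h2 i j : 'X_i * 'X_j \is [in K[3], 2.-homog] by apply: (@dhomogM _ _ _ 1 _ 1).
  have hT : 'X_i1 * 'X_i2 - 'X_i0 * 'X_i2 - (c - d) *: ('X_i0 * 'X_i1) \is [in K[3], 2.-homog].
    by apply: rpredB; [apply: rpredB|apply: rpredZ].
  apply: rpredB; first exact: (@dhomogMn _ _ _ 2 _ 2).
  apply: (@dhomogM _ _ _ 2 _ 2) => //; apply: rpredB; last exact: rpredZ.
  by apply: rpredB => //; apply: rpredZ.
have gs (e : K) x : grad Qn x = 0 -> grad Qn (e *: x) = 0.
  by move=> gx; rewrite (grad_scale _ _ (hQ : Qn \is 3.+1.-homog)) gx scaler0.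
have [g0 g1 g2] := grad_e a c d.
have [e e0 Hq] := normal_quartic_points d0 R0 q0 Qq.
case: Hq => [[E|E]|E|E|[r sr E]].
- by rewrite E gs ?eqxx in gq.
- by rewrite E gs ?eqxx in gq.
- by rewrite E gs ?eqxx in gq.
- by case: zp; exists e => //; rewrite pE E -scalemxAl.
have gr : proportional (tau a c d) (grad Qn (point_at a c d r)).
  have : proportional (nu *: tau a c d) (kap *: grad Qn q).
    rewrite -grad_zo -grad_quartic; apply/(proportional_mulmx _ _ MT_unit).
    by rewrite -pE; move: prop; rewrite tangent_lineE grad_lin_form.
  move/(proportional_scale _ _ nu0 kap0).
  rewrite E (grad_scale _ _ (hQ : Qn \is 3.+1.-homog)).
  move=> H; apply/(proportional_scale _ _ (oner_neq0 _) (expf_neq0 3 e0)).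
  by rewrite scale1r.
have Lr : \sum_i tau a c d 0 i * point_at a c d r 0 i = 0.
  apply/on_l; first exact: point_at_neq0.
  have hl : l \is 1.-homog by rewrite /l tangent_lineE; apply: lin_form_homog1.
  by apply/(on_curve_scale _ hl e0); rewrite scalemxAl -E -pE.
have := grad_at_tau gr; rewrite tau_velocity -/b -/m.
move: Lr; rewrite -tau_poly_at /tau_poly !hornerE /= -/b -/m.
have r0 : r != 0 by move: sr; rewrite root_conductor !negb_or => /and3P [].
move=> E1 E2.
have : m * beta = 0.
  transitivity ((m * (a + b) + 2 * (a * b * m + c * d) * r) ^+ 2
     - 4 * (a * b * m + c * d) * (m + m * (a + b) * r + (a * b * m + c * d) * (r * r))).
    by rewrite /beta /bitangency /m /b; ring.
  have -> : m * (a + b) + 2 * (a * b * m + c * d) * r = 0 by rewrite -[RHS]E2 /b; ring.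
  have -> : m + m * (a + b) * r + (a * b * m + c * d) * (r * r) = 0.
    by rewrite -[RHS]E1 /b; ring.
  ring.
move/eqP; rewrite mulf_eq0 => /orP [/eqP m0|/eqP //].
move: E2; rewrite m0 !(mulr0, mul0r, add0r) => /eqP.
by rewrite !mulf_eq0 (negbTE two0) (negbTE c0) (negbTE d0) (negbTE r0).
Qed.

Let not_proportional_z (q : 'rV[K]_3) : q != 0 -> q 0 i0 = 0 \/ q 0 i1 = 0 ->
  ~ proportional zo (q *m M).
Proof.
move=> q0 q01 /(proportional_mulmx _ _ M_unit) [e e0 E]; move: q01.
rewrite E !mxE /= => -[] /eqP; rewrite mulf_eq0 (negbTE e0) /= => H.
  by move: d0; rewrite H.
by move: c0; rewrite H.
Qed.

Let transverse_smooth (q : 'rV[K]_3) : position_s Q zo -> q != 0 ->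
  (normal_quartic a c d).@[q 0] = 0 -> \sum_i tau a c d 0 i * q 0 i = 0 ->
  ~ proportional zo (q *m M) ->
  grad Qn q != 0 /\ ~ proportional (tau a c d) (grad Qn q).
Proof.
move=> [_ tr] q0 Qq lq zq.
have [_ /smooth_pointE [_ gQ] np] := tr _ ((on_l q0).2 lq)
  ((on_quartic M_unit kap0 Q_normal q0).2 Qq) zq.
rewrite -grad_quartic_eq0; split=> // gprop; apply: np.
rewrite !tangent_lineE grad_lin_form; apply/proportional_lin_form.
apply/(proportional_mulmx _ _ MT_unit); rewrite grad_zo grad_quartic.
exact/proportional_scale.
Qed.

Lemma position_sP : position_s Q zo -> [/\ a != 0, b != 0, m != 0 & beta != 0].
Proof.
move=> ps; have [e0N0 e1N0 e2N0] := row3_e_neq0 K; have [g0 g1 g2] := grad_e a c d.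
have bN0 : b != 0.
  apply/negP => /eqP b0.
  have [||gq _] := transverse_smooth ps e0N0 (quartic_e0 a c d).
  - by rewrite big_ord3 !row3E /= -/b b0; ring.
  - by apply: not_proportional_z => //; right; rewrite row3E.
  by rewrite /Qn g0 eqxx in gq.
have aN0 : a != 0.
  apply/negP => /eqP a0.
  have [||gq _] := transverse_smooth ps e1N0 (quartic_e1 a c d).
  - by rewrite big_ord3 !row3E /= a0; ring.
  - by apply: not_proportional_z => //; left; rewrite row3E.
  by rewrite /Qn g1 eqxx in gq.
have mN0 : m != 0.
  apply/negP => /eqP m0.
  have [||gq _] := transverse_smooth ps e2N0 (quartic_e2 a c d).
  - by rewrite big_ord3 !row3E /= -/b -/m m0; ring.
  - by apply: not_proportional_z => //; left; rewrite row3E.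
  by rewrite /Qn g2 eqxx in gq.
split=> //; apply/negP => /eqP beta0.
have cdE : 4 * (c * d) = m by rewrite -[RHS]subr0 -beta0 /beta /bitangency /m /b; ring.
have four0 : 4 != 0 :> K by rewrite (_ : 4 = 2 * 2) ?mulf_neq0 //; ring.
have [ab0|abN0] := eqVneq (a + b) 0.
  have [_ t1 t2] := tau_coef.
  have E2 : a * b * m + c * d = 0.
    apply: (mulfI four0); rewrite mulr0.
    have -> : 4 * (a * b * m + c * d) = m * (a + b) ^+ 2.
      by rewrite mulrDr cdE /b; ring.
    by rewrite ab0 expr0n mulr0.
  have s1 : (size (tau_poly a c d) <= 1)%N.
    have sl := size_tau_poly_le; apply/leq_sizeP => j j1.
    have [j3|j3] := leqP 3 j; first by rewrite nth_default // (leq_trans sl).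
    move: j j1 j3 => [|[|[|j]]] // _ _; first by rewrite t1 ab0 mulr0.
    by rewrite t2 E2.
  have s0 : (0 < size (tau_poly a c d))%N by rewrite size_poly_gt0 tau_poly0.
  have s1E : size (tau_poly a c d) = 1%N by clear -s1 s0; slia.
  by case: ps => -[] /mult_l_size; rewrite s1E.
have [r rE r0] : exists2 r, r * (a + b) = - 2 & r != 0.
  exists (- 2 / (a + b)); first by rewrite divfK.
  by rewrite mulf_neq0 ?invr_neq0 // oppr_eq0.
have Lr : \sum_i tau a c d 0 i * point_at a c d r 0 i = 0.
  rewrite -tau_poly_at /tau_poly !hornerE /= -/b -/m.
  apply: (mulfI four0).
  transitivity (m * (2 + r * (a + b)) ^+ 2 + (4 * (c * d) - m) * r ^+ 2).
    by rewrite /b; ring.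
  by rewrite rE cdE; ring.
have Lv : \sum_i tau a c d 0 i * velocity a c d r 0 i = 0.
  rewrite tau_velocity -/b -/m; apply: (mulfI two0).
  transitivity (m * (a + b) * (2 + r * (a + b)) + (4 * (c * d) - m) * r).
    by rewrite /b; ring.
  by rewrite rE cdE; ring.
have Lr3 := Lr; move: Lr3; rewrite big_ord3 /= !row3E -/b -/m -/u -/v => Lr3.
have uv r' : root u r' -> root v r' -> False.
  move=> ur vr; have := coprime_uv R0.
  by move/Pdiv.ClosedField.coprimepP => /(_ r' ur); rewrite (eqP vr) eqxx.
have sr : ~~ root s r.
  rewrite root_conductor !negb_or r0 andbT; apply/andP; split; apply/negP => ur.
  - move/eqP: Lr3; rewrite (eqP (ur : u.[r] == 0)) !(mulr0, mul0r, addr0).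
    rewrite !mulf_eq0 (negbTE bN0) (negbTE c0) (negbTE r0) /= => vr.
    exact: uv ur vr.
  - move/eqP: Lr3; rewrite (eqP (ur : v.[r] == 0)) !(mulr0, mul0r, addr0, add0r).
    rewrite !mulf_eq0 oppr_eq0 !mulf_eq0 (negbTE aN0) (negbTE d0) (negbTE r0) /= => vr.
    exact: uv vr ur.
have [|g_r np] := transverse_smooth ps (point_at_neq0 sr) (quartic_at a c d r) Lr.
  move=> /(proportional_mulmx _ _ M_unit) [e e0 E].
  have [ur [vr _]] : u.[r] != 0 /\ v.[r] != 0 /\ True.
    by move: sr; rewrite root_conductor !negb_or !rootE => /and3P [].
  have := congr1 (fun x : 'rV[K]_3 => x 0 i0) E; have := congr1 (fun x : 'rV[K]_3 => x 0 i1) E.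
  have := congr1 (fun x : 'rV[K]_3 => x 0 i2) E; rewrite !mxE /= -/u -/v => E2 E1 E0.
  have uE : u.[r] = c * r ^+ 2.
    by apply: (mulIf vr); rewrite E2 -[RHS]mulrA E0; ring.
  have vE : v.[r] = d * r ^+ 2.
    by apply: (mulIf ur); rewrite mulrC E2 -[RHS]mulrA E1; ring.
  move: uE vE; rewrite !unit_quadE => uE vE.
  have : r = 0.
    have -> : r = (1 + a * r + c * r ^+ 2) - c * r ^+ 2 - ((1 + (a - 1) * r + d * r ^+ 2) - d * r ^+ 2) by ring.
    by rewrite uE vE; ring.
  by move/eqP; rewrite (negbTE r0).
by apply: np; apply: tau_grad_at.
Qed.

Lemma position_scP (y : 'rV[K]_3) (e : K) : e != 0 -> y = e *: (row3 0 0 1 *m M) ->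
  position_sc Q y zo -> m = 0.
Proof.
move=> e0 -> [_ ly]; have [_ _ e2N0] := row3_e_neq0 K.
have hl : l \is 1.-homog by rewrite /l tangent_lineE; apply: lin_form_homog1.
move/(on_curve_scale _ hl e0)/(on_l e2N0): ly.
by rewrite big_ord3 /= !row3E -/b -/m => <-; ring.
Qed.

Lemma position_snP (x1 x2 : 'rV[K]_3) (e f : K) : e != 0 -> f != 0 ->
  x1 = e *: (row3 1 0 0 *m M) -> x2 = f *: (row3 0 1 0 *m M) ->
  position_sn Q x1 x2 zo -> a = 0 \/ b = 0.
Proof.
move=> e0 f0 -> -> [_ lx]; have [e0N0 e1N0 _] := row3_e_neq0 K.
have hl : l \is 1.-homog by rewrite /l tangent_lineE; apply: lin_form_homog1.
case: lx => [/(on_curve_scale _ hl e0)/(on_l e0N0)|/(on_curve_scale _ hl f0)/(on_l e1N0)];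
  rewrite big_ord3 /= !row3E ?(mulr0, mulr1, addr0, add0r) => /eqP.
  by rewrite !mulf_eq0 (negbTE c0) !orbF => /eqP; right.
by rewrite oppr_eq0 !mulf_eq0 (negbTE d0) !orbF => /eqP; left.
Qed.

End Positions.

(** * Counting classes of proportional vectors *)

Section Counting.

Variables (K : closedFieldType) (V : lmodType K).
Implicit Types (P : V -> Prop) (v w S : V).

Lemma count_ext P P' n : (forall v, P v <-> P' v) ->
  number_up_to_scaling P n -> number_up_to_scaling P' n.
Proof.
move=> PP' [s [Ps inj surj]]; exists s; split=> // [i|v /PP' /surj //].
exact/PP'.
Qed.

Lemma count_one_if P S (cnd : bool) : (cnd -> P S) ->
  (forall v, P v -> cnd /\ proportional S v) -> number_up_to_scaling P cnd.
Proof.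
case: cnd => [/(_ isT) PS all|_ none]; exists (fun=> S); split=> //.
- by move=> i j _; rewrite !ord1.
- by move=> v /all [_ Sv]; exists ord0.
- by case.
- by case.
- by move=> v /none [].
Qed.

Lemma count_add P P1 P2 n1 n2 : (forall v, P v <-> P1 v \/ P2 v) ->
  (forall v w, P1 v -> P2 w -> ~ proportional v w) ->
  number_up_to_scaling P1 n1 -> number_up_to_scaling P2 n2 ->
  number_up_to_scaling P (n1 + n2).
Proof.
move=> PE disj [s1 [Ps1 inj1 surj1]] [s2 [Ps2 inj2 surj2]].
exists (fun i => match split i with inl j => s1 j | inr j => s2 j end); split.
- by move=> i; apply/PE; case: (split i) => j; [left|right].
- move=> i j; rewrite -(splitK i) -(splitK j) !unsplitK.
  case: (split i) (split j) => i' [] j' E.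
  + by rewrite (inj1 _ _ E).
  + by case: (disj _ _ (Ps1 i') (Ps2 j') E).
  + by case: (disj _ _ (Ps1 j') (Ps2 i') (proportional_sym E)).
  + by rewrite (inj2 _ _ E).
- move=> v /PE [/surj1|/surj2] [j sv].
    by exists (unsplit (inl j)); rewrite unsplitK.
  by exists (unsplit (inr j)); rewrite unsplitK.
Qed.

End Counting.

Lemma count_transport (K : closedFieldType) (V W : lmodType K) (f : V -> W) (g : W -> V)
    (P : V -> Prop) (P' : W -> Prop) n :
  scalable f -> scalable g -> cancel f g -> cancel g f ->
  (forall v, P v <-> P' (f v)) ->
  number_up_to_scaling P' n -> number_up_to_scaling P n.
Proof.
move=> fZ gZ fK gK PE [s [Ps inj surj]]; exists (g \o s); split=> /=.
- by move=> i; apply/PE; rewrite gK.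
- move=> i j [l l0 E]; apply: inj; exists l => //.
  by rewrite -[LHS]gK E fZ gK.
- move=> v /PE /surj [i [l l0 E]]; exists i, l => //.
  by rewrite -[v]fK E gZ.
Qed.

(** * Classification of the contact conics *)

Section Classification.

Variables (K : closedFieldType) (a c d : K).

Let b := a - 1.
Let k := c - d.
Let m := a * d - b * c.
Let beta := m - 4 * (c * d).
Let u := uu a c.
Let v := vv a d.

Hypotheses (two0 : 2 != 0 :> K).
Hypotheses (c0 : c != 0) (d0 : d != 0) (R0 : res_uv a c d != 0).
Hypotheses (Du0 : a ^+ 2 - 4 * c != 0) (Dv0 : b ^+ 2 - 4 * d != 0).

Let pb := pullback a c d.

(** The contact conics tangent to the quartic at infinity, by the double points
    that they contain. *)
Definition contact_quad (e1 e2 e3 : bool) (H : {mpoly K[3]}) : Prop :=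
  exists A B C D E F, [/\ H = quad A B C D E F, disc_quad A B C D E F != 0,
    [/\ (A == 0) = e1, (B == 0) = e2 & (C == 0) = e3],
    (size (pb H) <= 7)%N & exists h : {poly K}, pb H = u ^+ e1 * v ^+ e2 * h ^+ 2].

Lemma quadZ l A B C D E F : l *: quad A B C D E F =
  quad (l * A) (l * B) (l * C) (l * D) (l * E) (l * F) :> {mpoly K[3]}.
Proof. by rewrite /quad !scalerDr !scalerA. Qed.

Lemma disc_quadZ l A B C D E F :
  disc_quad (l * A) (l * B) (l * C) (l * D) (l * E) (l * F) =
  l ^+ 3 * disc_quad A B C D E F :> K.
Proof. rewrite /disc_quad; ring. Qed.

Let pbZ (l : K) H : pb (l *: H) = l%:P * pb H.
Proof. by rewrite /pb /pullback mmapZ. Qed.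

Lemma contact_quadZ e1 e2 e3 l H : l != 0 ->
  contact_quad e1 e2 e3 H -> contact_quad e1 e2 e3 (l *: H).
Proof.
move=> l0 [A [B [C [D [E [F [HE disc0 [eA eB eC] sH [h Hh]]]]]]]].
exists (l * A), (l * B), (l * C), (l * D), (l * E), (l * F).
split.
- by rewrite HE quadZ.
- by rewrite disc_quadZ mulf_neq0 ?expf_neq0.
- by rewrite !mulf_eq0 !(negbTE l0).
- by rewrite pbZ mul_polyC size_scale.
have [x x2] := poly_sqrt_const l; exists (x%:P * h).
by rewrite pbZ Hh -x2 polyC_exp; ring.
Qed.

Lemma quad_inj A B C D E F A' B' C' D' E' F' :
  quad A B C D E F = quad A' B' C' D' E' F' :> {mpoly K[3]} ->
  [/\ [/\ A = A', B = B' & C = C'] & [/\ D = D', E = E' & F = F']].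
Proof.
move=> EH; have ev x y z : A * x ^+ 2 + B * y ^+ 2 + C * z ^+ 2
  + D * (y * z) + E * (x * z) + F * (x * y) = A' * x ^+ 2 + B' * y ^+ 2 + C' * z ^+ 2
  + D' * (y * z) + E' * (x * z) + F' * (x * y).
  by have := congr1 (meval (row3 x y z 0)) EH; rewrite !meval_quad !row3E.
have EA : A = A' by have := ev 1 0 0; rewrite !expr0n !expr1n /= !(mulr0, mul0r, mulr1, addr0).
have EB : B = B' by have := ev 0 1 0; rewrite !expr0n !expr1n /= !(mulr0, mul0r, mulr1, addr0, add0r).
have EC : C = C' by have := ev 0 0 1; rewrite !expr0n !expr1n /= !(mulr0, mul0r, mulr1, addr0, add0r).
split=> //; subst A' B' C'; split.
- by have := ev 0 1 1; rewrite !expr0n !expr1n /= !(mulr0, mul0r, mulr1, addr0, add0r) => /addrI.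
- by have := ev 1 0 1; rewrite !expr0n !expr1n /= !(mulr0, mul0r, mulr1, addr0, add0r) => /addrI.
- by have := ev 1 1 0; rewrite !expr0n !expr1n /= !(mulr0, mul0r, mulr1, addr0, add0r) => /addrI.
Qed.

Let uv_coprime r : root u r -> root v r -> False.
Proof.
move=> ur vr; have := coprime_uv R0.
by move/Pdiv.ClosedField.coprimepP => /(_ r ur); rewrite (eqP vr) eqxx.
Qed.

Lemma pb_at_u A B C D E F r : root u r ->
  (pb (quad A B C D E F)).[r] = A * (r ^+ 2 * v.[r]) ^+ 2.
Proof.
move=> ur; rewrite /pb horner_pullback meval_quad !row3E -/u -/v.
rewrite (eqP (ur : u.[r] == 0)); ring.
Qed.

Lemma pb_at_v A B C D E F r : root v r ->
  (pb (quad A B C D E F)).[r] = B * (r ^+ 2 * u.[r]) ^+ 2.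
Proof.
move=> vr; rewrite /pb horner_pullback meval_quad !row3E -/u -/v.
rewrite (eqP (vr : v.[r] == 0)); ring.
Qed.

Let root_u : exists r, root u r.
Proof. by have [r [_ [_ ur _]]] := unit_quad_root2 c0 Du0; exists r. Qed.

Let root_v : exists r, root v r.
Proof. by have [r [_ [_ vr _]]] := unit_quad_root2 d0 Dv0; exists r. Qed.

Let node_val_neq0 r : root u r -> r ^+ 2 * v.[r] != 0.
Proof.
move=> ur; rewrite mulf_neq0 ?expf_neq0 ?(unit_quad_root0 ur) //.
by apply/negP => vr; apply: uv_coprime ur vr.
Qed.

Let node_val_neq0' r : root v r -> r ^+ 2 * u.[r] != 0.
Proof.
move=> vr; rewrite mulf_neq0 ?expf_neq0 ?(unit_quad_root0 vr) //.
by apply/negP => ur; apply: uv_coprime ur vr.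
Qed.

Lemma pullback_quad_inj A B C D E F :
  pb (quad A B C D E F) = 0 -> quad A B C D E F = 0.
Proof.
move=> E0; have [r ur] := root_u; have [t vt] := root_v.
have A0 : A = 0.
  have /eqP := pb_at_u A B C D E F ur; rewrite E0 horner0 eq_sym mulf_eq0.
  by rewrite (negbTE (expf_neq0 2 (node_val_neq0 ur))) orbF => /eqP.
have B0 : B = 0.
  have /eqP := pb_at_v A B C D E F vt; rewrite E0 horner0 eq_sym mulf_eq0.
  by rewrite (negbTE (expf_neq0 2 (node_val_neq0' vt))) orbF => /eqP.
have coef0 i : quad_coef a c d A B C D E F i = 0.
  by rewrite -coef_pullback_quad -/pb -/(pb _) E0 coef0.
have := coef0 0%N; have := coef0 2%N; have := coef0 3%N; have := coef0 4%N.
rewrite /quad_coef /= A0 B0 !(mul0r, mulr0, mulr1, add0r, addr0) -/b => e4 e3 e2 C0.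
move: e4 e3 e2; rewrite C0 !mul0r !add0r => e4 e3 e2.
have ED : D = - E by apply/eqP; rewrite -subr_eq0 opprK e2.
have D0 : D = 0.
  transitivity (D * (2 * a + b) + E * (2 * b + a)); last exact: e3.
  by rewrite ED /b; ring.
have E00 : E = 0 by apply/eqP; rewrite -oppr_eq0 -ED D0.
have F0 : F = 0 by rewrite -[RHS]e4 D0 E00; ring.
by rewrite D0 E00 F0 /quad !scale0r !addr0.
Qed.

Lemma pullback_quad_eq S H : S \is 2.-homog -> H \is 2.-homog ->
  pb S = pb H -> S = H.
Proof.
move=> hS hH E; apply/eqP; rewrite -subr_eq0; apply/eqP.
have hSH : S - H \is 2.-homog by apply: rpredB.
have [A [B [C [D [E' [F EQ]]]]]] := homog2_quad hSH.
rewrite EQ; apply: pullback_quad_inj; rewrite -EQ /pb /pullback raddfB /=.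
by rewrite -![mmap _ _ _]/(pb _) E subrr.
Qed.

(** Two conics whose restrictions are squares with proportional roots are
    proportional. *)
Lemma contact_quad_unique f mu h S H : S \is 2.-homog -> H \is 2.-homog ->
  H != 0 -> pb S = f * h ^+ 2 -> pb H = f * (mu%:P * h) ^+ 2 -> proportional S H.
Proof.
move=> hS hH H0 ES EH.
have E : H = mu ^+ 2 *: S.
  apply: pullback_quad_eq => //; first exact: rpredZ.
  by rewrite pbZ ES EH polyC_exp; ring.
exists (mu ^+ 2) => //; apply: contraNneq H0 => mu0.
by rewrite E mu0 scale0r.
Qed.

(* Square roots at the roots of a quadratic polynomial: with equal or with
   opposite signs, the latter being interpolated by 2 + a' x. *)
Lemma root_signs a' c' A (f g : {poly K}) : c' != 0 -> a' ^+ 2 - 4 * c' != 0 ->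
  A != 0 ->
  (forall r, root (unit_quad a' c') r -> f.[r] ^+ 2 = A * (r ^+ 2 * g.[r]) ^+ 2) ->
  exists2 p, p != 0 &
    (forall r, root (unit_quad a' c') r -> f.[r] = p * (r ^+ 2 * g.[r])) \/
    (forall r, root (unit_quad a' c') r -> f.[r] = p * (r * (2 + a' * r) * g.[r])).
Proof.
move=> c'0 D0 A0; have [r [t [rt aE crt qE]]] := unit_quad_roots c'0 D0.
have rq x : root (unit_quad a' c') x = (x == r) || (x == t).
  by rewrite qE !rootM !root_XsubC rootC (negbTE c'0).
have [al al2] := poly_sqrt_const A => fE.
have al0 : al != 0 by apply: contraNneq A0 => al0; rewrite -al2 al0 expr0n.
have sg x : root (unit_quad a' c') x ->
    f.[x] = al * (x ^+ 2 * g.[x]) \/ f.[x] = - al * (x ^+ 2 * g.[x]).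
  move=> qx; have /eqP := fE _ qx; rewrite -al2 -exprMn eqf_sqr mulNr.
  by case/orP => /eqP ->; [left|right].
have qr : root (unit_quad a' c') r by rewrite rq eqxx.
have qt : root (unit_quad a' c') t by rewrite rq eqxx orbT.
have two_at x y : c' * (x * y) = 1 -> a' = - (c' * (x + y)) ->
    2 + a' * x = c' * x * (y - x).
  move=> cxy ->; transitivity (2 - c' * (x * y) - c' * x * x); first by ring.
  by rewrite cxy; transitivity (c' * (x * y) - c' * x * x); [rewrite cxy; ring|ring].
have er := two_at _ _ crt aE.
have et : 2 + a' * t = c' * t * (r - t).
  by apply: two_at; [rewrite (mulrC t)|rewrite (addrC t)].
have D1 : c' * (t - r) != 0 by rewrite mulf_neq0 // subr_eq0 eq_sym.
have opp e : e != 0 -> f.[r] = e * (r ^+ 2 * g.[r]) -> f.[t] = - e * (t ^+ 2 * g.[t]) ->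
  exists2 p, p != 0 & forall x, root (unit_quad a' c') x ->
    f.[x] = p * (x * (2 + a' * x) * g.[x]).
  move=> e0 Er Et; exists (e / (c' * (t - r))); first by rewrite mulf_neq0 ?invr_neq0.
  move=> x; rewrite rq => /orP [] /eqP ->.
    rewrite er Er.
    transitivity (e / (c' * (t - r)) * (c' * (t - r)) * (r ^+ 2 * g.[r])); last by ring.
    by rewrite divfK.
  rewrite et Et.
  transitivity (e / (c' * (t - r)) * (c' * (t - r)) * - (t ^+ 2 * g.[t])); last by ring.
  by rewrite divfK //; ring.
case: (sg _ qr) => Er; case: (sg _ qt) => Et.
- by exists al => //; left=> x; rewrite rq => /orP [] /eqP ->.
- by have [p p0 Hp] := opp _ al0 Er Et; exists p => //; right.
- have [||p p0 Hp] := opp _ _ Er; first by rewrite oppr_eq0.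
    by rewrite opprK.
  by exists p => //; right.
- by exists (- al); rewrite ?oppr_eq0 //; left=> x; rewrite rq => /orP [] /eqP ->.
Qed.

Lemma dvd_roots (a' c' : K) (f : {poly K}) : c' != 0 -> a' ^+ 2 - 4 * c' != 0 ->
  (forall r, root (unit_quad a' c') r -> f.[r] = 0) -> unit_quad a' c' %| f.
Proof.
move=> c'0 D0; have [r [t [rt _ _ qE]]] := unit_quad_roots c'0 D0.
move=> fz; have fr : f.[r] = 0 by apply: fz; rewrite qE !rootM !root_XsubC eqxx orbT.
have ft : f.[t] = 0 by apply: fz; rewrite qE !rootM !root_XsubC eqxx !orbT.
rewrite qE mul_polyC dvdpZl // Gauss_dvdp.
  by rewrite !dvdp_XsubCl !rootE fr ft eqxx.
by rewrite coprimep_XsubC root_XsubC eq_sym.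
Qed.

Let size_u : size u = 3%N. Proof. exact: size_unit_quad. Qed.
Let size_v : size v = 3%N. Proof. exact: size_unit_quad. Qed.

Lemma const_uv (f : {poly K}) : (size f <= 5)%N -> (forall r, root u r -> f.[r] = 0) ->
  (forall r, root v r -> f.[r] = 0) -> exists e, f = e%:P * (u * v).
Proof.
move=> sf fu fv.
have : u * v %| f.
  by rewrite Gauss_dvdp ?(coprime_uv R0) // (dvd_roots c0 Du0 fu) (dvd_roots d0 Dv0 fv).
case/dvdpP => q Eq; exists q`_0; rewrite {1}Eq; congr (_ * _); apply: size1_polyC.
have [->|q0] := eqVneq q 0; first by rewrite size_poly0.
have u0 : u != 0 by rewrite -size_poly_gt0 size_u.
have v0 : v != 0 by rewrite -size_poly_gt0 size_v.
have : size f = (size q + (size u + size v).-1).-1.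
  have <- : size (u * v) = (size u + size v).-1 by apply: size_mul.
  by rewrite Eq; apply: size_mul => //; rewrite mulf_neq0.
by rewrite size_u size_v; move: sf; clear; slia.
Qed.

Lemma contact_quad_proportional e1 e2 e3 S H :
  proportional S H -> contact_quad e1 e2 e3 H -> contact_quad e1 e2 e3 S.
Proof. by case/proportional_sym => l l0 ->; apply: contact_quadZ. Qed.

Lemma contact_quad_disc e1 e2 e3 A B C D E F :
  contact_quad e1 e2 e3 (quad A B C D E F) -> disc_quad A B C D E F != 0.
Proof.
case=> A' [B' [C' [D' [E' [F' [EH disc0 _ _ _]]]]]].
by have [[-> -> ->] [-> -> ->]] := quad_inj EH.
Qed.

Lemma contact_quad_neq0 e1 e2 e3 H : contact_quad e1 e2 e3 H -> H != 0.
Proof.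
case=> A [B [C [D [E [F [-> disc0 _ _ _]]]]]]; apply: contraNneq disc0 => H0.
have EH : quad A B C D E F = quad 0 0 0 0 0 0 by rewrite H0 /quad !scale0r !addr0.
by have [[-> -> ->] [-> -> ->]] := quad_inj EH; rewrite /disc_quad; apply/eqP; ring.
Qed.

Lemma contact_quad_intro (e1 e2 e3 : bool) A B C D E F h :
  disc_quad A B C D E F != 0 -> (A == 0) = e1 -> (B == 0) = e2 -> (C == 0) = e3 ->
  (size (pb (quad A B C D E F)) <= 7)%N ->
  pb (quad A B C D E F) = u ^+ e1 * v ^+ e2 * h ^+ 2 ->
  contact_quad e1 e2 e3 (quad A B C D E F).
Proof. by move=> disc0 eA eB eC sg Eh; exists A, B, C, D, E, F; split=> //; exists h. Qed.

End Classification.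

Section ConicsMissingTheNodes.

Variables (K : closedFieldType) (a c d : K).

Let b := a - 1.
Let k := c - d.
Let m := a * d - b * c.
Let beta := bitangency a c d.
Let u := uu a c.
Let v := vv a d.
Let pb := pullback a c d.
Let Du := a ^+ 2 - 4 * c.
Let Dv := b ^+ 2 - 4 * d.

Hypotheses (two0 : 2 != 0 :> K).
Hypotheses (c0 : c != 0) (d0 : d != 0) (R0 : res_uv a c d != 0).
Hypotheses (Du0 : Du != 0) (Dv0 : Dv != 0).

Let contact := contact_quad a c d.

Definition cusp_conic1 : {mpoly K[3]} :=
  quad (b ^+ 2 * c ^+ 2) (d ^+ 2 * Dv) 0 (4 * d ^+ 2 - 4 * b * c * d)
    (4 * b * c * d) (- 2 * b * c * d * (b - 2 * k)).

Definition cusp_conic2 : {mpoly K[3]} :=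
  quad (c ^+ 2 * Du) (a ^+ 2 * d ^+ 2) 0 (- 4 * a * c * d)
    (4 * c ^+ 2 + 4 * a * c * d) (- 2 * a * c * d * (a - 2 * k)).

Definition cusp_conic3 : {mpoly K[3]} :=
  quad (b ^+ 2 * c ^+ 2 * Du) (a ^+ 2 * d ^+ 2 * Dv) 0
    (4 * a ^+ 2 * d ^+ 2 - 4 * a * b * c * d)
    (4 * b ^+ 2 * c ^+ 2 - 4 * a * b * c * d)
    (- 2 * a * b * c * d * (a * b - 2 * c - 2 * d)).

Definition free_conic : {mpoly K[3]} :=
  quad (c ^+ 2 * d ^+ 2 * Du) (c ^+ 2 * d ^+ 2 * Dv) (m ^+ 2)
    (- 2 * c * d * m * (- 2 + 2 * a - 2 * k - b)) (- 2 * c * d * m * (2 * k - a))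
    (- 2 * c ^+ 2 * d ^+ 2 * (a * b - 2 * c - 2 * d)
     - 2 * c * d * m * (2 * c - (2 * a - 2 * k) * k)).

(* On the roots of u and v these agree, up to scalars, with the square roots
   t^2 and t (2 + a t), or t (2 + b t), of t^4 and of the discriminant times t^4. *)
Let h1 : {poly K} := (b * c)%:P * ('X^2 * v) - d%:P * ('X * (2 + b%:P * 'X) * u).
Let h2 : {poly K} := (a * d)%:P * ('X^2 * u) - c%:P * ('X * (2 + a%:P * 'X) * v).
Let h3 : {poly K} := (b * c)%:P * ('X * (2 + a%:P * 'X) * v)
  - (a * d)%:P * ('X * (2 + b%:P * 'X) * u).
Let h4 : {poly K} := (c * d)%:P * ('X * (2 + a%:P * 'X) * v
  - 'X * (2 + b%:P * 'X) * u) - m%:P * (u * v).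

Let pbE1 : pb cusp_conic1 = h1 ^+ 2.
Proof.
rewrite /pb /cusp_conic1 pullback_quad /h1 /u /v /uu /vv /unit_quad /Dv /k -/b.
by rewrite !(polyCM, polyCB, polyCN, polyC_exp, polyCD) /b !(polyCB, polyC1); ring.
Qed.

Let pbE2 : pb cusp_conic2 = h2 ^+ 2.
Proof.
rewrite /pb /cusp_conic2 pullback_quad /h2 /u /v /uu /vv /unit_quad /Du /k -/b.
by rewrite !(polyCM, polyCB, polyCN, polyC_exp, polyCD) /b !(polyCB, polyC1); ring.
Qed.

Let pbE3 : pb cusp_conic3 = h3 ^+ 2.
Proof.
rewrite /pb /cusp_conic3 pullback_quad /h3 /u /v /uu /vv /unit_quad /Du /Dv /k -/b.
by rewrite !(polyCM, polyCB, polyCN, polyC_exp, polyCD) /b !(polyCB, polyC1); ring.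
Qed.

Let pbE4 : pb free_conic = h4 ^+ 2.
Proof.
rewrite /pb /free_conic pullback_quad /h4 /u /v /uu /vv /unit_quad /Du /Dv /m /k -/b.
by rewrite !(polyCM, polyCB, polyCN, polyC_exp, polyCD) /b !(polyCB, polyC1); ring.
Qed.

Let sixteen0 : 16 != 0 :> K.
Proof. by rewrite (_ : 16 = 2 ^+ 4) ?expf_neq0 // -natrX. Qed.

Lemma cusp_conic1_contact : b * m * beta != 0 -> contact false false true cusp_conic1.
Proof.
rewrite !mulf_eq0 !negb_or -andbA => /and3P [b0 m0 be0].
apply: (@contact_quad_intro _ a c d _ _ _ _ _ _ _ _ _ h1).
- rewrite (_ : disc_quad _ _ _ _ _ _ = - 16 * b ^+ 2 * c ^+ 2 * d ^+ 2 * m * beta).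
    by rewrite !mulf_neq0 ?expf_neq0 ?oppr_eq0.
  by rewrite /disc_quad /beta /bitangency /m /Dv /k /b; ring.
- by apply/negbTE; rewrite mulf_neq0 ?expf_neq0.
- by apply/negbTE; rewrite mulf_neq0 ?expf_neq0.
- by rewrite eqxx.
- rewrite size_pullback_quad; apply/andP; split; apply/eqP;
    by rewrite /quad_coef /= /Dv /k /b; ring.
- by rewrite -/pb pbE1 !expr0 !mul1r.
Qed.

Lemma cusp_conic2_contact : a * m * beta != 0 -> contact false false true cusp_conic2.
Proof.
rewrite !mulf_eq0 !negb_or -andbA => /and3P [a0 m0 be0].
apply: (@contact_quad_intro _ a c d _ _ _ _ _ _ _ _ _ h2).
- rewrite (_ : disc_quad _ _ _ _ _ _ = - 16 * a ^+ 2 * c ^+ 2 * d ^+ 2 * m * beta).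
    by rewrite !mulf_neq0 ?expf_neq0 ?oppr_eq0.
  by rewrite /disc_quad /beta /bitangency /m /Du /k /b; ring.
- by apply/negbTE; rewrite mulf_neq0 ?expf_neq0.
- by apply/negbTE; rewrite mulf_neq0 ?expf_neq0.
- by rewrite eqxx.
- rewrite size_pullback_quad; apply/andP; split; apply/eqP;
    by rewrite /quad_coef /= /Du /k /b; ring.
- by rewrite -/pb pbE2 !expr0 !mul1r.
Qed.

Lemma cusp_conic3_contact : a * b * m != 0 -> contact false false true cusp_conic3.
Proof.
rewrite !mulf_eq0 !negb_or -andbA => /and3P [a0 b0 m0].
apply: (@contact_quad_intro _ a c d _ _ _ _ _ _ _ _ _ h3).
- rewrite (_ : disc_quad _ _ _ _ _ _ =
    - 16 * a ^+ 2 * b ^+ 2 * c ^+ 2 * d ^+ 2 * m ^+ 2).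
    by rewrite !mulf_neq0 ?expf_neq0 ?oppr_eq0.
  by rewrite /disc_quad /m /Du /Dv /b; ring.
- by apply/negbTE; rewrite !mulf_neq0 ?expf_neq0.
- by apply/negbTE; rewrite !mulf_neq0 ?expf_neq0.
- by rewrite eqxx.
- rewrite size_pullback_quad; apply/andP; split; apply/eqP;
    by rewrite /quad_coef /= /Du /Dv /b; ring.
- by rewrite -/pb pbE3 !expr0 !mul1r.
Qed.

Lemma free_conic_contact : m * beta != 0 -> contact false false false free_conic.
Proof.
rewrite !mulf_eq0 !negb_or => /andP [m0 be0].
apply: (@contact_quad_intro _ a c d _ _ _ _ _ _ _ _ _ h4).
- rewrite (_ : disc_quad _ _ _ _ _ _ =
    - 16 * c ^+ 2 * d ^+ 2 * m ^+ 3 * beta * res_uv a c d ^+ 2).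
    by rewrite !mulf_neq0 ?expf_neq0 ?oppr_eq0.
  by rewrite /disc_quad /beta /bitangency /res_uv /m /Du /Dv /k /b; ring.
- by apply/negbTE; rewrite !mulf_neq0 ?expf_neq0.
- by apply/negbTE; rewrite !mulf_neq0 ?expf_neq0.
- by apply/negbTE; rewrite expf_neq0.
- rewrite size_pullback_quad; apply/andP; split; apply/eqP;
    by rewrite /quad_coef /= /Du /Dv /m /k /b; ring.
- by rewrite -/pb pbE4 !expr0 !mul1r.
Qed.

(* A square root of degree 3 of the restriction of a conic, given by its values
   at the roots of u and v. *)
Let square_shape A B C D E F h p1 p2 q1 q2 :
  pb (quad A B C D E F) = h ^+ 2 -> (size (pb (quad A B C D E F)) <= 7)%N ->
  (forall r, root u r -> h.[r] = ((p1%:P * 'X + p2%:P * 'X^2) * v).[r]) ->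
  (forall r, root v r -> h.[r] = ((q1%:P * 'X + q2%:P * 'X^2) * u).[r]) ->
  exists r, [/\ h = (p1%:P * 'X + p2%:P * 'X^2) * v + (q1%:P * 'X + q2%:P * 'X^2) * u
    + r%:P * (u * v), p2 * d + q2 * c + r * (c * d) = 0, C = r ^+ 2 & r * (p1 + q1) = 0].
Proof.
move=> Eh sg hu hv.
have sh : (size h <= 4)%N.
  have [->|hn0] := eqVneq h 0; first by rewrite size_poly0.
  have : size (h ^+ 2) = (size h + size h).-1 by rewrite expr2; apply: size_mul.
  by rewrite -Eh; move: sg; clear; slia.
pose f : {poly K} := (p1%:P * 'X + p2%:P * 'X^2) * v + (q1%:P * 'X + q2%:P * 'X^2) * u.
have coefs r : f + r%:P * (u * v) = Poly [:: r; p1 + q1 + r * (a + b);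
    p1 * b + p2 + q1 * a + q2 + r * (a * b + c + d);
    p1 * d + p2 * b + q1 * c + q2 * a + r * (a * d + b * c);
    p2 * d + q2 * c + r * (c * d)].
  rewrite /f /u /v /uu /vv /unit_quad -/b /= !cons_poly_def.
  by rewrite !(polyCM, polyCD); ring.
have sf : (size f <= 5)%N.
  by have := coefs 0; rewrite polyC0 mul0r addr0 => ->; rewrite (leq_trans (size_Poly _)).
have [||| r Er] := @const_uv _ a c d c0 d0 R0 Du0 Dv0 (h - f).
- by rewrite (leq_trans (size_polyD _ _)) // geq_max size_polyN sf (leq_trans sh).
- move=> r ur; rewrite hornerD hornerN hu // /f hornerD (hornerM _ u).
  by rewrite (eqP (ur : u.[r] == 0)) mulr0 addr0 subrr.
- move=> r vr; rewrite hornerD hornerN hv // /f hornerD (hornerM _ v).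
  by rewrite (eqP (vr : v.[r] == 0)) mulr0 add0r subrr.
have {Er} Eh2 : h = f + r%:P * (u * v) by rewrite -[h](subrK f) Er addrC.
have h4_0 : h`_4 = 0 by rewrite nth_default.
have := Eh2; rewrite coefs => Ec.
have C_r : C = r ^+ 2.
  have := congr1 (fun g : {poly K} => g`_0) Eh.
  rewrite coef_pullback_quad expr2 coef0M Ec coef_Poly /quad_coef /= => Er.
  by rewrite expr2 -Er; ring.
exists r; split=> //; first by move: h4_0; rewrite Ec coef_Poly.
have := congr1 (fun g : {poly K} => g`_1) Eh.
rewrite coef_pullback_quad expr2 coefM !big_ord_recl big_ord0 Ec !coef_Poly.
rewrite /quad_coef /= -/b C_r => E1; apply: (mulfI two0); rewrite mulr0.
transitivity ((r * (p1 + q1 + r * (a + b)) + ((p1 + q1 + r * (a + b)) * r + 0))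
  - r ^+ 2 * (2 * a + 2 * b)); first by ring.
by rewrite -E1; ring.
Qed.

Let signs A B C D E F h :
  A != 0 -> B != 0 -> pb (quad A B C D E F) = h ^+ 2 ->
  exists p q (al be : bool), [/\ p != 0, q != 0,
  (forall r, root u r -> h.[r] = (((if al then p * 2 else 0)%:P * 'X + (if al then p * a else p)%:P * 'X^2) * v).[r]) &
  (forall r, root v r -> h.[r] = (((if be then q * 2 else 0)%:P * 'X + (if be then q * b else q)%:P * 'X^2) * u).[r])].
Proof.
move=> A0 B0 Eh.
have [r ur|p p0 Hp] := @root_signs _ a c A h v c0 Du0 A0.
  by rewrite -(@pb_at_u _ a c d A B C D E F) // -/pb Eh horner_exp.
have [r vr|q q0 Hq] := @root_signs _ b d B h u d0 Dv0 B0.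
  by rewrite -(@pb_at_v _ a c d A B C D E F) // -/pb Eh horner_exp.
exists p, q; case: Hp => Hp; case: Hq => Hq; [exists false, false|exists false, true|
  exists true, false|exists true, true]; split=> // r /[dup] rr;
  by move=> /Hp -> || move=> /Hq ->; rewrite !hornerE /=; ring.
Qed.

Let square_class A B C D E F h :
  A != 0 -> B != 0 -> disc_quad A B C D E F != 0 ->
  pb (quad A B C D E F) = h ^+ 2 -> (size (pb (quad A B C D E F)) <= 7)%N ->
  exists mu, [\/ C = 0 /\ h = mu%:P * h1, C = 0 /\ h = mu%:P * h2,
    C = 0 /\ h = mu%:P * h3 | C != 0 /\ h = mu%:P * h4].
Proof.
move=> A0 B0 disc0 Eh sg.
have [p [q [al [be [p0 q0 hu hv]]]]] := signs A0 B0 Eh.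
have [r [{}Eh2 E4 C_r rpq]] := square_shape Eh sg hu hv.
have dbl (x : K) : x != 0 -> x * 2 != 0 by move=> x0; rewrite mulf_neq0.
have r_0 (x : K) : x != 0 -> r * x = 0 -> r = 0.
  by move=> x0 /eqP; rewrite mulf_eq0 (negbTE x0) orbF => /eqP.
case: al be hu hv Eh2 E4 rpq => [] [] _ _; rewrite ?addr0 ?add0r ?mul0r => Eh2 E4 rpq.
- have [r0|rn0] := eqVneq r 0; last first.
    have pq : q = - p.
      apply/eqP; rewrite -subr_eq0 opprK addrC; apply/eqP.
      move/eqP: rpq; rewrite mulf_eq0 (negbTE rn0) -mulrDl mulf_eq0 (negbTE two0).
      by rewrite orbF => /eqP.
    exists (p / (c * d)); constructor 4; rewrite C_r expf_neq0 //; split=> //.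
    have Er : r = - (p / (c * d) * m).
      apply: (mulIf (mulf_neq0 c0 d0)); apply/eqP; rewrite -subr_eq0; apply/eqP.
      rewrite -[RHS]E4 pq /m; field; by rewrite c0 d0.
    have Ep : p = p / (c * d) * (c * d) by rewrite divfK // mulf_neq0.
    rewrite Eh2 pq Er /h4; move: (p / (c * d)) Ep => e ->.
    by rewrite !(polyCM, polyCN); ring.
  have {}E4 : p * (a * d) = - (q * (b * c)).
    apply/eqP; rewrite -subr_eq0 opprK; apply/eqP; rewrite -[RHS]E4 r0; ring.
  have b0 : b != 0.
    apply: contraNneq p0 => b_0; move/eqP: E4; rewrite b_0 mul0r mulr0 oppr0.
    have -> : a = 1 by apply/eqP; rewrite -subr_eq0 -/b b_0.
    by rewrite mul1r mulf_eq0 (negbTE d0) orbF.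
  exists (p / (b * c)); constructor 3; rewrite C_r r0 expr0n; split=> //.
  have Eq : q = - (p / (b * c) * (a * d)).
    apply: (mulIf (mulf_neq0 b0 c0)); rewrite -[LHS]opprK -E4.
    by field; rewrite b0 c0.
  have Ep : p = p / (b * c) * (b * c) by rewrite divfK // mulf_neq0.
  rewrite Eh2 r0 /h3 Eq; move: (p / (b * c)) Ep => e ->.
  by rewrite !(polyCM, polyCN); ring.
- have r0 : r = 0 by apply: r_0 rpq; apply: dbl.
  exists (- (p / c)); constructor 2; rewrite C_r r0 expr0n; split=> //.
  have Eq : q = - (p / c * (a * d)).
    apply: (mulIf c0); apply/eqP; rewrite -subr_eq0; apply/eqP.
    rewrite -[RHS]E4 r0; field; exact: c0.
  have Ep : p = p / c * c by rewrite divfK.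
  rewrite Eh2 r0 /h2 Eq; move: (p / c) Ep => e ->.
  by rewrite !(polyCM, polyCN); ring.
- have r0 : r = 0 by apply: r_0 rpq; apply: dbl.
  exists (- (q / d)); constructor 1; rewrite C_r r0 expr0n; split=> //.
  have Ep : p = - (q / d * (b * c)).
    apply: (mulIf d0); apply/eqP; rewrite -subr_eq0; apply/eqP.
    rewrite -[RHS]E4 r0; field; exact: d0.
  have Eq : q = q / d * d by rewrite divfK.
  rewrite Eh2 r0 /h1 Ep; move: (q / d) Eq => e ->.
  by rewrite !(polyCM, polyCN); ring.
- case/eqP: disc0.
  have EH : quad A B C D E F = quad (p ^+ 2) (q ^+ 2) (r ^+ 2) (2 * q * r) (2 * p * r)
      (2 * p * q).
    apply: (@pullback_quad_eq _ a c d); rewrite ?quad_homog //.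
    rewrite -/pb Eh Eh2 /pb pullback_quad -/u -/v !(polyCM, polyC_exp, polyC0).
    ring.
  have [[-> -> ->] [-> -> ->]] := quad_inj EH; rewrite /disc_quad; ring.
Qed.

Let contact_same mu h S H : S \is 2.-homog -> pb S = h ^+ 2 -> H != 0 -> H \is 2.-homog ->
  pb H = (mu%:P * h) ^+ 2 -> proportional S H.
Proof.
move=> hS ES H0 hH EH; apply: (@contact_quad_unique _ a c d c0 d0 R0 Du0 Dv0 1 mu h) => //.
  by rewrite mul1r.
by rewrite mul1r.
Qed.

Let contact_class e3 H : contact false false e3 H ->
  [\/ e3 /\ proportional cusp_conic1 H, e3 /\ proportional cusp_conic2 H,
      e3 /\ proportional cusp_conic3 H | ~~ e3 /\ proportional free_conic H].
Proof.
move=> cH; have H0 := contact_quad_neq0 cH; case: cH.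
move=> A [B [C [D [E [F [EH disc0 [/negbT A0 /negbT B0 eC] sg [h Eh]]]]]]].
rewrite !expr0 !mul1r in Eh; rewrite EH in sg Eh.
have [mu Hmu] := square_class A0 B0 disc0 Eh sg.
have hH : H \is 2.-homog by rewrite EH quad_homog.
case: Hmu => [] [C0 Emu]; rewrite -EH in Eh; rewrite -eC.
- constructor 1; rewrite C0 eqxx; split=> //.
  by apply: (contact_same (quad_homog _ _ _ _ _ _) pbE1 H0 hH); rewrite /pb Eh Emu.
- constructor 2; rewrite C0 eqxx; split=> //.
  by apply: (contact_same (quad_homog _ _ _ _ _ _) pbE2 H0 hH); rewrite /pb Eh Emu.
- constructor 3; rewrite C0 eqxx; split=> //.
  by apply: (contact_same (quad_homog _ _ _ _ _ _) pbE3 H0 hH); rewrite /pb Eh Emu.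
- constructor 4; split=> //.
  by apply: (contact_same (quad_homog _ _ _ _ _ _) pbE4 H0 hH); rewrite /pb Eh Emu.
Qed.

Let cond1 : contact false false true cusp_conic1 -> b * m * beta != 0.
Proof.
move/contact_quad_disc; apply: contraNneq => E.
rewrite (_ : disc_quad _ _ _ _ _ _ = - 16 * b * c ^+ 2 * d ^+ 2 * (b * m * beta)).
  by rewrite E mulr0.
by rewrite /disc_quad /beta /bitangency /m /Dv /k /b; ring.
Qed.

Let cond2 : contact false false true cusp_conic2 -> a * m * beta != 0.
Proof.
move/contact_quad_disc; apply: contraNneq => E.
rewrite (_ : disc_quad _ _ _ _ _ _ = - 16 * a * c ^+ 2 * d ^+ 2 * (a * m * beta)).
  by rewrite E mulr0.
by rewrite /disc_quad /beta /bitangency /m /Du /k /b; ring.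
Qed.

Let cond3 : contact false false true cusp_conic3 -> a * b * m != 0.
Proof.
move/contact_quad_disc; apply: contraNneq => E.
rewrite (_ : disc_quad _ _ _ _ _ _ = - 16 * c ^+ 2 * d ^+ 2 * (a * b * m) ^+ 2).
  by rewrite E expr0n mulr0.
by rewrite /disc_quad /m /Du /Dv /b; ring.
Qed.

Let cond4 : contact false false false free_conic -> m * beta != 0.
Proof.
move/contact_quad_disc; apply: contraNneq => E.
rewrite (_ : disc_quad _ _ _ _ _ _ =
  - 16 * c ^+ 2 * d ^+ 2 * m ^+ 2 * (res_uv a c d) ^+ 2 * (m * beta)).
  by rewrite E mulr0.
by rewrite /disc_quad /beta /bitangency /res_uv /m /Du /Dv /k /b; ring.
Qed.

Lemma count_free_conics :
  number_up_to_scaling (contact false false false) (m * beta != 0).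
Proof.
apply: (@count_one_if _ _ _ free_conic); first exact: free_conic_contact.
move=> H cH; have [[]//|[]//|[]//|[_ SH]] := contact_class cH.
by split=> //; apply: cond4; apply: contact_quad_proportional SH cH.
Qed.

Let neq12 : b * m * beta != 0 -> proportional cusp_conic1 cusp_conic2 -> False.
Proof.
rewrite !mulf_eq0 !negb_or -andbA => /and3P [b0 m0 be0] [l l0].
rewrite quadZ => /quad_inj [[EA EB _] [ED EE _]].
have four0 : 4 != 0 :> K by rewrite (_ : 4 = 2 * 2) ?mulf_neq0 // -natrM.
have ld2 : l * d ^+ 2 = c ^+ 2.
  apply: (mulfI four0); transitivity (l * (4 * d ^+ 2 - 4 * b * c * d) + l * (4 * b * c * d)).
    by ring.
  by rewrite -ED -EE; ring.
have lb2 : l * b ^+ 2 = Du.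
  by apply: (mulfI (expf_neq0 2 c0)); rewrite EA; ring.
have lDv : l * Dv = a ^+ 2.
  by apply: (mulIf (expf_neq0 2 d0)); rewrite EB; ring.
have ldc : l * d = - c.
  apply: (mulfI four0); transitivity (l * b ^+ 2 - l * Dv); first by rewrite /Dv; ring.
  by rewrite lb2 lDv /Du; ring.
have dc : d = - c.
  apply: (mulIf c0); apply: oppr_inj; transitivity (l * d * d); first by rewrite ldc; ring.
  by rewrite -mulrA -expr2 ld2; ring.
have l1 : l = 1 by apply: (mulIf d0); rewrite ldc dc mul1r.
case/eqP: R0; rewrite /res_uv dc; transitivity (c * (4 * c - 2 * a + 1)); first by ring.
apply/eqP; rewrite mulf_eq0 (negbTE c0) /=; apply/eqP.
transitivity (l * b ^+ 2 - Du); first by rewrite l1 /b /Du; ring.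
by rewrite lb2 subrr.
Qed.

Let neq13 : b != 0 -> a != 0 -> proportional cusp_conic1 cusp_conic3 -> False.
Proof.
move=> b0 a0 [l l0]; rewrite quadZ => /quad_inj [[EA EB _] _].
have lDu : l = Du.
  by apply: (mulIf (mulf_neq0 (expf_neq0 2 b0) (expf_neq0 2 c0))); rewrite -EA; ring.
have la : l = a ^+ 2.
  by apply: (mulIf (mulf_neq0 (expf_neq0 2 d0) Dv0)); rewrite -EB; ring.
have four0 : 4 != 0 :> K by rewrite (_ : 4 = 2 * 2) ?mulf_neq0 // -natrM.
case/eqP: c0; apply: (mulfI four0); transitivity (l - Du); last by rewrite lDu subrr mulr0.
by rewrite la /Du; ring.
Qed.

Let neq23 : a != 0 -> proportional cusp_conic2 cusp_conic3 -> False.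
Proof.
move=> a0 [l l0]; rewrite quadZ => /quad_inj [[EA EB _] _].
have lb : l = b ^+ 2.
  by apply: (mulIf (mulf_neq0 (expf_neq0 2 c0) Du0)); rewrite -EA; ring.
have lDv : l = Dv.
  by apply: (mulIf (mulf_neq0 (expf_neq0 2 a0) (expf_neq0 2 d0))); rewrite -EB; ring.
have four0 : 4 != 0 :> K by rewrite (_ : 4 = 2 * 2) ?mulf_neq0 // -natrM.
case/eqP: d0; apply: (mulfI four0); transitivity (l - Dv); last by rewrite lDv subrr mulr0.
by rewrite lb /Dv; ring.
Qed.

Lemma count_cusp_conics : number_up_to_scaling (contact false false true)
  ((b * m * beta != 0) + (a * m * beta != 0) + (a * b * m != 0)).
Proof.
pose P1 H := b * m * beta != 0 /\ proportional cusp_conic1 H.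
pose P2 H := a * m * beta != 0 /\ proportional cusp_conic2 H.
pose P3 H := a * b * m != 0 /\ proportional cusp_conic3 H.
have one (S : {mpoly K[3]}) (cnd : bool) :
    number_up_to_scaling (fun H => cnd /\ proportional S H) cnd.
  by apply: (@count_one_if _ _ _ S) => // cc; split=> //; apply: proportional_refl.
have chain (S S' G G' : {mpoly K[3]}) : proportional S G -> proportional S' G' ->
    proportional G G' -> proportional S S'.
  move=> SG SG' GG'.
  exact: proportional_trans (proportional_trans SG GG') (proportional_sym SG').
apply: (@count_add _ _ _ (fun H => P1 H \/ P2 H) P3); last exact: one.
- move=> H; split.
    move=> cH; have [[_ SH]|[_ SH]|[_ SH]|[]//] := contact_class cH.
    + by left; left; split=> //; apply/cond1/contact_quad_proportional/cH.
    + by left; right; split=> //; apply/cond2/contact_quad_proportional/cH.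
    + by right; split=> //; apply/cond3/contact_quad_proportional/cH.
  case=> [[]|] [cnd /proportional_sym SH]; apply: contact_quad_proportional SH _.
  + exact: cusp_conic1_contact.
  + exact: cusp_conic2_contact.
  + exact: cusp_conic3_contact.
- move=> H H' [] [] c1 SH [c2 SH'] /(chain _ _ _ _ SH SH').
    move: c1 c2; rewrite !mulf_eq0 !negb_or -!andbA => /and3P [b0 _ _] /and3P [a0 _ _].
    exact: neq13.
  by move: c1; rewrite !mulf_eq0 !negb_or -!andbA => /and3P [a0 _ _]; apply: neq23.
apply: (@count_add _ _ _ P1 P2) => //; try exact: one.
by move=> H H' [c1 SH] [c2 SH'] /(chain _ _ _ _ SH SH'); apply: neq12.
Qed.

End ConicsMissingTheNodes.

Section ConicsThroughTheNodes.

Variables (K : closedFieldType) (a c d : K).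

Let b := a - 1.
Let k := c - d.
Let m := a * d - b * c.
Let beta := bitangency a c d.
Let u := uu a c.
Let v := vv a d.
Let pb := pullback a c d.
Let Du := a ^+ 2 - 4 * c.
Let Dv := b ^+ 2 - 4 * d.

Hypotheses (two0 : 2 != 0 :> K).
Hypotheses (c0 : c != 0) (d0 : d != 0) (R0 : res_uv a c d != 0).
Hypotheses (Du0 : Du != 0) (Dv0 : Dv != 0).

Let contact := contact_quad a c d.

Let size_u : size u = 3%N. Proof. exact: size_unit_quad. Qed.
Let size_v : size v = 3%N. Proof. exact: size_unit_quad. Qed.
Let u0 : u != 0. Proof. by rewrite -size_poly_gt0 size_u. Qed.
Let v0 : v != 0. Proof. by rewrite -size_poly_gt0 size_v. Qed.

Definition nodes_conic : {mpoly K[3]} := quad 0 0 4 (- 4 * d - b) (a - 4 * c) (- beta).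
Definition triple_conic : {mpoly K[3]} := quad 0 0 0 (- b) a (- m).

Let pb_nodes : pb nodes_conic = u * v * (2 + (a + b)%:P * 'X) ^+ 2.
Proof.
rewrite /pb /nodes_conic pullback_quad /u /v /uu /vv /unit_quad /beta /bitangency -/b.
by rewrite !(polyCM, polyCB, polyCN, polyC_exp, polyCD) /b !(polyCB, polyC1); ring.
Qed.

Let pb_triple : pb triple_conic = u * v * 'X ^+ 2.
Proof.
rewrite /pb /triple_conic pullback_quad /u /v /uu /vv /unit_quad /m -/b.
by rewrite !(polyCM, polyCB, polyCN, polyC_exp, polyCD) /b !(polyCB, polyC1); ring.
Qed.

Lemma nodes_conic_contact : a * b * beta != 0 -> contact true true false nodes_conic.
Proof.
move=> abb; apply: (@contact_quad_intro _ a c d _ _ _ _ _ _ _ _ _ (2 + (a + b)%:P * 'X)).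
- rewrite (_ : disc_quad _ _ _ _ _ _ = a * b * beta) //.
  by rewrite /disc_quad /beta /bitangency /b; ring.
- by rewrite eqxx.
- by rewrite eqxx.
- by apply/negbTE; rewrite (_ : 4 = 2 * 2) ?mulf_neq0 // -natrM.
- rewrite size_pullback_quad; apply/andP; split; apply/eqP;
    by rewrite /quad_coef /= /beta /bitangency /b; ring.
- by rewrite -/pb pb_nodes !expr1.
Qed.

Lemma triple_conic_contact : a * b * m != 0 -> contact true true true triple_conic.
Proof.
move=> abm; apply: (@contact_quad_intro _ a c d _ _ _ _ _ _ _ _ _ 'X).
- rewrite (_ : disc_quad _ _ _ _ _ _ = a * b * m) //.
  by rewrite /disc_quad /m /b; ring.
- by rewrite eqxx.
- by rewrite eqxx.
- by rewrite eqxx.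
- rewrite size_pullback_quad; apply/andP; split; apply/eqP;
    by rewrite /quad_coef /= /m /b; ring.
- by rewrite -/pb pb_triple !expr1.
Qed.

Let both_class e3 H : contact true true e3 H ->
  proportional (if e3 then triple_conic else nodes_conic) H.
Proof.
move=> cH; have H0 := contact_quad_neq0 cH; case: cH.
move=> A [B [C [D [E [F [EH disc0 [/eqP A0 /eqP B0 eC] sg [h Eh]]]]]]].
have hH : H \is 2.-homog by rewrite EH quad_homog.
rewrite !expr1 in Eh.
have sh : (size h <= 2)%N.
  have [->|hn0] := eqVneq h 0; first by rewrite size_poly0.
  have h2 : h * h != 0 by rewrite mulf_neq0.
  have uv0 : u * v != 0 by rewrite mulf_neq0.
  have : size (u * v * (h * h)) = (size (u * v) + size (h * h)).-1 by apply: size_mul.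
  rewrite [size (h * h)]size_mul // [size (u * v)]size_mul // size_u size_v.
  by rewrite -expr2 -Eh; move: sg; clear; slia.
pose x := h`_0; pose y := h`_1.
have hE : h = x%:P + y%:P * 'X.
  apply/polyP => -[|[|i]]; rewrite !coefE /= ?(mulr0, mulr1, addr0, add0r) //.
  by rewrite nth_default // (leq_trans sh).
have E2 : h ^+ 2 = C%:P * (u * v) + D%:P * ('X^2 * u) + E%:P * ('X^2 * v) + F%:P * 'X^4.
  apply: (mulfI (mulf_neq0 u0 v0)); rewrite -Eh EH /pb pullback_quad A0 B0 polyC0 -/u -/v.
  by ring.
have [xx xy] : x ^+ 2 = C /\ 2 * (x * y) = C * (a + b).
  have : h ^+ 2 = Poly [:: x ^+ 2; 2 * (x * y); y ^+ 2].
    by rewrite hE /= !cons_poly_def !(polyCM, polyC_exp); ring.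
  rewrite E2 (_ : _ + _ = Poly [:: C; C * (a + b); C * (a * b + c + d) + D + E;
    C * (a * d + b * c) + D * a + E * b; C * (c * d) + D * c + E * d + F]).
    move=> EP; split.
      by have := congr1 (fun g : {poly K} => g`_0) EP; rewrite !coef_Poly.
    by have := congr1 (fun g : {poly K} => g`_1) EP; rewrite !coef_Poly.
  rewrite /u /v /uu /vv /unit_quad -/b /= !cons_poly_def.
  by rewrite !(polyCM, polyCD); ring.
have same S (g : {poly K}) mu : S \is 2.-homog -> pb S = u * v * g ^+ 2 -> h = mu%:P * g ->
    proportional S H.
  move=> hS ES Emu; apply: (@contact_quad_unique _ a c d c0 d0 R0 Du0 Dv0 (u * v) mu g) => //.
  by rewrite Eh Emu.
rewrite -eC; have [C_0|Cn0] := eqVneq C 0.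
  apply: (same _ 'X y) => //; first exact: quad_homog.
  move/eqP: xx; rewrite C_0 expf_eq0 /= => /eqP x_0.
  by rewrite hE x_0 add0r.
have xn0 : x != 0 by apply: contraNneq Cn0 => x_0; rewrite -xx x_0 expr0n.
apply: (same _ (2 + (a + b)%:P * 'X) (x / 2)) => //; first exact: quad_homog.
have y_E : y = x / 2 * (a + b).
  apply: (mulfI (mulf_neq0 two0 xn0)); rewrite -mulrA xy -xx; field.
  exact: two0.
have Ex : x = x / 2 * 2 by rewrite divfK.
rewrite hE y_E; move: (x / 2) Ex => e ->; rewrite !polyCM; ring.
Qed.

Lemma count_nodes_conics :
  number_up_to_scaling (contact true true false) (a * b * beta != 0).
Proof.
apply: (@count_one_if _ _ _ nodes_conic); first exact: nodes_conic_contact.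
move=> H cH; have SH := both_class cH; split=> //.
move/contact_quad_disc: (contact_quad_proportional SH cH); apply: contraNneq => E.
rewrite (_ : disc_quad _ _ _ _ _ _ = a * b * beta); first by rewrite E.
by rewrite /disc_quad /beta /bitangency /b; ring.
Qed.

Lemma count_triple_conics :
  number_up_to_scaling (contact true true true) (a * b * m != 0).
Proof.
apply: (@count_one_if _ _ _ triple_conic); first exact: triple_conic_contact.
move=> H cH; have SH := both_class cH; split=> //.
move/contact_quad_disc: (contact_quad_proportional SH cH); apply: contraNneq => E.
rewrite (_ : disc_quad _ _ _ _ _ _ = a * b * m); first by rewrite E.
by rewrite /disc_quad /m /b; ring.
Qed.

End ConicsThroughTheNodes.

Section ConicsThroughOneNode.

Variables (K : closedFieldType) (a c d : K).

Let b := a - 1.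
Let k := c - d.
Let m := a * d - b * c.
Let beta := bitangency a c d.
Let u := uu a c.
Let v := vv a d.
Let pb := pullback a c d.
Let Du := a ^+ 2 - 4 * c.
Let Dv := b ^+ 2 - 4 * d.

Hypotheses (two0 : 2 != 0 :> K).
Hypotheses (c0 : c != 0) (d0 : d != 0) (R0 : res_uv a c d != 0).
Hypotheses (Du0 : Du != 0) (Dv0 : Dv != 0).

Let contact := contact_quad a c d.

Let size_u : size u = 3%N. Proof. exact: size_unit_quad. Qed.
Let size_v : size v = 3%N. Proof. exact: size_unit_quad. Qed.
Let u0 : u != 0. Proof. by rewrite -size_poly_gt0 size_u. Qed.
Let v0 : v != 0. Proof. by rewrite -size_poly_gt0 size_v. Qed.
Let four0 : 4 != 0 :> K. Proof. by rewrite (_ : 4 = 2 * 2) ?mulf_neq0 // -natrM. Qed.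

(** (x + y t)^2 = u + X v, so that x + y t is a square root of u modulo v. *)
Definition sqrt_mod X x y :=
  [/\ x ^+ 2 = 1 + X, y ^+ 2 = c + X * d & 2 * (x * y) = a + X * b].

Let rho (x y : K) : {poly K} := x%:P + y%:P * 'X.

Let sqrt_modE X x y : sqrt_mod X x y -> rho x y ^+ 2 = u + X%:P * v.
Proof.
case=> xx yy xy.
transitivity ((x ^+ 2)%:P + (2 * (x * y))%:P * 'X + (y ^+ 2)%:P * 'X^2).
  by rewrite /rho !(polyCM, polyC_exp); ring.
rewrite xx yy xy /u /v /uu /vv /unit_quad -/b !(polyCM, polyCD); ring.
Qed.

Let sqrt_mod_unit X x y : sqrt_mod X x y -> x * (2 * y - x * b) = 1.
Proof.
case=> xx yy xy; transitivity (2 * (x * y) - x ^+ 2 * b); first by ring.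
by rewrite xx xy /b; ring.
Qed.

Definition node_conic X x y : {mpoly K[3]} :=
  quad 0 (a ^+ 2 * d ^+ 2) (4 * y ^+ 2) (- 2 * a * d * y * (2 * x + (2 * y - a * x)))
    (y ^+ 2 * Du + 2 * a * d * y * (2 * y - a * x))
    (a ^+ 2 * d ^+ 2 * X - 2 * a * d * y * (- (2 * y - a * x) * k + (a * y - 2 * x * c))).

Definition node_cusp_conic X x y : {mpoly K[3]} :=
  quad 0 (d ^+ 2) 0 (- 2 * d * y * x) (y ^+ 2 + 2 * d * y * x)
    (d ^+ 2 * X - 2 * d * y * (- x * k + y)).

Let h5 x y : {poly K} := - (a * d)%:P * 'X^2 * rho x y + y%:P * (2 + a%:P * 'X) * v.
Let h6 x y : {poly K} := 'X * (d%:P * 'X * rho x y - y%:P * v).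

Let pbE5 X x y : sqrt_mod X x y -> pb (node_conic X x y) = u * h5 x y ^+ 2.
Proof.
move=> sq; transitivity (u * h5 x y ^+ 2
  - (a ^+ 2 * d ^+ 2)%:P * u * 'X^4 * (rho x y ^+ 2 - (u + X%:P * v))).
  rewrite /pb /node_conic pullback_quad /h5 /rho /u /v /uu /vv /unit_quad /Du /k -/b.
  by rewrite !(polyCM, polyCB, polyCN, polyC_exp, polyCD) /b !(polyCB, polyC1); ring.
by rewrite (sqrt_modE sq) subrr mulr0 subr0.
Qed.

Let pbE6 X x y : sqrt_mod X x y -> pb (node_cusp_conic X x y) = u * h6 x y ^+ 2.
Proof.
move=> sq; transitivity (u * h6 x y ^+ 2
  - (d ^+ 2)%:P * u * 'X^4 * (rho x y ^+ 2 - (u + X%:P * v))).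
  rewrite /pb /node_cusp_conic pullback_quad /h6 /rho /u /v /uu /vv /unit_quad /k -/b.
  by rewrite !(polyCM, polyCB, polyCN, polyC_exp, polyCD) /b !(polyCB, polyC1); ring.
by rewrite (sqrt_modE sq) subrr mulr0 subr0.
Qed.

Let size_u_sqr (h : {poly K}) : ((size (u * h ^+ 2)%R <= 7) = (size h <= 3))%N.
Proof.
have [->|hn0] := eqVneq h 0; first by rewrite expr0n mulr0 size_poly0.
have h2 : h * h != 0 by rewrite mulf_neq0.
have -> : size (u * h ^+ 2) = (size u + (size h + size h).-1).-1.
  have <- : size (h * h) = (size h + size h).-1 by apply: size_mul.
  by rewrite expr2; apply: size_mul.
by rewrite size_u; clear; slia.
Qed.

Let size_h5 x y : (size (h5 x y) <= 3)%N.
Proof.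
rewrite (_ : h5 x y = Poly [:: 2 * y; y * (2 * b + a); - (a * d) * x + y * (2 * d + a * b)]).
  exact: size_Poly.
rewrite /h5 /rho /v /vv /unit_quad -/b /= !cons_poly_def.
by rewrite !(polyCM, polyCD, polyCN); ring.
Qed.

Let size_h6 x y : (size (h6 x y) <= 3)%N.
Proof.
rewrite (_ : h6 x y = Poly [:: 0; - y; d * x - y * b]); first exact: size_Poly.
rewrite /h6 /rho /v /vv /unit_quad -/b /= !cons_poly_def.
by rewrite !(polyCM, polyCD, polyCN, polyC0); ring.
Qed.

Let f1 X := a * b + X * Dv.
Let f2 X := a * b + X * Dv - 4 * c - 4 * d.

(* The condition on x and y rationally parametrises the coefficients. *)
Let sqrt_mod_param X x y : sqrt_mod X x y -> exists2 f, f != 0 &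
  [/\ x = f^-1, a = 1 + f * (2 * y - f), X = f^-1 ^+ 2 - 1 & c = y ^+ 2 - (f^-1 ^+ 2 - 1) * d].
Proof.
move=> sq; have x1 := sqrt_mod_unit sq; case: sq => xx yy xy.
have x0 : x != 0 by apply/negP => /eqP x_0; move/eqP: x1; rewrite x_0 mul0r eq_sym oner_eq0.
exists x^-1; rewrite ?invr_neq0 // invrK xx.
have Ef : x^-1 = 2 * y - x * b by apply: (mulfI x0); rewrite mulfV.
split=> //; last 2 first.
- by ring.
- by rewrite yy; ring.
have Eb : b = x^-1 * (2 * y - x^-1) by rewrite [in X in _ * X]Ef; field.
by rewrite -Eb /b; ring.
Qed.

Let disc5 X x y : sqrt_mod X x y ->
  2 * x ^+ 5 * disc_quad 0 (a ^+ 2 * d ^+ 2) (4 * y ^+ 2)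
    (- 2 * a * d * y * (2 * x + (2 * y - a * x)))
    (y ^+ 2 * Du + 2 * a * d * y * (2 * y - a * x))
    (a ^+ 2 * d ^+ 2 * X - 2 * a * d * y * (- (2 * y - a * x) * k + (a * y - 2 * x * c))) =
  - y ^+ 3 * a ^+ 2 * b * d ^+ 2 * X ^+ 4 * f1 X.
Proof.
case/sqrt_mod_param => f fn0 [-> Ea -> Ec]; rewrite /disc_quad /f1 /Du /Dv /k /b Ea Ec; field.
exact: fn0.
Qed.

Let disc6 X x y : sqrt_mod X x y ->
  2 * disc_quad 0 (d ^+ 2) 0 (- 2 * d * y * x) (y ^+ 2 + 2 * d * y * x)
    (d ^+ 2 * X - 2 * d * y * (- x * k + y)) =
  - x ^+ 5 * y * m * b * d ^+ 2 * f2 X.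
Proof.
case/sqrt_mod_param => f fn0 [-> Ea -> Ec]; rewrite /disc_quad /f2 /m /Dv /k /b Ea Ec; field.
exact: fn0.
Qed.

Let y_neq0 X x y : sqrt_mod X x y -> (c + X * d != 0) = (y != 0).
Proof. by case=> _ <- _; rewrite expf_eq0. Qed.

Let m_factor X x y : sqrt_mod X x y -> m = y * (2 * x * d - y * b).
Proof.
move=> sq; have [xx yy xy] := sq; rewrite /m.
transitivity (a * d - b * c + 0); first by rewrite addr0.
transitivity (2 * (x * y) * d - y ^+ 2 * b); first by rewrite xy yy; ring.
ring.
Qed.

Let disc_neq0_l (x y z : K) : x * y = z -> z != 0 -> y != 0.
Proof. by move=> <-; rewrite mulf_eq0 negb_or => /andP []. Qed.

Lemma node_conic_contact X x y : sqrt_mod X x y -> X != 0 ->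
  a * b * (c + X * d) * f1 X != 0 -> contact true false false (node_conic X x y).
Proof.
move=> sq X0; rewrite !mulf_eq0 !negb_or (y_neq0 sq) -!andbA => /and4P [a0 b0 y0 f0].
apply: (@contact_quad_intro _ a c d _ _ _ _ _ _ _ _ _ (h5 x y)).
- by apply: disc_neq0_l (disc5 sq) _; rewrite !mulf_neq0 ?expf_neq0 ?oppr_eq0 ?expf_neq0.
- by rewrite eqxx.
- by apply/negbTE; rewrite mulf_neq0 ?expf_neq0.
- by apply/negbTE; rewrite mulf_neq0 ?expf_neq0.
- by rewrite -/pb -/(node_conic X x y) pbE5 // size_u_sqr size_h5.
- by rewrite -/pb -/(node_conic X x y) pbE5 // expr1 expr0 mulr1.
Qed.

Lemma node_cusp_conic_contact X x y : sqrt_mod X x y ->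
  b * m * f2 X != 0 -> contact true false true (node_cusp_conic X x y).
Proof.
move=> sq; rewrite !mulf_eq0 !negb_or -!andbA => /and3P [b0 m0 f0].
have y0 : y != 0 by apply: contraNneq m0 => y_0; rewrite (m_factor sq) y_0 mul0r.
have x0 : x != 0.
  apply/negP => /eqP x_0; have /eqP := sqrt_mod_unit sq.
  by rewrite x_0 mul0r eq_sym oner_eq0.
apply: (@contact_quad_intro _ a c d _ _ _ _ _ _ _ _ _ (h6 x y)).
- by apply: disc_neq0_l (disc6 sq) _; rewrite !mulf_neq0 ?expf_neq0 ?oppr_eq0 ?expf_neq0.
- by rewrite eqxx.
- by apply/negbTE; rewrite expf_neq0.
- by rewrite eqxx.
- by rewrite -/pb -/(node_cusp_conic X x y) pbE6 // size_u_sqr size_h6.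
- by rewrite -/pb -/(node_cusp_conic X x y) pbE6 // expr1 expr0 mulr1.
Qed.

Lemma sqrt_mod_roots : exists X1 x1 y1 X2 x2 y2,
  [/\ sqrt_mod X1 x1 y1, sqrt_mod X2 x2 y2, X1 != X2,
    (Dv * (X1 + X2) = 4 * c + 4 * d - 2 * a * b) * (Dv * (X1 * X2) = Du)
    & forall X x y, sqrt_mod X x y -> (X == X1) || (X == X2)].
Proof.
pose a' := (2 * a * b - 4 * c - 4 * d) / Du; pose c' := Dv / Du.
have PE X : 4 * (1 + X) * (c + X * d) - (a + X * b) ^+ 2 = - Du * (unit_quad a' c').[X].
  by rewrite unit_quadE /a' /c' /Dv /Du; field; exact: Du0.
have [||X1 [X2 [X12 Ea Ec Pfac]]] := @unit_quad_roots K a' c'.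
- by rewrite mulf_neq0 ?invr_neq0.
- rewrite (_ : _ - _ = 16 * res_uv a c d / Du ^+ 2).
    rewrite !mulf_neq0 ?invr_neq0 ?expf_neq0 // (_ : 16 = 2 ^+ 4) ?expf_neq0 //.
    by rewrite -natrX.
  by rewrite /a' /c' /res_uv /Dv /Du /b; field; exact: Du0.
have rootE X : 4 * (1 + X) * (c + X * d) = (a + X * b) ^+ 2 <-> (X == X1) || (X == X2).
  rewrite -[in X in _ <-> X]root_XsubC -[X in _ || X]root_XsubC -rootM.
  rewrite -(@rootZ _ _ c') ?mulf_neq0 ?invr_neq0 // -mul_polyC -Pfac rootE.
  split=> [E|/eqP E]; last by apply/eqP; rewrite -subr_eq0 PE E mulr0.
  move/eqP: (PE X); rewrite E subrr eq_sym mulf_eq0 oppr_eq0.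
  by rewrite -/Du (negbTE Du0).
have ex X : (X == X1) || (X == X2) -> exists x y, sqrt_mod X x y.
  move/rootE => E; have [x x2] := poly_sqrt_const (1 + X).
  have x0 : x != 0.
    apply/negP => /eqP x_0; move: E; rewrite -x2 x_0 expr0n mulr0 mul0r.
    have -> : X = -1 by apply/eqP; rewrite -subr_eq0 opprK addrC -x2 x_0 expr0n.
    move/eqP; rewrite (_ : a + _ = 1); last by rewrite /b; ring.
    by rewrite expr1n eq_sym oner_eq0.
  exists x, ((a + X * b) / (2 * x)); split=> //; last first.
    by field; rewrite x0 two0.
  rewrite expr_div_n exprMn x2 -E; field.
  by rewrite four0 -x2 expf_neq0.
have [x1 [y1 sq1]] := ex X1 (introT orP (or_introl (eqxx _))).
have [x2 [y2 sq2]] := ex X2 (introT orP (or_intror (eqxx _))).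
exists X1, x1, y1, X2, x2, y2; split=> //.
  split; last first.
    transitivity (Du * (c' * (X1 * X2))); last by rewrite Ec mulr1.
    by rewrite /c'; field; exact: Du0.
  transitivity (- Du * a'); last by rewrite /a'; field; exact: Du0.
  by rewrite Ea /c'; field; exact: Du0.
move=> X x y [xx yy xy]; apply/rootE; rewrite -xx -yy -xy; ring.
Qed.

Let quot_v n (f : {poly K}) : (forall r, root v r -> f.[r] = 0) -> (size f <= n.+2)%N ->
  exists2 g : {poly K}, (size g <= n)%N & f = g * v.
Proof.
move=> fz sf; have /dvdpP [g Eg] := dvd_roots d0 Dv0 fz; exists g => //.
have [->|g0] := eqVneq g 0; first by rewrite size_poly0.
have : size f = (size g + size v).-1 by rewrite Eg; apply: size_mul.
by rewrite size_v; move: sf; clear; slia.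
Qed.

Let root_u_mod A B C D E F (h : {poly K}) r : pb (quad A B C D E F) = u * h ^+ 2 -> root v r ->
  h.[r] ^+ 2 = B * (r ^+ 2) ^+ 2 * u.[r].
Proof.
move=> Eh vr; have ur : u.[r] != 0.
  apply/negP => ur; have := coprime_uv R0.
  by move/Pdiv.ClosedField.coprimepP => /(_ r ur); rewrite (eqP vr) eqxx.
apply: (mulfI ur); rewrite -horner_exp -hornerM -Eh.
by rewrite (@pb_at_v _ a c d) //; ring.
Qed.

Let one_class e3 H : contact true false e3 H -> exists X x y,
  sqrt_mod X x y /\ proportional (if e3 then node_cusp_conic X x y else node_conic X x y) H.
Proof.
move=> cH; have H0 := contact_quad_neq0 cH; case: cH.
move=> A [B [C [D [E [F [EH disc0 [/eqP A0 /negbT B0 eC] sg [h Eh]]]]]]].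
have hH : H \is 2.-homog by rewrite EH quad_homog.
rewrite expr1 expr0 mulr1 in Eh.
have sh : (size h <= 3)%N by rewrite -size_u_sqr -Eh.
have Eq : pb (quad A B C D E F) = u * h ^+ 2 by rewrite -EH.
have [r1 [r2 [r12 _ _ vE]]] := unit_quad_roots d0 Dv0.
have rv r : root v r = (r == r1) || (r == r2).
  by rewrite /v /vv -/b vE !rootM !root_XsubC rootC (negbTE d0).
have [q q2] := poly_sqrt_const B.
have q0 : q != 0 by apply: contraNneq B0 => q_0; rewrite -q2 q_0 expr0n.
have [x [y Er]] : exists x y, forall r, root v r -> h.[r] = q * r ^+ 2 * (x + y * r).
  pose e r := h.[r] / (q * r ^+ 2); pose y := (e r1 - e r2) / (r1 - r2).
  exists (e r1 - y * r1), y => r vr; have r_0 := unit_quad_root0 vr.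
  have -> : e r1 - y * r1 + y * r = e r.
    move: vr; rewrite rv => /orP [] /eqP ->; first by rewrite subrK.
    by rewrite /y; field; rewrite subr_eq0.
  by rewrite /e [RHS]mulrC divfK // mulf_neq0 ?expf_neq0.
have rho2 r : root v r -> (rho x y).[r] ^+ 2 = u.[r].
  move=> vr; apply: (mulfI (mulf_neq0 B0 (expf_neq0 2 (expf_neq0 2 (unit_quad_root0 vr))))).
  rewrite -(root_u_mod Eq vr) Er // /rho -q2 hornerD hornerM !hornerC hornerX; ring.
have rhoE : rho x y = Poly [:: x; y] by rewrite /rho /= !cons_poly_def; ring.
have uE : u = Poly [:: 1; a; c].
  by rewrite /u /uu /unit_quad /= !cons_poly_def polyC1; ring.
have [||g sgg Eg] := @quot_v 1 (rho x y ^+ 2 - u).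
- by move=> r vr; rewrite hornerD hornerN horner_exp rho2 // subrr.
- rewrite (leq_trans (size_polyD _ _)) // geq_max size_polyN size_u leqnn andbT.
  rewrite (_ : rho x y ^+ 2 = Poly [:: x ^+ 2; 2 * (x * y); y ^+ 2]); first exact: size_Poly.
  by rewrite /rho /= !cons_poly_def !(polyCM, polyC_exp); ring.
have [X gX] : exists X, g = X%:P by exists g`_0; apply: size1_polyC.
have sq : sqrt_mod X x y.
  have : Poly [:: x ^+ 2; 2 * (x * y); y ^+ 2] = Poly [:: 1 + X; a + X * b; c + X * d].
    transitivity (rho x y ^+ 2).
      by rewrite /rho /= !cons_poly_def !(polyCM, polyC_exp); ring.
    rewrite -[LHS](subrK u) Eg gX /u /v /uu /vv /unit_quad -/b /= !cons_poly_def.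
    by rewrite !(polyCM, polyCD, polyC1); ring.
  by move=> EP; split; [have := congr1 (fun f : {poly K} => f`_0) EP|
    have := congr1 (fun f : {poly K} => f`_2) EP|
    have := congr1 (fun f : {poly K} => f`_1) EP]; rewrite !coef_Poly.
exists X, x, y; split=> //.
have [||l sl El] := @quot_v 2 (h - q%:P * 'X^2 * rho x y).
- by move=> r vr; rewrite hornerD hornerN Er // /rho !hornerE /=; ring.
- rewrite (leq_trans (size_polyD _ _)) // geq_max size_polyN (leq_trans sh) //.
  rewrite (_ : _ * rho x y = Poly [:: 0; 0; q * x; q * y]); first exact: size_Poly.
  by rewrite /rho /= !cons_poly_def !(polyCM, polyC0); ring.
have {sl} [r [e lE]] : exists r e, l = r%:P + e%:P * 'X.
  exists l`_0, l`_1; apply/polyP => -[|[|i]];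
    rewrite !coefE /= ?(mulr0, mulr1, addr0, add0r) //.
  by rewrite nth_default // (leq_trans sl).
have hE : h = q%:P * 'X^2 * rho x y + (r%:P + e%:P * 'X) * v.
  by rewrite -[LHS](subrK (q%:P * 'X^2 * rho x y)) El lE addrC.
have hP : h = Poly [:: r; r * b + e; q * x + r * d + e * b; q * y + e * d].
  rewrite hE /rho /v /vv /unit_quad -/b /= !cons_poly_def.
  by rewrite !(polyCM, polyCD); ring.
have e3_0 : q * y + e * d = 0.
  have : h`_3 = 0 by rewrite nth_default.
  by rewrite hP coef_Poly.
have Cr : C = r ^+ 2.
  have := congr1 (fun f : {poly K} => f`_0) Eq.
  rewrite coef_pullback_quad expr2 !coef0M hP uE !coef_Poly /quad_coef /= A0 => Er0.
  transitivity (1 * (r * r)); [rewrite -Er0|]; ring.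
have re : r * (2 * e - r * a) = 0.
  have := congr1 (fun f : {poly K} => f`_1) Eq.
  rewrite coef_pullback_quad expr2 !coefM !big_ord_recl !big_ord0 /= coef0M.
  rewrite coefM !big_ord_recl !big_ord0 hP uE !coef_Poly /quad_coef /= A0 Cr -/b.
  move=> E1; transitivity (1 * (r * (r * b + e) + ((r * b + e) * r + 0)) + (a * (r * r) + 0)
   - r ^+ 2 * (2 * a + 2 * b)); first by ring.
  by rewrite -E1; ring.
have same S (g' : {poly K}) mu : S \is 2.-homog -> pb S = u * g' ^+ 2 -> h = mu%:P * g' ->
    proportional S H.
  move=> hS ES Emu; apply: (@contact_quad_unique _ a c d c0 d0 R0 Du0 Dv0 u mu g') => //.
  by rewrite Eh Emu.
rewrite -eC Cr expf_eq0 /=; have [r_0|rn0] := eqVneq r 0.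
  apply: (same _ (h6 x y) (q / d)); [exact: quad_homog|exact: pbE6|].
  have Ed : q = q / d * d by rewrite divfK.
  have Ee : e = - (q / d * y).
    apply: (mulIf d0); apply/eqP; rewrite -subr_eq0; apply/eqP; rewrite -[RHS]e3_0.
    by field; exact: d0.
  rewrite hE r_0 Ee /h6; move: (q / d) Ed => f ->; rewrite !(polyCM, polyCN, polyC0); ring.
have Ee : 2 * e = r * a.
  move/eqP: re; rewrite mulf_eq0 (negbTE rn0) subr_eq0 => /eqP //.
have y0 : y != 0.
  apply/negP => /eqP y_0; move/eqP: e3_0; rewrite y_0 mulr0 add0r mulf_eq0 (negbTE d0) orbF.
  move=> /eqP e0; move/esym/eqP: Ee; rewrite e0 mulr0 mulf_eq0 (negbTE rn0) /= => /eqP a_0.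
  have [_ _] := sq; rewrite y_0 a_0 /b a_0 !mulr0 !add0r mulrN1 => /esym/eqP.
  rewrite oppr_eq0 => /eqP X_0.
  have [_ + _] := sq; rewrite y_0 X_0 mul0r addr0 expr0n => /esym/eqP.
  by rewrite (negbTE c0).
apply: (same _ (h5 x y) (r / (2 * y))); [exact: quad_homog|exact: pbE5|].
have Er' : r = r / (2 * y) * (2 * y) by rewrite divfK // mulf_neq0.
have Ee' : e = r / (2 * y) * (y * a).
  by apply: (mulfI two0); rewrite Ee; field; rewrite y0 two0.
have Eq' : q = - (r / (2 * y) * (a * d)).
  apply: (mulIf y0); apply/eqP; rewrite -subr_eq0; apply/eqP; rewrite -[RHS]e3_0 Ee'.
  by field; rewrite y0 two0.
rewrite hE /h5 Ee' Eq'; move: (r / (2 * y)) Er' => f ->; rewrite !(polyCM, polyCN); ring.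
Qed.

Let sqrt_mod_sign X x y x' y' : sqrt_mod X x y -> sqrt_mod X x' y' ->
  (x' = x /\ y' = y) \/ (x' = - x /\ y' = - y).
Proof.
move=> sq sq'; have [xx _ xy] := sq; have [xx' _ xy'] := sq'.
have x0 : x != 0.
  by apply/negP => /eqP x_0; have /eqP := sqrt_mod_unit sq; rewrite x_0 mul0r eq_sym oner_eq0.
have : x' ^+ 2 == x ^+ 2 by rewrite xx xx'.
rewrite eqf_sqr => /orP [] /eqP Ex; [left|right]; split=> //.
  by apply: (mulfI x0); apply: (mulfI two0); rewrite xy -xy' Ex.
by apply: (mulfI x0); apply: (mulfI two0); rewrite mulrN mulrN xy -xy' Ex; ring.
Qed.

Let node_conic_sign X x y x' y' : sqrt_mod X x y -> sqrt_mod X x' y' ->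
  node_conic X x y = node_conic X x' y'.
Proof.
move=> sq /(sqrt_mod_sign sq) [[-> ->]//|[-> ->]].
by rewrite /node_conic; congr quad; ring.
Qed.

Let node_cusp_conic_sign X x y x' y' : sqrt_mod X x y -> sqrt_mod X x' y' ->
  node_cusp_conic X x y = node_cusp_conic X x' y'.
Proof.
move=> sq /(sqrt_mod_sign sq) [[-> ->]//|[-> ->]].
by rewrite /node_cusp_conic; congr quad; ring.
Qed.

Let cond5 X x y : sqrt_mod X x y -> contact true false false (node_conic X x y) ->
  a * b * (c + X * d) * f1 X != 0.
Proof.
move=> sq /contact_quad_disc; apply: contraNneq; have [_ <- _] := sq => E.
have x0 : x != 0.
  by apply/negP => /eqP x_0; have /eqP := sqrt_mod_unit sq; rewrite x_0 mul0r eq_sym oner_eq0.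
have /eqP := disc5 sq.
rewrite [X in _ == X](_ : _ = - y * a * d ^+ 2 * X ^+ 4 * (a * b * y ^+ 2 * f1 X)).
  by rewrite E mulr0 mulf_eq0 (negbTE (mulf_neq0 two0 (expf_neq0 5 x0))).
by ring.
Qed.

Let cond6 X x y : sqrt_mod X x y -> contact true false true (node_cusp_conic X x y) ->
  b * m * f2 X != 0.
Proof.
move=> sq /contact_quad_disc; apply: contraNneq => E.
have /eqP := disc6 sq.
rewrite [X in _ == X](_ : _ = - x ^+ 5 * y * d ^+ 2 * (b * m * f2 X)).
  by rewrite E mulr0 mulf_eq0 (negbTE two0).
by ring.
Qed.

Let node_conic_neq X x y X' x' y' : a * b * (c + X * d) * f1 X != 0 ->
  sqrt_mod X x y -> sqrt_mod X' x' y' ->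
  proportional (node_conic X x y) (node_conic X' x' y') -> X = X'.
Proof.
rewrite !mulf_eq0 !negb_or -!andbA => /and4P [a0 b0 _ _] [_ yy _] [_ yy' _] [l l0].
rewrite quadZ => /quad_inj [[_ EB EC] _].
have l1 : l = 1.
  apply: (mulIf (mulf_neq0 (expf_neq0 2 a0) (expf_neq0 2 d0))).
  by rewrite -EB mul1r.
move: EC; rewrite l1 mul1r => /(mulfI four0); rewrite yy yy' => /addrI /(mulIf d0) ->.
by [].
Qed.

Let node_cusp_conic_neq X x y X' x' y' : b * m * f2 X != 0 ->
  sqrt_mod X x y -> sqrt_mod X' x' y' ->
  proportional (node_cusp_conic X x y) (node_cusp_conic X' x' y') -> X = X'.
Proof.
rewrite !mulf_eq0 !negb_or -!andbA => /and3P [b0 _ _] [_ _ xy] [_ _ xy'] [l l0].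
rewrite quadZ => /quad_inj [[_ EB _] [ED _ _]].
have l1 : l = 1 by apply: (mulIf (expf_neq0 2 d0)); rewrite -EB mul1r.
have : 2 * (x * y) = 2 * (x' * y').
  apply: (mulfI d0); apply: oppr_inj; transitivity (- 2 * d * y * x); first by ring.
  transitivity (- 2 * d * y' * x'); last by ring.
  by rewrite ED l1 mul1r.
by rewrite xy xy' => /addrI /(mulIf b0).
Qed.

(** The conics with even contact through the first node. *)
Lemma count_one_node_conics : exists X1 X2,
  [/\ X1 != X2, Dv * (X1 + X2) = 4 * c + 4 * d - 2 * a * b, Dv * (X1 * X2) = Du,
    number_up_to_scaling (contact true false false)
      ((a * b * (c + X1 * d) * f1 X1 != 0) + (a * b * (c + X2 * d) * f1 X2 != 0))
  & number_up_to_scaling (contact true false true)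
      ((b * m * f2 X1 != 0) + (b * m * f2 X2 != 0))].
Proof.
have [X1 [x1 [y1 [X2 [x2 [y2 [sq1 sq2 X12 [VS VP] all_roots]]]]]]] := sqrt_mod_roots.
have [X10 X20] : X1 != 0 /\ X2 != 0.
  apply/andP; rewrite -negb_or -mulf_eq0; apply: contraNneq Du0 => X0.
  by rewrite -VP X0 mulr0.
have one (S : {mpoly K[3]}) (cnd : bool) :
    number_up_to_scaling (fun H => cnd /\ proportional S H) cnd.
  by apply: (@count_one_if _ _ _ S) => // cc; split=> //; apply: proportional_refl.
have chain (S S' G G' : {mpoly K[3]}) : proportional S G -> proportional S' G' ->
    proportional G G' -> proportional S S'.
  move=> SG SG' GG'.
  exact: proportional_trans (proportional_trans SG GG') (proportional_sym SG').
exists X1, X2; split=> //.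
- apply: (count_add _ _ (one (node_conic X1 x1 y1) _) (one (node_conic X2 x2 y2) _)).
    move=> H; split.
      move=> cH; have [X [x [y [sq /= SH]]]] := one_class cH.
      case/orP: (all_roots _ _ _ sq) => /eqP EX; subst X; [left|right].
        rewrite (node_conic_sign sq sq1) in SH.
        by split=> //; apply: (cond5 sq1); apply: contact_quad_proportional SH cH.
      rewrite (node_conic_sign sq sq2) in SH.
      by split=> //; apply: (cond5 sq2); apply: contact_quad_proportional SH cH.
    case=> [] [cnd /proportional_sym SH]; apply: contact_quad_proportional SH _.
      exact: node_conic_contact.
    exact: node_conic_contact.
  move=> H H' [c1 SH] [c2 SH'] /(chain _ _ _ _ SH SH') /(node_conic_neq c1 sq1 sq2) /eqP.
  by rewrite (negbTE X12).
- apply: (count_add _ _ (one (node_cusp_conic X1 x1 y1) _) (one (node_cusp_conic X2 x2 y2) _)).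
    move=> H; split.
      move=> cH; have [X [x [y [sq /= SH]]]] := one_class cH.
      case/orP: (all_roots _ _ _ sq) => /eqP EX; subst X; [left|right].
        rewrite (node_cusp_conic_sign sq sq1) in SH.
        by split=> //; apply: (cond6 sq1); apply: contact_quad_proportional SH cH.
      rewrite (node_cusp_conic_sign sq sq2) in SH.
      by split=> //; apply: (cond6 sq2); apply: contact_quad_proportional SH cH.
    case=> [] [cnd /proportional_sym SH]; apply: contact_quad_proportional SH _.
      exact: node_cusp_conic_contact.
    exact: node_cusp_conic_contact.
  move=> H H' [c1 SH] [c2 SH'] /(chain _ _ _ _ SH SH') /(node_cusp_conic_neq c1 sq1 sq2) /eqP.
  by rewrite (negbTE X12).
Qed.

End ConicsThroughOneNode.

Section Swap.

Variable K : closedFieldType.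

Definition swap_nodes : {mpoly K[3]} -> {mpoly K[3]} := lin_sub (tperm_mx i0 i1).

Lemma swap_nodesK : involutive swap_nodes.
Proof.
by move=> H; rewrite /swap_nodes lin_sub_comp -perm_mxM tperm2 perm_mx1 lin_sub1.
Qed.

Lemma swap_nodes_quad A B C D E F :
  swap_nodes (quad A B C D E F) = quad B A C E D F :> {mpoly K[3]}.
Proof.
have E0 : swap_nodes 'X_i0 = 'X_i1.
  rewrite /swap_nodes lin_subX big_ord3 /= !mxE tpermL tpermR tpermD //=.
  by rewrite !scale0r scale1r add0r addr0.
have E1 : swap_nodes 'X_i1 = 'X_i0.
  rewrite /swap_nodes lin_subX big_ord3 /= !mxE tpermL tpermR tpermD //=.
  by rewrite !scale0r scale1r !addr0.
have E2 : swap_nodes 'X_i2 = 'X_i2.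
  rewrite /swap_nodes lin_subX big_ord3 /= !mxE tpermL tpermR tpermD //=.
  by rewrite !scale0r scale1r !add0r.
rewrite /quad /swap_nodes !rmorphD /= !lin_subZ !rmorphXn !rmorphM /=.
rewrite -![lin_sub _ _]/(swap_nodes _) E0 E1 E2 -!mul_mpolyC; ring.
Qed.

Lemma comp_unit_quad (a c : K) :
  unit_quad a c \Po (- 'X : {poly K}) = unit_quad (- a) c.
Proof.
rewrite /unit_quad !comp_polyD !comp_polyM !comp_polyC !comp_polyX.
by rewrite polyCN; ring.
Qed.

Lemma pullback_swap a c d A B C D E F :
  pullback (1 - a) d c (quad B A C E D F) =
  pullback a c d (quad A B C D E F) \Po (- 'X : {poly K}).
Proof.
have Eu : uu (1 - a) d = vv a d \Po (- 'X : {poly K}).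
  by rewrite /uu /vv comp_unit_quad; congr unit_quad; ring.
have Ev : vv (1 - a) c = uu a c \Po (- 'X : {poly K}).
  by rewrite /uu /vv comp_unit_quad; congr unit_quad; ring.
rewrite !pullback_quad Eu Ev !(rmorphD, rmorphM, rmorphXn) /= !comp_polyC comp_polyX.
by ring.
Qed.

Lemma contact_quad_swap a c d e1 e2 e3 H :
  contact_quad a c d e1 e2 e3 H -> contact_quad (1 - a) d c e2 e1 e3 (swap_nodes H : {mpoly K[3]}).
Proof.
case=> A [B [C [D [E [F [EH disc0 [eA eB eC] sg [h Eh]]]]]]].
exists B, A, C, E, D, F; rewrite EH swap_nodes_quad pullback_swap -EH.
split=> //.
- by apply: contraNneq disc0 => disc0; rewrite -[X in _ == X]disc0 /disc_quad; apply/eqP; ring.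
- by rewrite size_comp_poly2 // size_polyN size_polyX.
exists (h \Po - 'X); rewrite Eh !(rmorphM, rmorphXn) /=.
have -> : uu (1 - a) d = vv a d \Po (- 'X : {poly K}).
  by rewrite /uu /vv comp_unit_quad; congr unit_quad; ring.
have -> : vv (1 - a) c = uu a c \Po (- 'X : {poly K}).
  by rewrite /uu /vv comp_unit_quad; congr unit_quad; ring.
by rewrite [_ ^+ e1 * _]mulrC.
Qed.

Lemma count_swap a c d e1 e2 e3 n :
  number_up_to_scaling (contact_quad (1 - a) d c e2 e1 e3 : {mpoly K[3]} -> Prop) n ->
  number_up_to_scaling (contact_quad a c d e1 e2 e3 : {mpoly K[3]} -> Prop) n.
Proof.
have sc : scalable swap_nodes by move=> l H; apply: lin_subZ.
apply: (count_transport sc sc swap_nodesK swap_nodesK) => H; split.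
  exact: contact_quad_swap.
by move/contact_quad_swap; rewrite swap_nodesK opprB addrC subrK.
Qed.

Lemma contact_quad_pattern a c d e1 e2 e3 e1' e2' e3' (H H' : {mpoly K[3]}) :
  contact_quad a c d e1 e2 e3 H -> contact_quad a c d e1' e2' e3' H' ->
  proportional H H' -> [/\ e1 = e1', e2 = e2' & e3 = e3'].
Proof.
move=> + + HH'; move=> cH /(contact_quad_proportional HH').
case: cH => A [B [C [D [E [F [-> _ [<- <- <-] _ _]]]]]].
case=> A' [B' [C' [D' [E' [F' [EH _ [<- <- <-] _ _]]]]]].
by have [[-> -> ->] _] := quad_inj EH.
Qed.

End Swap.

Section Table.

Variables (K : closedFieldType) (a c d : K).

Let b := a - 1.
Let k := c - d.
Let m := a * d - b * c.
Let beta := bitangency a c d.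
Let Du := a ^+ 2 - 4 * c.
Let Dv := b ^+ 2 - 4 * d.

Hypotheses (two0 : 2 != 0 :> K).
Hypotheses (c0 : c != 0) (d0 : d != 0) (R0 : res_uv a c d != 0).
Hypotheses (Du0 : Du != 0) (Dv0 : Dv != 0).

Lemma through_node_nondegenerate : a * b = 0 -> (m != 0) && (beta != 0).
Proof.
move=> ab0; rewrite -negb_or -mulf_eq0.
have /orP [] : (a == 0) || (b == 0) by rewrite -mulf_eq0 ab0.
  move/eqP => E.
  rewrite (_ : m * beta = c ^+ 2 * Dv); first by rewrite mulf_neq0 ?expf_neq0.
  by rewrite /m /beta /bitangency /Dv /b E; ring.
move/eqP => E; have a1 : a = 1 by apply/eqP; rewrite -subr_eq0 -/b E.
rewrite (_ : m * beta = d ^+ 2 * Du); first by rewrite mulf_neq0 ?expf_neq0.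
by rewrite /m /beta /bitangency /Du /b a1; ring.
Qed.

End Table.

(** The contact conics through exactly one given node, by the number of ... *)
Section OneNode.

Variables (K : closedFieldType) (a c d : K).

Let b := a - 1.
Let m := a * d - b * c.
Let beta := bitangency a c d.
Let Du := a ^+ 2 - 4 * c.
Let Dv := b ^+ 2 - 4 * d.

Hypotheses (two0 : 2 != 0 :> K).
Hypotheses (c0 : c != 0) (d0 : d != 0) (R0 : res_uv a c d != 0).
Hypotheses (Du0 : Du != 0) (Dv0 : Dv != 0).

Let n2 := number_up_to_scaling (contact_quad a c d true false false).
Let n3 := number_up_to_scaling (contact_quad a c d true false true).

Let nd := through_node_nondegenerate c0 d0 Du0 Dv0.
Let four0 : 4 != 0 :> K. Proof. by rewrite (_ : 4 = 2 * 2) ?mulf_neq0 // -natrM. Qed.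

Lemma count_one_node :
  [/\ a * b != 0 -> m != 0 -> beta != 0 -> n2 2%N /\ n3 2%N,
      beta = 0 -> n2 1%N /\ n3 1%N,
      m = 0 -> n2 1%N /\ n3 0%N
    & a * b = 0 -> n2 0%N /\ n3 (if b == 0 then 0%N else 2%N)].
Proof.
have [X1 [X2 [X12 VS VP]]] := count_one_node_conics two0 c0 d0 R0 Du0 Dv0.
rewrite -/b -/Dv -/Du -/m in VS VP *.
set f := fun X : K => a * b + X * Dv; set g := fun X : K => a * b + X * Dv - 4 * c - 4 * d.
rewrite -/(f X1) -/(f X2) -/(g X1) -/(g X2) -/n2 -/n3 => N2 N3.
have g1 : g X1 = - f X2.
  rewrite /g /f; transitivity (- (a * b + X2 * Dv) + (Dv * (X1 + X2) - (4 * c + 4 * d - 2 * a * b))).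
    by ring.
  by rewrite VS subrr addr0.
have g2 : g X2 = - f X1.
  rewrite /g /f; transitivity (- (a * b + X1 * Dv) + (Dv * (X1 + X2) - (4 * c + 4 * d - 2 * a * b))).
    by ring.
  by rewrite VS subrr addr0.
have ff : f X1 * f X2 = - 4 * beta.
  transitivity ((a * b) ^+ 2 + a * b * (Dv * (X1 + X2)) + Dv * (Dv * (X1 * X2))).
    by rewrite /f; ring.
  by rewrite VS VP /Du /Dv /beta /bitangency /b; ring.
have cc : Dv * ((c + X1 * d) * (c + X2 * d)) = m ^+ 2.
  transitivity (Dv * c ^+ 2 + c * d * (Dv * (X1 + X2)) + d ^+ 2 * (Dv * (X1 * X2))).
    by ring.
  by rewrite VS VP /Du /Dv /m /b; ring.
have f12 : f X1 != f X2.
  by apply: contraNneq X12 => /addrI /(mulIf Dv0) ->.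
have c12 : c + X1 * d != c + X2 * d.
  by apply: contraNneq X12 => /addrI /(mulIf d0) ->.
have f_beta : (f X1 == 0) || (f X2 == 0) = (beta == 0).
  by rewrite -mulf_eq0 ff mulf_eq0 oppr_eq0 (negbTE four0).
have c_m : (c + X1 * d == 0) || (c + X2 * d == 0) = (m == 0).
  by rewrite -mulf_eq0 -[RHS](expf_eq0 _ 2) -cc [RHS]mulf_eq0 (negbTE Dv0).
rewrite g1 g2 !mulf_eq0 !oppr_eq0 !negb_or in N2 N3.
have ab_m : m == 0 -> (a != 0) && (b != 0).
  move=> m0; rewrite -negb_or -mulf_eq0; apply: contraL m0 => /eqP /nd.
  by case/andP.
have ab_beta : beta == 0 -> (a != 0) && (b != 0).
  move=> m0; rewrite -negb_or -mulf_eq0; apply: contraL m0 => /eqP /nd.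
  by case/andP.
have m_beta : m == 0 -> beta != 0.
  move=> m0; rewrite /beta /bitangency -/b -/m (eqP m0) sub0r oppr_eq0.
  by rewrite mulf_neq0 // mulf_neq0.
split.
- rewrite mulf_eq0 negb_or => /andP [a0 b0] m0 be0.
  move: f_beta c_m N2 N3; rewrite (negbTE m0) (negbTE be0) a0 b0.
  by case: eqP; case: eqP; case: eqP; case: eqP.
- move=> be0; move: ab_beta m_beta; rewrite be0 eqxx => /(_ isT) /andP [a0 b0].
  have [//|m0 _] := eqVneq m 0; first by move=> _ /(_ isT).
  move: f_beta c_m N2 N3; rewrite (negbTE m0) be0 eqxx a0 b0 /=.
  case: (c + X1 * d == 0) => //; case: (c + X2 * d == 0) => //.
  case: (eqVneq (f X1) 0) => [E1|_]; case: (eqVneq (f X2) 0) => [E2|_] //=.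
  by case/eqP: f12; rewrite E1 E2.
- move=> m0; move: (ab_m) (m_beta); rewrite m0 eqxx => /(_ isT) /andP [a0 b0] /(_ isT) be0.
  move: f_beta c_m N2 N3; rewrite m0 (negbTE be0) eqxx a0 b0.
  case: (f X1 == 0) => //; case: (f X2 == 0) => //.
  case: (eqVneq (c + X1 * d) 0) => [E1|_]; case: (eqVneq (c + X2 * d) 0) => [E2|_] //=.
  by case/eqP: c12; rewrite E1 E2.
- move=> ab0; have /andP [m0 be0] := nd ab0.
  move/eqP: ab0; rewrite mulf_eq0; move: f_beta c_m N2 N3; rewrite (negbTE m0) (negbTE be0) /=.
  have [a_0|a0] := eqVneq a 0; have [b_0|b0] := eqVneq b 0 => //=.
  by case: (f X1 == 0) => //; case: (f X2 == 0).
Qed.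

End OneNode.

Section CountingTable.

Variables (K : closedFieldType) (a c d : K).

Let b := a - 1.
Let m := a * d - b * c.
Let beta := bitangency a c d.
Let Du := a ^+ 2 - 4 * c.
Let Dv := b ^+ 2 - 4 * d.

Hypotheses (two0 : 2 != 0 :> K).
Hypotheses (c0 : c != 0) (d0 : d != 0) (R0 : res_uv a c d != 0).
Hypotheses (Du0 : Du != 0) (Dv0 : Dv != 0).

Let contact := contact_quad a c d.

Definition contact_type (i : nat) : {mpoly K[3]} -> Prop :=
  match i with
  | 1 => contact false false true
  | 2 => fun H => contact true false false H \/ contact false true false H
  | 3 => fun H => contact true false true H \/ contact false true true H
  | 4 => contact true true false
  | 5 => contact true true true
  | 6 => contact false false false
  | _ => fun=> False
  end.

Let N i n := number_up_to_scaling (contact_type i) n.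
Let N' e1 e2 e3 n := number_up_to_scaling (contact e1 e2 e3) n.

Let add2 n n' : N' true false false n -> N' false true false n' -> N 2 (n + n').
Proof.
by apply: count_add => // H H' cH cH' /(contact_quad_pattern cH cH') [].
Qed.

Let add3 n n' : N' true false true n -> N' false true true n' -> N 3 (n + n').
Proof.
by apply: count_add => // H H' cH cH' /(contact_quad_pattern cH cH') [].
Qed.

Let n1 := count_cusp_conics two0 c0 d0 R0 Du0 Dv0.
Let n4 := count_nodes_conics two0 c0 d0 R0 Du0 Dv0.
Let n5 := count_triple_conics two0 c0 d0 R0 Du0 Dv0.
Let n6 := count_free_conics two0 c0 d0 R0 Du0 Dv0.

Lemma contact_table :
  [/\ [/\ a != 0, b != 0, m != 0 & beta != 0] ->
        [/\ N 1 3, N 2 4, N 3 4, N 4 1 & N 5 1 /\ N 6 1]%N,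
      beta = 0 -> [/\ N 1 1, N 2 2, N 3 2, N 4 0 & N 5 1 /\ N 6 0]%N,
      m = 0 -> [/\ N 1 0, N 2 2, N 3 0, N 4 1 & N 5 0 /\ N 6 0]%N
    & a = 0 \/ b = 0 -> [/\ N 1 1, N 2 0, N 3 2, N 4 0 & N 5 0 /\ N 6 1]%N].
Proof.
have [s1 b1 sc1 sn1] := count_one_node two0 c0 d0 R0 Du0 Dv0.
have R0' : res_uv (1 - a) d c != 0.
  by rewrite (_ : res_uv _ _ _ = res_uv a c d) // /res_uv; ring.
have Du0' : (1 - a) ^+ 2 - 4 * d != 0.
  by rewrite (_ : _ - _ = Dv) // /Dv /b; ring.
have Dv0' : (1 - a - 1) ^+ 2 - 4 * c != 0.
  by rewrite (_ : _ - _ = Du) // /Du; ring.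
have m_sw : (1 - a) * c - (1 - a - 1) * d = m by rewrite /m /b; ring.
have be_sw : bitangency (1 - a) d c = beta by rewrite /beta /bitangency; ring.
have ab_sw : (1 - a) * (1 - a - 1) = a * b by rewrite /b; ring.
have b_sw : 1 - a - 1 = - a by ring.
have := count_one_node two0 d0 c0 R0' Du0' Dv0'; rewrite m_sw be_sw ab_sw b_sw.
move=> [s2 b2 sc2 sn2].
have [nm nbe nab] : [/\ m = 0 -> [/\ a != 0, b != 0 & beta != 0],
    beta = 0 -> [/\ a != 0, b != 0 & m != 0]
    & a = 0 \/ b = 0 -> [/\ (a == 0) = ~~ (b == 0), m != 0 & beta != 0]].
  have nd : a * b = 0 -> (m != 0) && (beta != 0) := through_node_nondegenerate c0 d0 Du0 Dv0.
  have ab : a * b != 0 -> a != 0 /\ b != 0 by rewrite mulf_eq0 negb_or => /andP.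
  have four0 : 4 != 0 :> K by rewrite (_ : 4 = 2 * 2) ?mulf_neq0 // -natrM.
  split=> [m0|be0|ab0].
  - have [|a0 b0] := ab; first by apply/eqP => /nd; rewrite m0 eqxx.
    split=> //; rewrite /beta /bitangency -/b -/m m0 sub0r oppr_eq0.
    by rewrite mulf_neq0 // mulf_neq0.
  - have [|a0 b0] := ab; first by apply/eqP => /nd; rewrite be0 eqxx andbF.
    split=> //; apply: contra_eqN be0 => /eqP m0.
    rewrite /beta /bitangency -/b -/m m0 sub0r oppr_eq0.
    by rewrite mulf_neq0 // mulf_neq0.
  - have /nd /andP [m0 be0] : a * b = 0 by case: ab0 => ->; rewrite ?mul0r ?mulr0.
    split=> //; rewrite /b subr_eq0; case: ab0 => [->|/eqP].
      by rewrite eqxx eq_sym oner_eq0.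
    by rewrite subr_eq0 => /eqP ->; rewrite eqxx oner_eq0.
split.
- case=> a0 b0 m0 be0; have ab0 : a * b != 0 by rewrite mulf_neq0.
  have [N2 N3] := s1 ab0 m0 be0; have [N2' N3'] := s2 ab0 m0 be0.
  have := add2 N2 (count_swap N2'); have := add3 N3 (count_swap N3').
  move: n1 n4 n5 n6; rewrite -/b -/m -/beta !mulf_neq0 //.
- move=> be0; have [a0 b0 m0] := nbe be0.
  have [N2 N3] := b1 be0; have [N2' N3'] := b2 be0.
  have := add2 N2 (count_swap N2'); have := add3 N3 (count_swap N3').
  move: n1 n4 n5 n6; rewrite -/b -/m -/beta be0 !mulr0 eqxx !mulf_neq0 //.
- move=> m0; have [a0 b0 be0] := nm m0.
  have [N2 N3] := sc1 m0; have [N2' N3'] := sc2 m0.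
  have := add2 N2 (count_swap N2'); have := add3 N3 (count_swap N3').
  move: n1 n4 n5 n6; rewrite -/b -/m -/beta m0 !mulr0 !mul0r eqxx !mulf_neq0 //.
- move=> ab0; have [a_b m0 be0] := nab ab0.
  have {}ab0 : a * b = 0 by case: ab0 => ->; rewrite ?mul0r ?mulr0.
  have [N2 N3] := sn1 ab0; have [N2' N3'] := sn2 ab0.
  have := add2 N2 (count_swap N2'); have := add3 N3 (count_swap N3').
  move: n1 n4 n5 n6; rewrite -/b -/m -/beta ab0 !mul0r eqxx oppr_eq0 a_b.
  have -> : (b * m * beta != 0) = (b != 0) by rewrite !mulf_eq0 (negbTE m0) (negbTE be0) !orbF.
  have -> : (a * m * beta != 0) = (b == 0).
    by rewrite !mulf_eq0 (negbTE m0) (negbTE be0) !orbF a_b negbK.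
  by rewrite (mulf_neq0 m0 be0); case: (b == 0).
Qed.

End CountingTable.

Section ContactConicsOfNormalForms.

Variables (K : closedFieldType) (a c d : K).

Let b := a - 1.
Let k := c - d.
Let u := uu a c.
Let v := vv a d.
Let pb := pullback a c d.

Hypotheses (two0 : 2 != 0 :> K).
Hypotheses (c0 : c != 0) (d0 : d != 0) (R0 : res_uv a c d != 0).
Hypotheses (Du0 : a ^+ 2 - 4 * c != 0) (Dv0 : b ^+ 2 - 4 * d != 0).

Let uv_coprime r : root u r -> v.[r] != 0.
Proof.
move=> ur; have := coprime_uv R0.
by move/Pdiv.ClosedField.coprimepP => /(_ r ur).
Qed.

Let vu_coprime r : root v r -> u.[r] != 0.
Proof. by move=> vr; apply: contraL vr => /uv_coprime. Qed.

Let size_u : size u = 3%N. Proof. exact: size_unit_quad. Qed.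
Let size_v : size v = 3%N. Proof. exact: size_unit_quad. Qed.
Let u0 : u != 0. Proof. by rewrite -size_poly_gt0 size_u. Qed.
Let v0 : v != 0. Proof. by rewrite -size_poly_gt0 size_v. Qed.

Let v_at r : root u r -> v.[r] = - r - k * r ^+ 2.
Proof.
move=> ur; transitivity (v.[r] - u.[r]).
  by rewrite (eqP (ur : u.[r] == 0)) subr0.
by rewrite !unit_quadE /k; ring.
Qed.

Let u_at r : root v r -> u.[r] = r + k * r ^+ 2.
Proof.
move=> vr; transitivity (u.[r] - v.[r]).
  by rewrite (eqP (vr : v.[r] == 0)) subr0.
by rewrite !unit_quadE /k; ring.
Qed.

(* Two distinct roots of x + y t. *)
Let lin_eq0 (x y r1 r2 : K) : r1 != r2 -> x + y * r1 = 0 -> x + y * r2 = 0 ->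
  x = 0 /\ y = 0.
Proof.
move=> r12 E1 E2; have y_0 : y = 0.
  apply: contraNeq r12 => y_n0; rewrite -(inj_eq (mulfI y_n0)).
  by rewrite -(inj_eq (addrI x)) E1 E2.
by move: E1; rewrite y_0 mul0r addr0.
Qed.

Let horner_at_root (p q : {poly K}) (x y z e f r : K) : p.[r] = 0 ->
  (x%:P * ('X^2) ^+ 2 * p + y%:P * p * q ^+ 2 + z%:P * 'X^2 * p * q
    + 'X^2 * q * (e%:P * q + f%:P * 'X^2)).[r] = r ^+ 2 * q.[r] * (e * q.[r] + f * r ^+ 2).
Proof.
move=> pr; rewrite !(hornerD, hornerM, hornerC, horner_exp, hornerX) pr; ring.
Qed.

Let exponent_u A B C D E F (e1 e2 : bool) (h : {poly K}) :
  disc_quad A B C D E F != 0 ->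
  pb (quad A B C D E F) = u ^+ e1 * v ^+ e2 * h ^+ 2 -> (A == 0) = e1.
Proof.
move=> disc0 Eh; have [r1 [r2 [r12 _ _ uE]]] := unit_quad_roots c0 Du0.
have ur r : root u r = (r == r1) || (r == r2).
  by rewrite /u /uu uE !rootM !root_XsubC rootC (negbTE c0).
have at_u r : root u r -> A * (r ^+ 2 * v.[r]) ^+ 2 = 0 ^+ e1 * v.[r] ^+ e2 * h.[r] ^+ 2.
  move=> rr; rewrite -(@pb_at_u _ a c d A B C D E F) // -/pb Eh !hornerM !horner_exp.
  by rewrite (eqP (rr : u.[r] == 0)).
have w0 r : root u r -> (r ^+ 2 * v.[r]) ^+ 2 != 0.
  by move=> rr; rewrite !expf_neq0 // mulf_neq0 ?uv_coprime // expf_neq0 // (unit_quad_root0 rr).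
have ur1 : root u r1 by rewrite ur eqxx.
have ur2 : root u r2 by rewrite ur eqxx orbT.
case: e1 Eh at_u => [Eh at_u|Eh at_u].
  apply/eqP; apply: (mulIf (w0 _ ur1)); rewrite at_u //.
  by rewrite expr1 !mul0r.
apply/negbTE/negP => /eqP A0.
have hr r : root u r -> h.[r] = 0.
  move=> rr; move/eqP: (at_u _ rr); rewrite A0 mul0r expr0 mul1r eq_sym mulf_eq0.
  by rewrite (negbTE (expf_neq0 _ (uv_coprime rr))) /= expf_eq0 /= => /eqP.
have /dvdpP [h' Eh'] := dvd_roots c0 Du0 hr.
have EW : B%:P * ('X^2) ^+ 2 * u + C%:P * u * v ^+ 2 + D%:P * 'X^2 * u * v
    + 'X^2 * v * (E%:P * v + F%:P * 'X^2) = v ^+ e2 * h' ^+ 2 * u.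
  apply: (mulfI u0); transitivity (pb (quad A B C D E F)).
    by rewrite /pb pullback_quad A0 polyC0 -/u -/v; ring.
  by rewrite Eh expr0 mul1r Eh' -/(uu a c) -/u; ring.
have EF r : root u r -> - E + (F - E * k) * r = 0.
  move=> rr; have r0 := unit_quad_root0 rr.
  have := congr1 (fun f : {poly K} => f.[r]) EW.
  rewrite horner_at_root ?(eqP (rr : u.[r] == 0)) // hornerM (eqP (rr : u.[r] == 0)) mulr0.
  move/eqP; rewrite !mulf_eq0 (negbTE r0) (negbTE (uv_coprime rr)) /= => /eqP E0.
  apply: (mulfI r0).
  by rewrite mulr0 -[RHS]E0 v_at //; ring.
have [/eqP E_0 F_0] := lin_eq0 r12 (EF _ ur1) (EF _ ur2).
move: E_0; rewrite oppr_eq0 => /eqP E_0; move: F_0; rewrite E_0 mul0r subr0 => F_0.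
by case/eqP: disc0; rewrite /disc_quad A0 E_0 F_0; ring.
Qed.

Let exponent_v A B C D E F (e1 e2 : bool) (h : {poly K}) :
  disc_quad A B C D E F != 0 ->
  pb (quad A B C D E F) = u ^+ e1 * v ^+ e2 * h ^+ 2 -> (B == 0) = e2.
Proof.
move=> disc0 Eh; have [r1 [r2 [r12 _ _ vE]]] := unit_quad_roots d0 Dv0.
have vr r : root v r = (r == r1) || (r == r2).
  by rewrite /v /vv -/b vE !rootM !root_XsubC rootC (negbTE d0).
have at_v r : root v r -> B * (r ^+ 2 * u.[r]) ^+ 2 = u.[r] ^+ e1 * 0 ^+ e2 * h.[r] ^+ 2.
  move=> rr; rewrite -(@pb_at_v _ a c d A B C D E F) // -/pb Eh !hornerM !horner_exp.
  by rewrite (eqP (rr : v.[r] == 0)).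
have w0 r : root v r -> (r ^+ 2 * u.[r]) ^+ 2 != 0.
  by move=> rr; rewrite !expf_neq0 // mulf_neq0 ?vu_coprime // expf_neq0 // (unit_quad_root0 rr).
have vr1 : root v r1 by rewrite vr eqxx.
have vr2 : root v r2 by rewrite vr eqxx orbT.
case: e2 Eh at_v => [Eh at_v|Eh at_v].
  apply/eqP; apply: (mulIf (w0 _ vr1)); rewrite at_v //.
  by rewrite expr1 mulr0 !mul0r.
apply/negbTE/negP => /eqP B0.
have hr r : root v r -> h.[r] = 0.
  move=> rr; move/eqP: (at_v _ rr); rewrite B0 mul0r expr0 mulr1 eq_sym mulf_eq0.
  by rewrite (negbTE (expf_neq0 _ (vu_coprime rr))) /= expf_eq0 /= => /eqP.
have /dvdpP [h' Eh'] := dvd_roots d0 Dv0 hr.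
have EW : A%:P * ('X^2) ^+ 2 * v + C%:P * v * u ^+ 2 + E%:P * 'X^2 * v * u
    + 'X^2 * u * (D%:P * u + F%:P * 'X^2) = u ^+ e1 * h' ^+ 2 * v.
  apply: (mulfI v0); transitivity (pb (quad A B C D E F)).
    by rewrite /pb pullback_quad B0 polyC0 -/u -/v; ring.
  by rewrite Eh expr0 mulr1 Eh' -[unit_quad _ _]/v; ring.
have DF r : root v r -> D + (F + D * k) * r = 0.
  move=> rr; have r0 := unit_quad_root0 rr.
  have := congr1 (fun f : {poly K} => f.[r]) EW.
  rewrite horner_at_root ?(eqP (rr : v.[r] == 0)) // hornerM (eqP (rr : v.[r] == 0)) mulr0.
  move/eqP; rewrite !mulf_eq0 (negbTE r0) (negbTE (vu_coprime rr)) /= => /eqP E0.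
  apply: (mulfI r0).
  by rewrite mulr0 -[RHS]E0 u_at //; ring.
have [D_0 F_0] := lin_eq0 r12 (DF _ vr1) (DF _ vr2).
move: F_0; rewrite D_0 mul0r addr0 => F_0.
by case/eqP: disc0; rewrite /disc_quad B0 D_0 F_0; ring.
Qed.

Variables (Q : {mpoly K[3]}) (M : 'M[K]_3) (kap : K).
Hypotheses (M_unit : M \in unitmx) (kap0 : kap != 0).
Hypothesis Q_normal : lin_sub M Q = kap *: normal_quartic a c d.

Let zo := point_infty c d *m M.

Variables (x1 x2 y : 'rV[K]_3) (l1 l2 l3 : K).
Hypotheses (l10 : l1 != 0) (l20 : l2 != 0) (l30 : l3 != 0).
Hypothesis x1E : x1 = l1 *: (row3 1 0 0 *m M).
Hypothesis x2E : x2 = l2 *: (row3 0 1 0 *m M).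
Hypothesis yE : y = l3 *: (row3 0 0 1 *m M).
Hypothesis singE : forall p, singular_point Q p <->
  [\/ proportional x1 p, proportional x2 p | proportional y p].

Let on_e G A B C D E F (e : 'rV[K]_3) l : l != 0 -> e != 0 -> lin_sub M G = quad A B C D E F ->
  on_curve G (l *: (e *m M)) <-> (quad A B C D E F).@[e 0] = 0.
Proof.
move=> l0 e0 EG; have hG : G \is 2.-homog.
  by rewrite -(lin_sub_homogE _ _ M_unit) EG quad_homog.
rewrite (on_curve_scale _ hG l0) -(on_curve_lin_sub M_unit) EG.
by split=> [[]|].
Qed.

Let on_x1 G A B C D E F : lin_sub M G = quad A B C D E F -> on_curve G x1 <-> A = 0.
Proof.
have [e0 _ _] := row3_e_neq0 K; move=> EG; rewrite x1E (on_e l10 e0 EG) meval_quad !row3E.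
by rewrite (_ : _ + _ = A) //; ring.
Qed.

Let on_x2 G A B C D E F : lin_sub M G = quad A B C D E F -> on_curve G x2 <-> B = 0.
Proof.
have [_ e1 _] := row3_e_neq0 K; move=> EG; rewrite x2E (on_e l20 e1 EG) meval_quad !row3E.
by rewrite (_ : _ + _ = B) //; ring.
Qed.

Let on_y G A B C D E F : lin_sub M G = quad A B C D E F -> on_curve G y <-> C = 0.
Proof.
have [_ _ e2] := row3_e_neq0 K; move=> EG; rewrite yE (on_e l30 e2 EG) meval_quad !row3E.
by rewrite (_ : _ + _ = C) //; ring.
Qed.

Let basis_indep (l l' : K) (e e' : 'rV[K]_3) i : l != 0 -> l' != 0 -> e 0 i = 1 -> e' 0 i = 0 ->
  proportional (l *: (e *m M)) (l' *: (e' *m M)) -> False.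
Proof.
move=> l0 l0' ei ei' [n n0]; rewrite !scalemxAl => /(can_inj (mulmxK M_unit)).
move/rowP/(_ i); rewrite !mxE ei ei' mulr0 mulr1 => /esym/eqP.
by rewrite mulf_eq0 (negbTE n0) (negbTE l0).
Qed.

Let x12 : ~ proportional x1 x2.
Proof. by rewrite x1E x2E; apply: (@basis_indep _ _ _ _ i0); rewrite ?row3E. Qed.
Let x1y : ~ proportional x1 y.
Proof. by rewrite x1E yE; apply: (@basis_indep _ _ _ _ i0); rewrite ?row3E. Qed.
Let x2y : ~ proportional x2 y.
Proof. by rewrite x2E yE; apply: (@basis_indep _ _ _ _ i1); rewrite ?row3E. Qed.

Let nodes (e1 e2 e3 : bool) : seq 'rV[K]_3 := mask [:: e1; e2; e3] [:: x1; x2; y].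

Let nodesE e1 e2 e3 p : (exists2 q, q \in nodes e1 e2 e3 & proportional q p) <->
  [\/ e1 /\ proportional x1 p, e2 /\ proportional x2 p | e3 /\ proportional y p].
Proof.
split.
  case=> q; rewrite /nodes; case: e1 e2 e3 => [] [] []; rewrite /= ?inE //;
    do ?[case/orP]; move/eqP => -> qp;
    by [constructor 1|constructor 2|constructor 3].
by case=> -[e qp]; [exists x1|exists x2|exists y] => //; move: e; rewrite /nodes;
  case: e1 e2 e3 => [] [] [] //=; rewrite !inE eqxx ?orbT.
Qed.

Let common_singE G A B C D E F e1 e2 e3 : lin_sub M G = quad A B C D E F ->
  common_sing_is Q G (nodes e1 e2 e3) <->
  [/\ (A == 0) = e1, (B == 0) = e2 & (C == 0) = e3].
Proof.
move=> EG; have hG : G \is 2.-homog.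
  by rewrite -(lin_sub_homogE _ _ M_unit) EG quad_homog.
have onG p q : proportional p q -> on_curve G q <-> on_curve G p.
  by case=> l l0 ->; apply: on_curve_scale hG l0.
split=> [cs|[eA eB eC] p].
  have self x : singular_point Q x -> on_curve G x <->
      [\/ e1 /\ proportional x1 x, e2 /\ proportional x2 x | e3 /\ proportional y x].
    move=> sx; rewrite -nodesE -(cs x).
    by split=> [|[]].
  have s1 : singular_point Q x1 by apply/singE; constructor 1; apply: proportional_refl.
  have s2 : singular_point Q x2 by apply/singE; constructor 2; apply: proportional_refl.
  have s3 : singular_point Q y by apply/singE; constructor 3; apply: proportional_refl.
  split; apply/idP/idP.
  - move=> /eqP A0; case: ((self _ s1).1 ((on_x1 EG).2 A0)) => [[]//|[_]|[_]] /proportional_sym.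
      by move/x12.
    by move/x1y.
  - move=> e; apply/eqP/(on_x1 EG)/(self _ s1).
    by constructor 1; split=> //; apply: proportional_refl.
  - move=> /eqP B0; case: ((self _ s2).1 ((on_x2 EG).2 B0)) => [[_ /x12]//|[]//|[_]].
    by move/proportional_sym/x2y.
  - move=> e; apply/eqP/(on_x2 EG)/(self _ s2).
    by constructor 2; split=> //; apply: proportional_refl.
  - move=> /eqP C0; case: ((self _ s3).1 ((on_y EG).2 C0)) => [[_ /x1y]//|[_ /x2y]//|[]//].
  - move=> e; apply/eqP/(on_y EG)/(self _ s3).
    by constructor 3; split=> //; apply: proportional_refl.
rewrite nodesE; split.
  case=> /singE [] xp /(onG _ _ xp).
  - by move/(on_x1 EG)/eqP; rewrite eA => e; constructor 1.
  - by move/(on_x2 EG)/eqP; rewrite eB => e; constructor 2.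
  - by move/(on_y EG)/eqP; rewrite eC => e; constructor 3.
case=> -[e xp]; split; try (apply/singE); try (apply/(onG _ _ xp)).
- by constructor 1.
- by apply/(on_x1 EG)/eqP; rewrite eA.
- by constructor 2.
- by apply/(on_x2 EG)/eqP; rewrite eB.
- by constructor 3.
- by apply/(on_y EG)/eqP; rewrite eC.
Qed.

Let smooth_conicE G A B C D E F : lin_sub M G = quad A B C D E F ->
  smooth_conic G <-> disc_quad A B C D E F != 0.
Proof.
move=> EG; have hG : G \is 2.-homog.
  by rewrite -(lin_sub_homogE _ _ M_unit) EG quad_homog.
have grE q : (grad G (q *m M) == 0) = (grad (quad A B C D E F) q == 0).
  by rewrite -EG grad_lin_sub mulmx_tr_eq0.
rewrite -(smooth_quad two0) /smooth_conic; split.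
  case=> _ sm p p0 Hp; rewrite -grE; suff /sm /smooth_pointE [] : on_curve G (p *m M) by [].
  by apply/(on_curve_lin_sub M_unit); rewrite EG.
move=> sm; split.
  split=> //; apply/negP => /eqP G0; have [e0 _ _] := row3_e_neq0 K.
  have := sm _ e0; rewrite -EG G0 /lin_sub raddf0 meval0 => /(_ erefl).
  by case/eqP; apply/rowP => i; rewrite !mxE mderiv0 meval0.
move=> p Gp; apply/smooth_pointE; split=> //.
have pE : p = (p *m invmx M) *m M by rewrite mulmxKV.
move: Gp; rewrite pE => /(on_curve_lin_sub M_unit) []; rewrite EG => q0 Hq.
by rewrite grE; apply: sm.
Qed.

Let contactE e1 e2 e3 G :
  [/\ weak_contact_conic Q G, tangent_at Q G zo & common_sing_is Q G (nodes e1 e2 e3)] <->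
  contact_quad a c d e1 e2 e3 (lin_sub M G).
Proof.
split.
  case=> -[sm ev] tg cs; have [hG G0] : plane_curve 2 G by case: sm.
  have [A [B [C [D [E [F EG]]]]]] := homog2_quad (lin_sub_homog M hG).
  have disc0 := (smooth_conicE EG).1 sm.
  have [eA eB eC] := (common_singE e1 e2 e3 EG).1 cs.
  exists A, B, C, D, E, F; split=> //.
    rewrite EG; exact: (tangent_conicP two0 c0 d0 M_unit kap0 Q_normal EG disc0).1 tg.
  have g0 : pb (lin_sub M G) != 0.
    apply/negP => /eqP E0; have : lin_sub M G = 0.
      by rewrite EG; apply: (pullback_quad_inj c0 d0 R0 Du0 Dv0); rewrite -EG.
    by move/eqP; rewrite lin_sub_eq0 // (negbTE G0).
  have [e1' [e2' [h Eh]]] :=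
    (even_contactP c0 d0 R0 Du0 Dv0 M_unit kap0 Q_normal hG g0).1 ev.
  have Eh' := Eh; rewrite EG in Eh'.
  by exists h; rewrite -eA -eB (exponent_u disc0 Eh') (exponent_v disc0 Eh').
case=> A [B [C [D [E [F [EG disc0 pat sg [h Eh]]]]]]].
have hG : G \is 2.-homog by rewrite -(lin_sub_homogE _ _ M_unit) EG quad_homog.
have sm := (smooth_conicE EG).2 disc0; have [[_ G0] _] := sm.
have g0 : pb (lin_sub M G) != 0.
  apply/negP => /eqP E0; have : lin_sub M G = 0.
    by rewrite EG; apply: (pullback_quad_inj c0 d0 R0 Du0 Dv0); rewrite -EG.
  by move/eqP; rewrite lin_sub_eq0 // (negbTE G0).
split; last by apply/(common_singE e1 e2 e3 EG).
  split=> //; apply/(even_contactP c0 d0 R0 Du0 Dv0 M_unit kap0 Q_normal hG g0).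
  by exists e1, e2, h.
apply/(tangent_conicP two0 c0 d0 M_unit kap0 Q_normal EG disc0).
by rewrite -EG.
Qed.

Lemma conic_count_normal i n : number_up_to_scaling (contact_type a c d i) n ->
  conic_count Q x1 x2 y zo i n.
Proof.
have scM (N : 'M[K]_3) : scalable (lin_sub N) by move=> l H; apply: lin_subZ.
apply: (count_transport (scM M) (scM (invmx M))).
- by move=> G; apply: lin_subK.
- by move=> G; apply: lin_subKV.
move=> G; case: i => [|[|[|[|[|[|[|i]]]]]]] /=; try by split=> [[]|].
- exact: (contactE false false true).
- rewrite -(contactE true false false) -(contactE false true false).
  by split=> [[wc tg [cs|cs]]|[[wc tg cs]|[wc tg cs]]]; try split=> //; by [left|right].
- rewrite -(contactE true false true) -(contactE false true true).
  by split=> [[wc tg [cs|cs]]|[[wc tg cs]|[wc tg cs]]]; try split=> //; by [left|right].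
- exact: (contactE true true false).
- exact: (contactE true true true).
- exact: (contactE false false false).
Qed.

End ContactConicsOfNormalForms.

Section QuarticForms.

Variable K : closedFieldType.
Implicit Types (f : 'rV[K]_3) (F A B : {mpoly K[3]}).

Lemma irreducible_form m n Q A B : irreducible_elt Q -> A \is m.+1.-homog ->
  B \is n.+1.-homog -> Q = A * B -> False.
Proof.
case=> _ _ irr hA hB /irr; have nonunit e F : F \is e.+1.-homog -> F \is a GRing.unit -> False.
  move=> hF uF; have : F.@[(0 : 'rV[K]_3) 0] \is a GRing.unit by apply: rmorph_unit.
  by rewrite -(scale0r 0) (meval_homog _ _ hF) exprS !mul0r unitr0.
by case; [apply: nonunit hA|apply: nonunit hB].
Qed.

Lemma irreducible_lin_sub M m n Q A B : M \in unitmx -> irreducible_elt Q ->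
  A \is m.+1.-homog -> B \is n.+1.-homog -> lin_sub M Q = A * B -> False.
Proof.
move=> uM irr hA hB EQ.
apply: (irreducible_form irr (lin_sub_homog (invmx M) hA) (lin_sub_homog (invmx M) hB)).
by rewrite -rmorphM /= -EQ lin_subK.
Qed.

Definition nodal_quartic (al be ga de ep ze : K) : {mpoly K[3]} :=
  al *: ('X_i1 * 'X_i2) ^+ 2 + be *: ('X_i0 * 'X_i2) ^+ 2 + ga *: ('X_i0 * 'X_i1) ^+ 2
  + de *: ('X_i0 * 'X_i2 * ('X_i0 * 'X_i1)) + ep *: ('X_i1 * 'X_i2 * ('X_i0 * 'X_i1))
  + ze *: ('X_i1 * 'X_i2 * ('X_i0 * 'X_i2)).

Let quartic f0 f1 f2 al be ga de ep ze : {mpoly K[3]} :=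
  'X_i0 * 'X_i0 * 'X_i0 * lin_form f0 + 'X_i1 * 'X_i1 * 'X_i1 * lin_form f1
  + 'X_i2 * 'X_i2 * 'X_i2 * lin_form f2 + nodal_quartic al be ga de ep ze.

Let lin_formE f : lin_form f =
  f 0 i0 *: 'X_i0 + f 0 i1 *: 'X_i1 + f 0 i2 *: 'X_i2 :> {mpoly K[3]}.
Proof. by rewrite /lin_form big_ord3. Qed.

Let quartic_form F : F \is 4.-homog -> exists f0 f1 f2 al be ga de ep ze,
  F = quartic f0 f1 f2 al be ga de ep ze.
Proof.
move: F; apply: homog_ind.
- exists 0, 0, 0, 0, 0, 0, 0, 0, 0; rewrite /quartic /nodal_quartic !lin_formE !mxE.
  by rewrite !scale0r !addr0 !mulr0 !addr0.
- move=> _ _ [f0 [f1 [f2 [al [be [ga [de [ep [ze ->]]]]]]]]]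
    [g0 [g1 [g2 [al' [be' [ga' [de' [ep' [ze' ->]]]]]]]]].
  exists (f0 + g0), (f1 + g1), (f2 + g2), (al + al'), (be + be'), (ga + ga'), (de + de'),
    (ep + ep'), (ze + ze').
  by rewrite /quartic /nodal_quartic !lin_formE !mxE !scalerDl -!mul_mpolyC; ring.
- move=> l _ [f0 [f1 [f2 [al [be [ga [de [ep [ze ->]]]]]]]]].
  exists (l *: f0), (l *: f1), (l *: f2), (l * al), (l * be), (l * ga), (l * de), (l * ep), (l * ze).
  by rewrite /quartic /nodal_quartic !lin_formE !mxE -!scalerA -!mul_mpolyC; ring.
- pose e0 : 'rV[K]_3 := row3 1 0 0; pose e1 : 'rV[K]_3 := row3 0 1 0.
  pose e2 : 'rV[K]_3 := row3 0 0 1.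
  have fin f0 f1 f2 al be ga de ep ze F : F = quartic f0 f1 f2 al be ga de ep ze ->
      exists f0 f1 f2 al be ga de ep ze, F = quartic f0 f1 f2 al be ga de ep ze.
    by exists f0, f1, f2, al, be, ga, de, ep, ze.
  move=> [|[|[|[|[|i]]]]] [|[|[|[|[|j]]]]] [|[|[|[|[|l]]]]] // _;
   [apply: (fin 0 0 e2 0 0 0 0 0 0)|apply: (fin 0 0 e1 0 0 0 0 0 0)
   |apply: (fin 0 0 0 1 0 0 0 0 0)|apply: (fin 0 e2 0 0 0 0 0 0 0)
   |apply: (fin 0 e1 0 0 0 0 0 0 0)|apply: (fin 0 0 e0 0 0 0 0 0 0)
   |apply: (fin 0 0 0 0 0 0 0 0 1)|apply: (fin 0 0 0 0 0 0 0 1 0)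
   |apply: (fin 0 e0 0 0 0 0 0 0 0)|apply: (fin 0 0 0 0 1 0 0 0 0)
   |apply: (fin 0 0 0 0 0 0 1 0 0)|apply: (fin 0 0 0 0 0 1 0 0 0)
   |apply: (fin e2 0 0 0 0 0 0 0 0)|apply: (fin e1 0 0 0 0 0 0 0 0)
   |apply: (fin e0 0 0 0 0 0 0 0 0)];
  by rewrite /quartic /nodal_quartic !lin_formE ?row3E !mxE -!mul_mpolyC ?mpolyC0 ?mpolyC1; ring.
Qed.

Let e0 : 'rV[K]_3 := row3 1 0 0.
Let e1 : 'rV[K]_3 := row3 0 1 0.
Let e2 : 'rV[K]_3 := row3 0 0 1.

Lemma singular_quartic F : F \is 4.-homog -> singular_point F e0 -> singular_point F e1 ->
  singular_point F e2 -> exists al be ga de ep ze, F = nodal_quartic al be ga de ep ze.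
Proof.
case/quartic_form => f0 [f1 [f2 [al [be [ga [de [ep [ze ->]]]]]]]].
move=> [[_ v0] g0] [[_ v1] g1] [[_ v2] g2].
have Fx (p : 'rV[K]_3) : (quartic f0 f1 f2 al be ga de ep ze)^`M(i0).@[p 0] =
  3 * p 0 i0 ^+ 2 * (\sum_i f0 0 i * p 0 i) + p 0 i0 ^+ 3 * f0 0 i0 + p 0 i1 ^+ 3 * f1 0 i0
  + p 0 i2 ^+ 3 * f2 0 i0 + 2 * be * p 0 i0 * p 0 i2 ^+ 2 + 2 * ga * p 0 i0 * p 0 i1 ^+ 2
  + 2 * de * p 0 i0 * p 0 i1 * p 0 i2 + ep * p 0 i1 ^+ 2 * p 0 i2 + ze * p 0 i1 * p 0 i2 ^+ 2.
  rewrite /quartic /nodal_quartic !lin_formE !expr2 big_ord3 /=.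
  rewrite !(mderivD, mderivM, mderivZ, mderivXU) /=.
  rewrite !(mevalD, mevalM, mevalZ, mevalXU, meval0, meval1); ring.
have Fy (p : 'rV[K]_3) : (quartic f0 f1 f2 al be ga de ep ze)^`M(i1).@[p 0] =
  3 * p 0 i1 ^+ 2 * (\sum_i f1 0 i * p 0 i) + p 0 i0 ^+ 3 * f0 0 i1 + p 0 i1 ^+ 3 * f1 0 i1
  + p 0 i2 ^+ 3 * f2 0 i1 + 2 * al * p 0 i1 * p 0 i2 ^+ 2 + 2 * ga * p 0 i1 * p 0 i0 ^+ 2
  + de * p 0 i0 ^+ 2 * p 0 i2 + 2 * ep * p 0 i0 * p 0 i1 * p 0 i2 + ze * p 0 i0 * p 0 i2 ^+ 2.
  rewrite /quartic /nodal_quartic !lin_formE !expr2 big_ord3 /=.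
  rewrite !(mderivD, mderivM, mderivZ, mderivXU) /=.
  rewrite !(mevalD, mevalM, mevalZ, mevalXU, meval0, meval1); ring.
have Fz (p : 'rV[K]_3) : (quartic f0 f1 f2 al be ga de ep ze)^`M(i2).@[p 0] =
  3 * p 0 i2 ^+ 2 * (\sum_i f2 0 i * p 0 i) + p 0 i0 ^+ 3 * f0 0 i2 + p 0 i1 ^+ 3 * f1 0 i2
  + p 0 i2 ^+ 3 * f2 0 i2 + 2 * al * p 0 i2 * p 0 i1 ^+ 2 + 2 * be * p 0 i2 * p 0 i0 ^+ 2
  + de * p 0 i0 ^+ 2 * p 0 i1 + ep * p 0 i0 * p 0 i1 ^+ 2 + 2 * ze * p 0 i0 * p 0 i1 * p 0 i2.
  rewrite /quartic /nodal_quartic !lin_formE !expr2 big_ord3 /=.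
  rewrite !(mderivD, mderivM, mderivZ, mderivXU) /=.
  rewrite !(mevalD, mevalM, mevalZ, mevalXU, meval0, meval1); ring.
have Fv (p : 'rV[K]_3) : (quartic f0 f1 f2 al be ga de ep ze).@[p 0] =
  p 0 i0 ^+ 3 * (\sum_i f0 0 i * p 0 i) + p 0 i1 ^+ 3 * (\sum_i f1 0 i * p 0 i)
  + p 0 i2 ^+ 3 * (\sum_i f2 0 i * p 0 i) + al * (p 0 i1 * p 0 i2) ^+ 2
  + be * (p 0 i0 * p 0 i2) ^+ 2 + ga * (p 0 i0 * p 0 i1) ^+ 2
  + p 0 i0 * p 0 i1 * p 0 i2 * (de * p 0 i0 + ep * p 0 i1 + ze * p 0 i2).
  rewrite /quartic /nodal_quartic !lin_formE !expr2 !big_ord3 /=.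
  rewrite !(mevalD, mevalM, mevalZ, mevalXU, meval0, meval1); ring.
have f0_0 : f0 = 0.
  have f00 : f0 0 i0 = 0 by rewrite -[RHS]v0 Fv !big_ord3 /= !row3E; ring.
  apply/rowP; apply: forall_ord3; rewrite mxE //.
    by rewrite -[RHS](g0 i1) Fy !big_ord3 /= !row3E; ring.
  by rewrite -[RHS](g0 i2) Fz !big_ord3 /= !row3E; ring.
have f1_0 : f1 = 0.
  have f11 : f1 0 i1 = 0 by rewrite -[RHS]v1 Fv !big_ord3 /= !row3E; ring.
  apply/rowP; apply: forall_ord3; rewrite mxE //.
    by rewrite -[RHS](g1 i0) Fx !big_ord3 /= !row3E; ring.
  by rewrite -[RHS](g1 i2) Fz !big_ord3 /= !row3E; ring.
have f2_0 : f2 = 0.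
  have f22 : f2 0 i2 = 0 by rewrite -[RHS]v2 Fv !big_ord3 /= !row3E; ring.
  apply/rowP; apply: forall_ord3; rewrite mxE //.
    by rewrite -[RHS](g2 i0) Fx !big_ord3 /= !row3E; ring.
  by rewrite -[RHS](g2 i1) Fy !big_ord3 /= !row3E; ring.
exists al, be, ga, de, ep, ze.
rewrite f0_0 f1_0 f2_0 /quartic !lin_formE !mxE !scale0r !addr0 !mulr0 !add0r.
by [].
Qed.

End QuarticForms.

Section TangentCones.

Variable K : closedFieldType.
Implicit Types (A B C D E F : K) (L H : {mpoly K[3]}) (p q : 'rV[K]_3) (M : 'M[K]_3).

Lemma tangent_cone_lin_sub M (F : {mpoly K[3]}) q :
  tangent_cone (lin_sub M F) q = lin_sub M (tangent_cone F (q *m M)).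
Proof.
pose h (i j : 'I_3) : K := (F^`M(i)^`M(j)).@[(q *m M) 0].
have hE i j : ((lin_sub M F)^`M(i)^`M(j)).@[q 0] = \sum_r \sum_l M i r * M j l * h r l.
  rewrite mderiv_lin_sub (raddf_sum (mderiv j)) raddf_sum; apply: eq_bigr => r _ /=.
  rewrite mderivZ mderiv_lin_sub mevalZ raddf_sum mulr_sumr; apply: eq_bigr => l _ /=.
  by rewrite mevalZ meval_lin_sub mulrA.
transitivity (\sum_i \sum_j \sum_r \sum_l (M i r * M j l * h r l) *: ('X_i * 'X_j)
    : {mpoly K[3]}).
  apply: eq_bigr => i _; apply: eq_bigr => j _; rewrite hE scaler_suml.
  by apply: eq_bigr => r _; rewrite scaler_suml.
transitivity (\sum_r \sum_l \sum_i \sum_j (M i r * M j l * h r l) *: ('X_i * 'X_j)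
    : {mpoly K[3]}).
  under eq_bigr do rewrite exchange_big.
  rewrite exchange_big; apply: eq_bigr => r _.
  under eq_bigr do rewrite exchange_big.
  by rewrite exchange_big.
rewrite /tangent_cone raddf_sum; apply: eq_bigr => r _.
rewrite raddf_sum; apply: eq_bigr => l _ /=.
rewrite lin_subZ rmorphM /= !lin_subX mulr_suml scaler_sumr; apply: eq_bigr => i _.
rewrite mulr_sumr scaler_sumr; apply: eq_bigr => j _.
by rewrite -/(h r l) -!mul_mpolyC !mpolyCM; ring.
Qed.

Lemma tangent_cone_scale n (F : {mpoly K[3]}) (l : K) p : F \is n.+2.-homog ->
  tangent_cone F (l *: p) = l ^+ n *: tangent_cone F p.
Proof.
move=> hF; rewrite /tangent_cone scaler_sumr; apply: eq_bigr => i _.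
rewrite scaler_sumr; apply: eq_bigr => j _.
by rewrite (meval_homog _ _ (mderiv_homog _ (mderiv_homog _ hF))) scalerA.
Qed.

Lemma homog1_lin_form L : L \is 1.-homog -> exists g, L = lin_form g.
Proof.
move: L; apply: homog_ind.
- by exists 0; rewrite /lin_form big1 // => i _; rewrite mxE scale0r.
- move=> _ _ [g ->] [h ->]; exists (g + h); rewrite /lin_form -big_split /=.
  by apply: eq_bigr => i _; rewrite mxE scalerDl.
- by move=> l _ [g ->]; exists (l *: g); rewrite lin_formZ.
- move=> [|[|i]] [|[|j]] [|[|l]] // _;
   [exists (row3 0 0 1)|exists (row3 0 1 0)|exists (row3 1 0 0)];
   by rewrite /lin_form big_ord3 /= !row3E -!mul_mpolyC ?mpolyC0 ?mpolyC1; ring.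
Qed.

Lemma mul_lin_form (g h : 'rV[K]_3) : lin_form g * lin_form h =
  quad (g 0 i0 * h 0 i0) (g 0 i1 * h 0 i1) (g 0 i2 * h 0 i2)
    (g 0 i1 * h 0 i2 + g 0 i2 * h 0 i1) (g 0 i0 * h 0 i2 + g 0 i2 * h 0 i0)
    (g 0 i0 * h 0 i1 + g 0 i1 * h 0 i0).
Proof.
rewrite /lin_form !big_ord3 /quad /= -!mul_mpolyC !(mpolyCD, mpolyCM); ring.
Qed.

(* A degenerate quadratic form of rank 1 has vanishing minors. *)
Definition rank1_quad (A B C D E F : K) : Prop :=
  [/\ 4 * A * B = F ^+ 2, 4 * A * C = E ^+ 2 & 4 * B * C = D ^+ 2].

Lemma rank1_square L A B C D E F : L \is 1.-homog -> quad A B C D E F = L ^+ 2 ->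
  rank1_quad A B C D E F.
Proof.
case/homog1_lin_form => g ->; rewrite expr2 mul_lin_form.
by case/quad_inj => [[-> -> ->] [-> -> ->]]; split; ring.
Qed.

Lemma rank1_product L L' A B C D E F : plane_curve 1 L -> plane_curve 1 L' ->
  quad A B C D E F = L * L' -> rank1_quad A B C D E F -> proportional L L'.
Proof.
case=> /homog1_lin_form [g ->] g0 [/homog1_lin_form [h ->] h0].
rewrite mul_lin_form => /quad_inj [[-> -> ->] [-> -> ->]] [E01 E02 E12].
have nz (f : 'rV[K]_3) : lin_form f != 0 -> f != 0.
  by apply: contraNneq => ->; rewrite /lin_form big1 // => i _; rewrite mxE scale0r.
have sq (x y : K) : 4 * (x * y) = (x + y) ^+ 2 -> x = y.
  move=> Exy; have : (x - y) ^+ 2 = 0.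
    by transitivity ((x + y) ^+ 2 - 4 * (x * y)); [ring|rewrite Exy subrr].
  by move/eqP; rewrite expf_eq0 /= subr_eq0 => /eqP.
apply/proportional_lin_form; apply: cross_proportional (nz _ g0) (nz _ h0) _ _ _; apply: sq.
- by rewrite -E01; ring.
- by rewrite -E02; ring.
- by rewrite -E12; ring.
Qed.

Lemma tangent_cone_quad (F : {mpoly K[3]}) p : tangent_cone F p =
  quad (F^`M(i0)^`M(i0)).@[p 0] (F^`M(i1)^`M(i1)).@[p 0] (F^`M(i2)^`M(i2)).@[p 0]
   (2 * (F^`M(i1)^`M(i2)).@[p 0]) (2 * (F^`M(i0)^`M(i2)).@[p 0]) (2 * (F^`M(i0)^`M(i1)).@[p 0]).
Proof.
rewrite /tangent_cone; have : forall i j, (F^`M(i)^`M(j)).@[p 0] = (F^`M(j)^`M(i)).@[p 0].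
  by move=> i j; rewrite mderiv_comm.
move: (fun i j => (F^`M(i)^`M(j)).@[p 0]) => h hC.
rewrite !big_ord3 /= (hC i1 i0) (hC i2 i0) (hC i2 i1).
by rewrite /quad -!mul_mpolyC !mpolyCM (_ : 2%:MP = 2); [ring|rewrite mpolyC_nat].
Qed.

Lemma tangent_cone_nodal (al be ga de ep ze : K) :
  let T := tangent_cone (nodal_quartic al be ga de ep ze) in
  [/\ T (row3 1 0 0) = quad 0 (2 * ga) (2 * be) (2 * de) 0 0,
      T (row3 0 1 0) = quad (2 * ga) 0 (2 * al) 0 (2 * ep) 0
    & T (row3 0 0 1) = quad (2 * be) (2 * al) 0 0 0 (2 * ze)].
Proof.
set F := nodal_quartic al be ga de ep ze.
pose X i : {mpoly K[3]} := 'X_i.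
have Fx : F^`M(i0) = (2 * be) *: (X i0 * X i2 ^+ 2) + (2 * ga) *: (X i0 * X i1 ^+ 2)
    + (2 * de) *: (X i0 * X i1 * X i2) + ep *: (X i1 ^+ 2 * X i2) + ze *: (X i1 * X i2 ^+ 2).
  rewrite /F /nodal_quartic /X !expr2 !(mderivD, mderivM, mderivZ, mderivXU) /=.
  by rewrite -!mul_mpolyC !mpolyCM (_ : 2%:MP = 2); [ring|rewrite mpolyC_nat].
have Fy : F^`M(i1) = (2 * al) *: (X i1 * X i2 ^+ 2) + (2 * ga) *: (X i0 ^+ 2 * X i1)
    + de *: (X i0 ^+ 2 * X i2) + (2 * ep) *: (X i0 * X i1 * X i2) + ze *: (X i0 * X i2 ^+ 2).
  rewrite /F /nodal_quartic /X !expr2 !(mderivD, mderivM, mderivZ, mderivXU) /=.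
  by rewrite -!mul_mpolyC !mpolyCM (_ : 2%:MP = 2); [ring|rewrite mpolyC_nat].
have Fz : F^`M(i2) = (2 * al) *: (X i1 ^+ 2 * X i2) + (2 * be) *: (X i0 ^+ 2 * X i2)
    + de *: (X i0 ^+ 2 * X i1) + ep *: (X i0 * X i1 ^+ 2) + (2 * ze) *: (X i0 * X i1 * X i2).
  rewrite /F /nodal_quartic /X !expr2 !(mderivD, mderivM, mderivZ, mderivXU) /=.
  by rewrite -!mul_mpolyC !mpolyCM (_ : 2%:MP = 2); [ring|rewrite mpolyC_nat].
have Fxx p : (F^`M(i0)^`M(i0)).@[p 0] = 2 * be * p 0 i2 ^+ 2 + 2 * ga * p 0 i1 ^+ 2
    + 2 * de * (p 0 i1 * p 0 i2).
  rewrite Fx /X !expr2 !(mderivD, mderivM, mderivZ, mderivXU) /=.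
  by rewrite !(mevalD, mevalM, mevalZ, mevalXU, meval0, meval1); ring.
have Fyy p : (F^`M(i1)^`M(i1)).@[p 0] = 2 * al * p 0 i2 ^+ 2 + 2 * ga * p 0 i0 ^+ 2
    + 2 * ep * (p 0 i0 * p 0 i2).
  rewrite Fy /X !expr2 !(mderivD, mderivM, mderivZ, mderivXU) /=.
  by rewrite !(mevalD, mevalM, mevalZ, mevalXU, meval0, meval1); ring.
have Fzz p : (F^`M(i2)^`M(i2)).@[p 0] = 2 * al * p 0 i1 ^+ 2 + 2 * be * p 0 i0 ^+ 2
    + 2 * ze * (p 0 i0 * p 0 i1).
  rewrite Fz /X !expr2 !(mderivD, mderivM, mderivZ, mderivXU) /=.
  by rewrite !(mevalD, mevalM, mevalZ, mevalXU, meval0, meval1); ring.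
have Fxy p : (F^`M(i0)^`M(i1)).@[p 0] = 4 * ga * p 0 i0 * p 0 i1
    + 2 * de * p 0 i0 * p 0 i2 + 2 * ep * p 0 i1 * p 0 i2 + ze * p 0 i2 ^+ 2.
  rewrite Fx /X !expr2 !(mderivD, mderivM, mderivZ, mderivXU) /=.
  by rewrite !(mevalD, mevalM, mevalZ, mevalXU, meval0, meval1); ring.
have Fxz p : (F^`M(i0)^`M(i2)).@[p 0] = 4 * be * p 0 i0 * p 0 i2
    + 2 * de * p 0 i0 * p 0 i1 + ep * p 0 i1 ^+ 2 + 2 * ze * p 0 i1 * p 0 i2.
  rewrite Fx /X !expr2 !(mderivD, mderivM, mderivZ, mderivXU) /=.
  by rewrite !(mevalD, mevalM, mevalZ, mevalXU, meval0, meval1); ring.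
have Fyz p : (F^`M(i1)^`M(i2)).@[p 0] = 4 * al * p 0 i1 * p 0 i2
    + de * p 0 i0 ^+ 2 + 2 * ep * p 0 i0 * p 0 i1 + 2 * ze * p 0 i0 * p 0 i2.
  rewrite Fy /X !expr2 !(mderivD, mderivM, mderivZ, mderivXU) /=.
  by rewrite !(mevalD, mevalM, mevalZ, mevalXU, meval0, meval1); ring.
split; rewrite tangent_cone_quad Fxx Fyy Fzz Fxy Fxz Fyz !row3E; congr quad; ring.
Qed.

End TangentCones.

Section Bases.

Variable K : closedFieldType.
Implicit Types (x y z p q : 'rV[K]_3) (M : 'M[K]_3).

Definition rows3 x y z : 'M[K]_3 := \matrix_(i, j) (nth 0 [:: x; y; z] i) 0 j.

Lemma mul_rows3 x y z p : p *m rows3 x y z = p 0 i0 *: x + p 0 i1 *: y + p 0 i2 *: z.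
Proof. by apply/rowP => j; rewrite mxE big_ord3 !mxE. Qed.

Lemma e0_rows3 x y z : row3 1 0 0 *m rows3 x y z = x.
Proof. by rewrite mul_rows3 !row3E !scale0r scale1r !addr0. Qed.
Lemma e1_rows3 x y z : row3 0 1 0 *m rows3 x y z = y.
Proof. by rewrite mul_rows3 !row3E !scale0r scale1r !addr0 add0r. Qed.
Lemma e2_rows3 x y z : row3 0 0 1 *m rows3 x y z = z.
Proof. by rewrite mul_rows3 !row3E !scale0r scale1r !add0r. Qed.

Lemma rows3_unit x y z : (forall p, p *m rows3 x y z = 0 -> p = 0) -> rows3 x y z \in unitmx.
Proof.
move=> inj; rewrite unitmxE unitfE; apply/negP => /det0P [p p0 pM].
by rewrite (inj _ pM) eqxx in p0.
Qed.

Lemma det_rows3 x y z : \det (rows3 x y z) = \sum_i cross 1 x y 0 i * z 0 i.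
Proof.
rewrite (row3_eta x) (row3_eta y) (row3_eta z).
move: (x 0 i0) (x 0 i1) (x 0 i2) (y 0 i0) (y 0 i1) (y 0 i2) (z 0 i0) (z 0 i1) (z 0 i2).
move=> x0 x1 x2 y0 y1 y2 z0 z1 z2.
rewrite (expand_det_row _ i2) big_ord3 /cofactor !(expand_det_row _ ord0).
rewrite !big_ord3 /= /cofactor !big_ord_recl !big_ord0 /cofactor !det_mx11 !mxE /=.
by rewrite /bump /=; ring.
Qed.

Lemma complete_basis x y : x != 0 -> y != 0 -> ~ proportional x y ->
  exists z, rows3 x y z \in unitmx.
Proof.
move=> x0 y0 nxy; have /rV0Pn [i ci] : cross 1 x y != 0.
  apply/negP => /eqP /rowP c0; apply: nxy.
  have [E0 E1 E2] : [/\ cross 1 x y 0 i0 = 0, cross 1 x y 0 i1 = 0 & cross 1 x y 0 i2 = 0].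
    by rewrite !c0 !mxE.
  rewrite !row3E !mul1r in E0 E1 E2.
  apply: cross_proportional => //; apply/eqP; rewrite -subr_eq0; apply/eqP => //.
  by apply: oppr_inj; rewrite opprB oppr0.
exists (delta_mx 0 i); rewrite unitmxE unitfE det_rows3 (bigD1 i) //= big1 ?addr0.
  by move: ci; rewrite !mxE /= !eqxx mulr1.
by move=> j ji; rewrite [delta_mx _ _ _ _]mxE (negbTE ji) andbF mulr0.
Qed.

End Bases.

Section NormalForm.

Variable K : closedFieldType.
Hypothesis two0 : 2 != 0 :> K.

Let e0 : 'rV[K]_3 := row3 1 0 0.
Let e1 : 'rV[K]_3 := row3 0 1 0.
Let e2 : 'rV[K]_3 := row3 0 0 1.

Let mpolyC_expn (x : K) n : (x ^+ n)%:MP = x%:MP ^+ n :> {mpoly K[3]}.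
Proof. exact: rmorphXn. Qed.

Lemma lin_sub_scale n (s : K) (M : 'M[K]_3) A : A \is n.-homog ->
  lin_sub (s *: M) A = s ^+ n *: lin_sub M A.
Proof.
move=> hA; rewrite -mul_mpolyC mpolyC_expn /lin_sub -(mmap_homog _ _ _ hA).
apply: eq_mmap => j; rewrite mulr_sumr; apply: eq_bigr => i _.
by rewrite mxE mul_mpolyC scalerA.
Qed.

Lemma lin_sub_diag (s1 s2 s3 al be ga de ep ze : K) :
  lin_sub (diag_mx (row3 s1 s2 s3)) (nodal_quartic al be ga de ep ze) =
  nodal_quartic (al * s2 ^+ 2 * s3 ^+ 2) (be * s1 ^+ 2 * s3 ^+ 2) (ga * s1 ^+ 2 * s2 ^+ 2)
    (de * s1 ^+ 2 * s2 * s3) (ep * s1 * s2 ^+ 2 * s3) (ze * s1 * s2 * s3 ^+ 2).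
Proof.
have X0 : lin_sub (diag_mx (row3 s1 s2 s3)) 'X_i0 = s1 *: 'X_i0.
  by rewrite lin_subX big_ord3 /= !mxE /= !mulr1n !mulr0n !scale0r !addr0.
have X1 : lin_sub (diag_mx (row3 s1 s2 s3)) 'X_i1 = s2 *: 'X_i1.
  by rewrite lin_subX big_ord3 /= !mxE /= !mulr1n !mulr0n !scale0r !addr0 add0r.
have X2 : lin_sub (diag_mx (row3 s1 s2 s3)) 'X_i2 = s3 *: 'X_i2.
  by rewrite lin_subX big_ord3 /= !mxE /= !mulr1n !mulr0n !scale0r !add0r.
rewrite /nodal_quartic !rmorphD /= !lin_subZ !rmorphXn /= !rmorphM /= X0 X1 X2.
by rewrite -!mul_mpolyC !(mpolyCM, mpolyC_expn); ring.
Qed.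

Lemma normal_quartic_nodal (a c d : K) : normal_quartic a c d =
  nodal_quartic 1 1 ((c - d) ^+ 2 - a * (c - d) + c) (2 * (c - d) - a)
    (a - 2 * (c - d) - 1) (- 2).
Proof.
rewrite /normal_quartic /nodal_quartic -!mul_mpolyC.
rewrite !(mpolyCD, mpolyCB, mpolyCM, mpolyC_expn, mpolyCN) mpolyC1.
ring.
Qed.

Lemma meval_nodal (al be ga de ep ze : K) (p : 'rV[K]_3) :
  (nodal_quartic al be ga de ep ze).@[p 0] =
  al * (p 0 i1 * p 0 i2) ^+ 2 + be * (p 0 i0 * p 0 i2) ^+ 2 + ga * (p 0 i0 * p 0 i1) ^+ 2
  + p 0 i0 * p 0 i1 * p 0 i2 * (de * p 0 i0 + ep * p 0 i1 + ze * p 0 i2).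
Proof.
rewrite /nodal_quartic !expr2 !(mevalD, mevalM, mevalZ, mevalXU); ring.
Qed.

Lemma nodal_quartic_homog (al be ga de ep ze : K) :
  nodal_quartic al be ga de ep ze \is 4.-homog.
Proof.
have h1 i : ('X_i : {mpoly K[3]}) \is 1.-homog by apply: homogX.
have h2 i j : ('X_i * 'X_j : {mpoly K[3]}) \is 2.-homog by apply: (@dhomogM _ _ _ 1 _ 1).
have h4 i j k l : ('X_i * 'X_j * ('X_k * 'X_l) : {mpoly K[3]}) \is 4.-homog.
  by apply: (@dhomogM _ _ _ 2 _ 2).
by rewrite /nodal_quartic !expr2; do !apply: rpredD; apply: rpredZ; apply: h4.
Qed.

Variables (Q : {mpoly K[3]}) (x1 x2 y zo : 'rV[K]_3).
Hypotheses (hQ : Q \is 4.-homog) (irr : irreducible_elt Q).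
Hypotheses (node1 : node Q x1) (node2 : node Q x2) (x12 : ~ proportional x1 x2).
Hypotheses (cuspy : cusp Q y) (smooth_zo : smooth_point Q zo).

Let nz p : singular_point Q p -> p != 0. Proof. by case=> [[]]. Qed.

Let x1_0 : x1 != 0. Proof. by apply: nz; case: node1. Qed.
Let x2_0 : x2 != 0. Proof. by apply: nz; case: node2. Qed.
Let y_0 : y != 0. Proof. by apply: nz; case: cuspy. Qed.

(** The tangent cone has rank 1 at a cusp, and not at a node. *)
Lemma node_not_cusp p q : node Q p -> cusp Q q -> ~ proportional p q.
Proof.
case=> _ [L [L' [hL hL' nLL' TE]]] [_ [L1 [hL1 T1E _]]] [l l0 Epq]; apply: nLL'.
have T := tangent_cone_quad Q p; rewrite TE in T; apply: (rank1_product hL hL' (esym T)).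
move: T1E; rewrite Epq (tangent_cone_scale _ _ hQ) tangent_cone_quad quadZ.
case: hL1 => hL1 _ /(rank1_square hL1) [E1 E2 E3].
have l4 : l ^+ 2 * l ^+ 2 != 0 by rewrite mulf_neq0 ?expf_neq0.
split; apply: (mulfI l4).
- by rewrite [RHS](_ : _ = (l ^+ 2 * (2 * Q^`M(i0)^`M(i1).@[p 0])) ^+ 2); [rewrite -E1|]; ring.
- by rewrite [RHS](_ : _ = (l ^+ 2 * (2 * Q^`M(i0)^`M(i2).@[p 0])) ^+ 2); [rewrite -E2|]; ring.
- by rewrite [RHS](_ : _ = (l ^+ 2 * (2 * Q^`M(i1)^`M(i2).@[p 0])) ^+ 2); [rewrite -E3|]; ring.
Qed.

Let sing_sub (M : 'M[K]_3) q : M \in unitmx -> singular_point Q (q *m M) ->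
  singular_point (lin_sub M Q) q.
Proof.
move=> uM /singular_pointE [Qq gq]; apply/singular_pointE; split.
  exact/(on_curve_lin_sub uM).
by rewrite grad_lin_sub gq mul0mx.
Qed.

(** A line through three double points would be a component. *)
Lemma double_points_not_collinear al be : al != 0 -> be != 0 ->
  ~ singular_point Q (al *: x1 + be *: x2).
Proof.
move=> al0 be0 s3; have [z uM] := complete_basis x1_0 x2_0 x12.
set M := rows3 x1 x2 z in uM.
have s1 : singular_point (lin_sub M Q) e0.
  by apply: sing_sub => //; rewrite /M e0_rows3; case: node1.
have s2 : singular_point (lin_sub M Q) e1.
  by apply: sing_sub => //; rewrite /M e1_rows3; case: node2.
have {}s3 : singular_point (lin_sub M Q) (row3 al be 0).
  by apply: sing_sub => //; rewrite /M mul_rows3 !row3E scale0r addr0.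
have [f [A [hA EQ]]] := homog_split (lin_sub_homog M hQ).
rewrite !big_ord_recl big_ord0 /= !subn0 /bump /= !add1n /= in EQ.
have ev (p : 'rV[K]_3) : p 0 i2 = 0 -> (lin_sub M Q).@[p 0] =
    f 0%N * p 0 i1 ^+ 4 + f 1%N * p 0 i0 * p 0 i1 ^+ 3 + f 2%N * p 0 i0 ^+ 2 * p 0 i1 ^+ 2
    + f 3%N * p 0 i0 ^+ 3 * p 0 i1 + f 4%N * p 0 i0 ^+ 4.
  move=> p2; rewrite EQ !(mevalD, mevalZ, mevalM, mevalXU, rmorphXn, meval0) /= !mevalXU p2; ring.
have evx (p : 'rV[K]_3) : p 0 i2 = 0 -> ((lin_sub M Q)^`M(i0)).@[p 0] =
    f 1%N * p 0 i1 ^+ 3 + 2 * f 2%N * p 0 i0 * p 0 i1 ^+ 2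
    + 3 * f 3%N * p 0 i0 ^+ 2 * p 0 i1 + 4 * f 4%N * p 0 i0 ^+ 3.
  move=> p2; rewrite EQ !exprS !expr0 !(mderivD, mderivZ, mderivM, mderivXU, mderivC) /= -?mpolyC1 ?mderivC.
  rewrite !(mevalD, mevalZ, mevalM, mevalXU, meval0, mevalC, meval1) /= p2; ring.
have evy (p : 'rV[K]_3) : p 0 i2 = 0 -> ((lin_sub M Q)^`M(i1)).@[p 0] =
    4 * f 0%N * p 0 i1 ^+ 3 + 3 * f 1%N * p 0 i0 * p 0 i1 ^+ 2
    + 2 * f 2%N * p 0 i0 ^+ 2 * p 0 i1 + f 3%N * p 0 i0 ^+ 3.
  move=> p2; rewrite EQ !exprS !expr0 !(mderivD, mderivZ, mderivM, mderivXU, mderivC) /= -?mpolyC1 ?mderivC.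
  rewrite !(mevalD, mevalZ, mevalM, mevalXU, meval0, mevalC, meval1) /= p2; ring.
have f4 : f 4%N = 0.
  by case: s1 => [[_ <-] _]; rewrite ev !row3E //; ring.
have f0 : f 0%N = 0.
  by case: s2 => [[_ <-] _]; rewrite ev !row3E //; ring.
have f3 : f 3%N = 0.
  by case: s1 => [_ /(_ i1) <-]; rewrite evy !row3E //; ring.
have f1 : f 1%N = 0.
  by case: s2 => [_ /(_ i0) <-]; rewrite evx !row3E //; ring.
have f2 : f 2%N = 0.
  apply: (mulIf (mulf_neq0 (expf_neq0 2 al0) (expf_neq0 2 be0))); rewrite mul0r.
  by case: s3 => [[_ <-] _]; rewrite ev !row3E // f0 f1 f3 f4; ring.
rewrite f0 f1 f2 f3 f4 !scale0r !add0r in EQ.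
by apply: (irreducible_lin_sub uM irr (homogX K i2) hA); rewrite EQ.
Qed.

Lemma double_points_independent : rows3 x1 x2 y \in unitmx.
Proof.
have sy : singular_point Q y by case: cuspy.
have x1y := node_not_cusp node1 cuspy; have x2y := node_not_cusp node2 cuspy.
apply: rows3_unit => p; rewrite mul_rows3 => E.
have prop (x x' : 'rV[K]_3) (r s : K) : x != 0 -> x' != 0 -> r *: x + s *: x' = 0 ->
    ~ proportional x x' -> r = 0 /\ s = 0.
  move=> xn0 xn0' Ers nxx'; have s0 : s = 0.
    apply/eqP; apply: contra_notT nxx' => s0; exists (- (r / s)).
      rewrite oppr_eq0 mulf_neq0 ?invr_neq0 //; apply: contraNneq xn0' => r0.
      by move/eqP: Ers; rewrite r0 scale0r add0r scaler_eq0 (negbTE s0).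
    apply: (scalerI s0); rewrite scalerA mulrN mulrCA mulfV // mulr1 scaleNr.
    by apply/eqP; rewrite -addr_eq0 addrC Ers.
  split=> //; move/eqP: Ers; rewrite s0 scale0r addr0 scaler_eq0 (negbTE xn0) orbF.
  by move/eqP.
have [p2|p2] := eqVneq (p 0 i2) 0.
  rewrite p2 scale0r addr0 in E; have [p0 p1] := prop _ _ _ _ x1_0 x2_0 E x12.
  by apply/rowP; apply: forall_ord3; rewrite mxE.
have [p0|p0] := eqVneq (p 0 i0) 0.
  rewrite p0 scale0r add0r in E; have [p1 p2_0] := prop _ _ _ _ x2_0 y_0 E x2y.
  by rewrite p2_0 eqxx in p2.
have [p1|p1] := eqVneq (p 0 i1) 0.
  rewrite p1 scale0r addr0 in E; have [_ p2_0] := prop _ _ _ _ x1_0 y_0 E x1y.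
  by rewrite p2_0 eqxx in p2.
case: (@double_points_not_collinear (- (p 0 i0 / p 0 i2)) (- (p 0 i1 / p 0 i2))).
- by rewrite oppr_eq0 mulf_neq0 ?invr_neq0.
- by rewrite oppr_eq0 mulf_neq0 ?invr_neq0.
rewrite (_ : _ + _ = y) //; apply: (scalerI p2); rewrite scalerDr !scalerA !mulrN.
rewrite !(mulrCA (p 0 i2)) !mulfV // !mulr1 !scaleNr -opprD.
by apply/eqP; rewrite eq_sym -addr_eq0 addrC E.
Qed.

Let M0 := rows3 x1 x2 y.

(* The standard quadratic transformation takes the quartic to a conic
   (la U + mu V)^2 + W (de V + ep U + ga W). *)
Let nodal_form : exists la mu ga de ep,
  [/\ lin_sub M0 Q = nodal_quartic (la ^+ 2) (mu ^+ 2) ga de ep (2 * la * mu),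
      [/\ la != 0, mu != 0 & ga != 0],
      de ^+ 2 - 4 * mu ^+ 2 * ga != 0, ep ^+ 2 - 4 * la ^+ 2 * ga != 0
    & de * la - ep * mu != 0].
Proof.
have uM := double_points_independent; rewrite -/M0 in uM.
have s1 : singular_point (lin_sub M0 Q) e0.
  by apply: sing_sub => //; rewrite /M0 e0_rows3; case: node1.
have s2 : singular_point (lin_sub M0 Q) e1.
  by apply: sing_sub => //; rewrite /M0 e1_rows3; case: node2.
have s3 : singular_point (lin_sub M0 Q) e2.
  by apply: sing_sub => //; rewrite /M0 e2_rows3; case: cuspy.
have [al [be [ga [de [ep [ze EF]]]]]] := singular_quartic (lin_sub_homog M0 hQ) s1 s2 s3.
have [T1 T2 T3] := tangent_cone_nodal al be ga de ep ze.
have four0 : 4 != 0 :> K by rewrite (_ : 4 = 2 * 2) ?mulf_neq0 // -natrM.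
have cone p q A B C D E F : node Q p -> q *m M0 = p ->
    tangent_cone (nodal_quartic al be ga de ep ze) q = quad A B C D E F ->
    ~ rank1_quad A B C D E F.
  case=> _ [L [L' [[hL L0] [hL' L0'] nLL' TE]]] qE; rewrite -EF tangent_cone_lin_sub qE TE.
  rewrite rmorphM /= => /esym Equad /(rank1_product _ _ Equad) [||l l0 E1].
  - by split; rewrite ?lin_sub_homogE ?lin_sub_eq0.
  - by split; rewrite ?lin_sub_homogE ?lin_sub_eq0.
  by apply: nLL'; exists l => //; rewrite -(lin_subK L' uM) E1 lin_subZ lin_subK.
have n1 : de ^+ 2 - 4 * be * ga != 0.
  apply/negP => /eqP E; apply: (cone _ _ _ _ _ _ _ _ node1 (e0_rows3 _ _ _) T1).
  split; [ring|ring|]; transitivity (4 * (de ^+ 2 - (de ^+ 2 - 4 * be * ga))); first by ring.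
  by rewrite E; ring.
have n2 : ep ^+ 2 - 4 * al * ga != 0.
  apply/negP => /eqP E; apply: (cone _ _ _ _ _ _ _ _ node2 (e1_rows3 _ _ _) T2).
  split; [ring| |ring]; transitivity (4 * (ep ^+ 2 - (ep ^+ 2 - 4 * al * ga))); first by ring.
  by rewrite E; ring.
have n3 : ze ^+ 2 = 4 * al * be.
  case: cuspy => _ [L [[hL _] TE _]].
  have := T3; rewrite -EF tangent_cone_lin_sub e2_rows3 TE rmorphXn /= => /esym.
  case/(rank1_square (lin_sub_homog M0 hL)) => E1 _ _.
  by apply: (mulfI four0); transitivity ((2 * ze) ^+ 2); [ring|rewrite -E1; ring].
have fact A B m n : A \is m.+1.-homog -> B \is n.+1.-homog ->
    nodal_quartic al be ga de ep ze = A * B -> False.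
  by move=> hA hB; rewrite -EF; apply: irreducible_lin_sub uM irr hA hB.
have h1 i : ('X_i : {mpoly K[3]}) \is 1.-homog by apply: homogX.
have h2 i j : ('X_i * 'X_j : {mpoly K[3]}) \is 2.-homog by apply: (@dhomogM _ _ _ 1 _ 1).
have h3 i j k : ('X_i * ('X_j * 'X_k) : {mpoly K[3]}) \is 3.-homog.
  by apply: (@dhomogM _ _ _ 1 _ 2).
have al0 : al != 0.
  apply/negP => /eqP al0; apply: (fact 'X_i0 (be *: ('X_i0 * ('X_i2 * 'X_i2)) +
    ga *: ('X_i0 * ('X_i1 * 'X_i1)) + de *: ('X_i0 * ('X_i1 * 'X_i2)) +
    ep *: ('X_i1 * ('X_i1 * 'X_i2)) + ze *: ('X_i1 * ('X_i2 * 'X_i2))) 0%N 2%N).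
  - exact: h1.
  - by do !apply: rpredD; apply: rpredZ; apply: h3.
  by rewrite /nodal_quartic al0 -!mul_mpolyC mpolyC0; ring.
have be0 : be != 0.
  apply/negP => /eqP be0; apply: (fact 'X_i1 (al *: ('X_i1 * ('X_i2 * 'X_i2)) +
    ga *: ('X_i1 * ('X_i0 * 'X_i0)) + de *: ('X_i0 * ('X_i0 * 'X_i2)) +
    ep *: ('X_i0 * ('X_i1 * 'X_i2)) + ze *: ('X_i0 * ('X_i2 * 'X_i2))) 0%N 2%N).
  - exact: h1.
  - by do !apply: rpredD; apply: rpredZ; apply: h3.
  by rewrite /nodal_quartic be0 -!mul_mpolyC mpolyC0; ring.
have ga0 : ga != 0.
  apply/negP => /eqP ga0; apply: (fact 'X_i2 (al *: ('X_i1 * ('X_i1 * 'X_i2)) +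
    be *: ('X_i0 * ('X_i0 * 'X_i2)) + de *: ('X_i0 * ('X_i0 * 'X_i1)) +
    ep *: ('X_i0 * ('X_i1 * 'X_i1)) + ze *: ('X_i0 * ('X_i1 * 'X_i2))) 0%N 2%N).
  - exact: h1.
  - by do !apply: rpredD; apply: rpredZ; apply: h3.
  by rewrite /nodal_quartic ga0 -!mul_mpolyC mpolyC0; ring.
have [la la2] := poly_sqrt_const al; have [mu' mu2'] := poly_sqrt_const be.
have [mu mu2 zeE] : exists2 mu, mu ^+ 2 = be & ze = 2 * la * mu.
  have : ze ^+ 2 == (2 * la * mu') ^+ 2.
    by rewrite n3 -la2 -mu2'; apply/eqP; ring.
  rewrite eqf_sqr => /orP [] /eqP ->; first by exists mu'.
  by exists (- mu'); rewrite ?sqrrN // mulrN.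
have la0 : la != 0 by apply: contraNneq al0 => l0; rewrite -la2 l0 expr0n.
have mu0 : mu != 0 by apply: contraNneq be0 => l0; rewrite -mu2 l0 expr0n.
exists la, mu, ga, de, ep; rewrite la2 mu2 -zeE; split=> //.
apply/negP => /eqP Edeg; pose ka := ep / la.
have epE : ep = ka * la by rewrite divfK.
have deE : de = ka * mu.
  by apply: (mulIf la0); apply/eqP; rewrite -subr_eq0 -[X in _ == X]Edeg epE; apply/eqP; ring.
have [r gaE] : exists r, ga = r * (- ka - r).
  have /closed_rootP [r] : size ('X^2 + (ka%:P * 'X + ga%:P) : {poly K}) != 1%N.
    rewrite size_polyDl size_polyXn // (leq_ltn_trans (size_polyD _ _)) // gtn_max.
    rewrite mul_polyC (leq_ltn_trans (size_scale_leq _ _)) ?size_polyX //=.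
    by rewrite (leq_ltn_trans (size_polyC_leq1 _)).
  rewrite rootE !hornerE /= => /eqP E; exists r; apply/eqP.
  rewrite -subr_eq0; apply/eqP; rewrite -[RHS]E; ring.
pose T := la *: ('X_i1 * 'X_i2) + mu *: ('X_i0 * 'X_i2) : {mpoly K[3]}.
have hT t : T - t *: ('X_i0 * 'X_i1) \is 2.-homog.
  by apply: rpredB; [apply: rpredD|]; apply: rpredZ; apply: h2.
apply: (fact _ _ 1%N 1%N (hT r) (hT (- ka - r))).
rewrite /nodal_quartic /T -la2 -mu2 zeE gaE deE epE -!mul_mpolyC.
rewrite !(mpolyCM, mpolyC_expn, mpolyCB, mpolyCN) (_ : 2%:MP = 2); first by ring.
by rewrite mpolyC_nat.
Qed.

Lemma normal_form : exists a c d (M : 'M[K]_3) kap l1 l2 l3,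
  [/\ [/\ c != 0, d != 0, res_uv a c d != 0, a ^+ 2 - 4 * c != 0
        & (a - 1) ^+ 2 - 4 * d != 0],
      [/\ M \in unitmx, kap != 0 & lin_sub M Q = kap *: normal_quartic a c d],
      [/\ l1 != 0, l2 != 0 & l3 != 0],
      [/\ x1 = l1 *: (row3 1 0 0 *m M), x2 = l2 *: (row3 0 1 0 *m M)
        & y = l3 *: (row3 0 0 1 *m M)]
    & zo = point_infty c d *m M].
Proof.
have uM0 := double_points_independent; rewrite -/M0 in uM0.
have [la [mu [ga [de [ep [EF [la0 mu0 ga0] n1 n2 dete]]]]]] := nodal_form.
have [xi xi0 xiE] : exists2 xi, xi != 0 & xi = (de * la - ep * mu) / (la * mu).
  by exists ((de * la - ep * mu) / (la * mu)); rewrite ?mulf_neq0 ?invr_neq0 ?mulf_neq0.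
pose D := diag_mx (row3 la (- mu) xi); pose M1 := D *m M0.
have uD : D \in unitmx.
  rewrite unitmxE unitfE det_diag big_ord3 /= !row3E.
  by rewrite !mulf_neq0 ?oppr_eq0.
have uM1 : M1 \in unitmx by rewrite unitmx_mul uD.
have n0 : - mu != 0 by rewrite oppr_eq0.
have D0 : row3 1 0 0 *m D = la *: row3 1 0 0.
  by apply/rowP; apply: forall_ord3; rewrite mul_mx_diag !mxE /=; ring.
have D1 : row3 0 1 0 *m D = (- mu) *: row3 0 1 0.
  by apply/rowP; apply: forall_ord3; rewrite mul_mx_diag !mxE /=; ring.
have D2 : row3 0 0 1 *m D = xi *: row3 0 0 1.
  by apply/rowP; apply: forall_ord3; rewrite mul_mx_diag !mxE /=; ring.
have r0 : row3 1 0 0 *m M1 = la *: x1 by rewrite mulmxA D0 -scalemxAl e0_rows3.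
have r1 : row3 0 1 0 *m M1 = (- mu) *: x2 by rewrite mulmxA D1 -scalemxAl e1_rows3.
have r2 : row3 0 0 1 *m M1 = xi *: y by rewrite mulmxA D2 -scalemxAl e2_rows3.
pose ga' := ga / xi ^+ 2; pose de' := - de / (mu * xi); pose ep' := ep / (la * xi).
have sum1 : ep' = - 1 - de'.
  rewrite /ep' /de' xiE; field.
  by rewrite la0 mu0 dete.
pose k1 := (la * mu * xi) ^+ 2.
have k10 : k1 != 0 by rewrite /k1 expf_neq0 // !mulf_neq0.
have EF1 : lin_sub M1 Q = k1 *: nodal_quartic 1 1 ga' de' ep' (- 2).
  rewrite -lin_sub_comp EF lin_sub_diag.
  have -> : k1 *: nodal_quartic 1 1 ga' de' ep' (- 2) = nodal_quartic (k1 * 1) (k1 * 1)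
      (k1 * ga') (k1 * de') (k1 * ep') (k1 * - 2).
    by rewrite /nodal_quartic !scalerDr !scalerA.
  congr nodal_quartic; rewrite /k1 /ga' /de' /ep'.
  - by ring.
  - by ring.
  - by field.
  - by field; rewrite mu0 xi0.
  - by field; rewrite la0 xi0.
  - by ring.
have [[zo0 Qzo] _] := smooth_zo.
pose p := zo *m invmx M1; have pM : p *m M1 = zo by rewrite mulmxKV.
have Fp : (nodal_quartic 1 1 ga' de' ep' (- 2)).@[p 0] = 0.
  move: Qzo; rewrite -pM -meval_lin_sub EF1 mevalZ => /eqP.
  by rewrite mulf_eq0 (negbTE k10) => /eqP.
have ga'0 : ga' != 0 by rewrite /ga' mulf_neq0 ?invr_neq0 ?expf_neq0.
have not_sing q (l : K) : singular_point Q q -> zo = l *: q -> False.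
  move=> /singular_pointE [_ gq] zE; have [_ gz] := (smooth_pointE _ _).1 smooth_zo.
  by move: gz; rewrite zE (grad_scale _ _ hQ) gq scaler0 eqxx.
have s1 : singular_point Q x1 by case: node1.
have s2 : singular_point Q x2 by case: node2.
have s3 : singular_point Q y by case: cuspy.
have pE : p = p 0 i0 *: row3 1 0 0 + p 0 i1 *: row3 0 1 0 + p 0 i2 *: row3 0 0 1.
  by apply/rowP; apply: forall_ord3; rewrite !mxE /=; ring.
have not_e i j : i != j -> ~ (p 0 i = 0 /\ p 0 j = 0).
  have zE : zo = p 0 i0 *: (la *: x1) + p 0 i1 *: (- mu *: x2) + p 0 i2 *: (xi *: y).
    by rewrite -pM {1}pE !mulmxDl -!scalemxAl r0 r1 r2.
  have ne01 : ~ (p 0 i0 = 0 /\ p 0 i1 = 0).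
    case=> p0 p1; apply: (not_sing y (p 0 i2 * xi)) => //.
    by rewrite zE p0 p1 !scale0r !add0r scalerA.
  have ne02 : ~ (p 0 i0 = 0 /\ p 0 i2 = 0).
    case=> p0 p2; apply: (not_sing x2 (p 0 i1 * - mu)) => //.
    by rewrite zE p0 p2 !scale0r add0r addr0 scalerA.
  have ne12 : ~ (p 0 i1 = 0 /\ p 0 i2 = 0).
    case=> p1 p2; apply: (not_sing x1 (p 0 i0 * la)) => //.
    by rewrite zE p1 p2 !scale0r !addr0 scalerA.
  move: i j; apply: forall_ord3; apply: forall_ord3 => // _ [pi pj];
    by [apply: ne01|apply: ne02|apply: ne12].
have [p0 p1 p2] : [/\ p 0 i0 != 0, p 0 i1 != 0 & p 0 i2 != 0].
  rewrite meval_nodal in Fp; split; apply/negP => /eqP pz; rewrite pz in Fp.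
  - move/eqP: Fp; rewrite !(mul0r, mul1r, addr0, expr0n, mulr0) /= sqrf_eq0 mulf_eq0.
    by case/orP => /eqP pz'; [apply: (not_e i0 i1)|apply: (not_e i0 i2)].
  - move/eqP: Fp; rewrite !(mul0r, mul1r, addr0, expr0n, mulr0, add0r) /= sqrf_eq0 mulf_eq0.
    by case/orP => /eqP pz'; [apply: (not_e i0 i1)|apply: (not_e i1 i2)].
  - move/eqP: Fp; rewrite !(mul0r, mul1r, addr0, expr0n, mulr0, add0r) /=.
    rewrite mulf_eq0 (negbTE ga'0) /= sqrf_eq0 mulf_eq0.
    by case/orP => /eqP pz'; [apply: (not_e i0 i2)|apply: (not_e i1 i2)].
pose c := p 0 i2 / p 0 i0; pose d := p 0 i2 / p 0 i1; pose k := c - d; pose a := 2 * k - de'.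
have c0 : c != 0 by rewrite /c mulf_neq0 ?invr_neq0.
have d0 : d != 0 by rewrite /d mulf_neq0 ?invr_neq0.
have gaE : ga' = k ^+ 2 - a * k + c.
  have W0 : p 0 i0 * p 0 i1 * (p 0 i0 * p 0 i1) != 0 by rewrite !mulf_neq0.
  apply: (mulIf W0); apply/eqP; rewrite -subr_eq0; apply/eqP; rewrite -[RHS]Fp.
  by rewrite meval_nodal sum1 /a /k /c /d; field; rewrite p0 p1.
have normE : nodal_quartic 1 1 ga' de' ep' (- 2) = normal_quartic a c d.
  rewrite normal_quartic_nodal -/k; congr nodal_quartic.
  - exact: gaE.
  - by rewrite /a; ring.
  - by rewrite sum1 /a; ring.
pose s := p 0 i2 / (c * d); have s0 : s != 0 := mulf_neq0 p2 (invr_neq0 (mulf_neq0 c0 d0)).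
exists a, c, d, (s *: M1), (s ^+ 4 * k1), (s * la)^-1, (s * - mu)^-1, (s * xi)^-1.
split.
- split=> //.
  + by rewrite /res_uv -/k -gaE.
  + rewrite (_ : _ - _ = (de ^+ 2 - 4 * mu ^+ 2 * ga) / (mu * xi) ^+ 2).
      by rewrite mulf_neq0 ?invr_neq0 ?expf_neq0 ?mulf_neq0.
    transitivity (de' ^+ 2 - 4 * ga'); first by rewrite gaE /a; ring.
    by rewrite /de' /ga'; field; rewrite mu0 xi0.
  + rewrite (_ : _ - _ = (ep ^+ 2 - 4 * la ^+ 2 * ga) / (la * xi) ^+ 2).
      by rewrite mulf_neq0 ?invr_neq0 ?expf_neq0 ?mulf_neq0.
    transitivity (ep' ^+ 2 - 4 * ga'); first by rewrite gaE sum1 /a /k; ring.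
    by rewrite /ep' /ga'; field; rewrite la0 xi0.
- split; first by rewrite unitmxZ // unitfE.
    exact: mulf_neq0 (expf_neq0 4 s0) k10.
  by rewrite (lin_sub_scale _ _ hQ) EF1 normE scalerA.
- by split; apply/invr_neq0/mulf_neq0.
- by split; rewrite -scalemxAr ?r0 ?r1 ?r2 !scalerA -mulrA mulVf ?scale1r //; apply: mulf_neq0.
rewrite -pM -scalemxAr scalemxAl; congr (_ *m _); apply/rowP; apply: forall_ord3.
- by rewrite [RHS]mxE /point_infty row3E /s /c /d; field; rewrite p0 p1 p2.
- by rewrite [RHS]mxE /point_infty row3E /s /c /d; field; rewrite p0 p1 p2.
- by rewrite [RHS]mxE /point_infty row3E /s /c /d; field; rewrite p0 p1 p2.
Qed.

End NormalForm.

Theorem theorem1 (R : realType) (Q : {mpoly R[i][3]})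
    (x1 x2 y zo : 'rV[R[i]]_3) :
  plane_curve 4 Q ->
  irreducible_elt Q ->
  node Q x1 -> node Q x2 -> ~ proportional x1 x2 ->
  cusp Q y ->
  (forall p, singular_point Q p ->
     [\/ proportional x1 p, proportional x2 p | proportional y p]) ->
  smooth_point Q zo ->
  let n := conic_count Q x1 x2 y zo in
  [/\ position_s Q zo ->
        [/\ n 1 3, n 2 4, n 3 4, n 4 1 & n 5 1 /\ n 6 1],
      position_b Q zo ->
        [/\ n 1 1, n 2 2, n 3 2, n 4 0 & n 5 1 /\ n 6 0],
      position_sc Q y zo ->
        [/\ n 1 0, n 2 2, n 3 0, n 4 1 & n 5 0 /\ n 6 0]
    & position_sn Q x1 x2 zo ->
        [/\ n 1 1, n 2 0, n 3 2, n 4 0 & n 5 0 /\ n 6 1]]%N.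
Proof.
move=> [hQ _] irr node1 node2 x12 cuspy sing szo n.
have two0 : 2 != 0 :> R[i] by rewrite pnatr_eq0.
have [a [c [d [M [kap [l1 [l2 [l3 []]]]]]]]] :=
  normal_form two0 hQ irr node1 node2 x12 cuspy szo.
move=> [c0 d0 R0 Du0 Dv0] [uM kap0 QE] [l10 l20 l30] [x1E x2E yE] zoE.
have s1 : singular_point Q x1 by case: node1.
have s2 : singular_point Q x2 by case: node2.
have s3 : singular_point Q y by case: cuspy.
have singE p : singular_point Q p <->
    [\/ proportional x1 p, proportional x2 p | proportional y p].
  split; first exact: sing.
  have scale q : singular_point Q q -> proportional q p -> singular_point Q p.
    move=> /singular_pointE [Qq gq] [l l0 ->]; apply/singular_pointE.
    by rewrite (grad_scale _ _ hQ) gq scaler0; split=> //; apply/(on_curve_scale _ hQ l0).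
  by case; apply: scale.
have count i r : number_up_to_scaling (contact_type a c d i) r -> n i r.
  rewrite /n zoE; exact: (conic_count_normal two0 c0 d0 R0 Du0 Dv0 uM kap0 QE
    l10 l20 l30 x1E x2E yE singE).
have [ts tb tsc tsn] := contact_table two0 c0 d0 R0 Du0 Dv0.
split; rewrite zoE => pos.
- have [n1 n2 n3 n4 [n5 n6]] := ts (position_sP two0 c0 d0 R0 Du0 Dv0 uM kap0 QE pos).
  by do !split; apply: count.
- have [n1 n2 n3 n4 [n5 n6]] := tb (position_bP two0 c0 d0 R0 Du0 Dv0 uM kap0 QE pos).
  by do !split; apply: count.
- have [n1 n2 n3 n4 [n5 n6]] := tsc (position_scP c0 d0 uM kap0 QE l30 yE pos).
  by do !split; apply: count.
- have [n1 n2 n3 n4 [n5 n6]] := tsn (position_snP c0 d0 uM kap0 QE l10 l20 x1E x2E pos).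
  by do !split; apply: count.
Qed.
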